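(* Let $n\ge 1$, let $\alpha\in(0,n)$ be real, let $m\in\mathbb{N}$ with $2m>\alpha$, and let $f\in L^p(\mathbb{R}^n)$ with $1\le p<n/\alpha$. Let $$w(x)=(-\Delta)^m\big[(1+|x|^2)^{m-(n+\alpha)/2}\big],\qquad \tilde w(x)=(-\Delta w)(x),$$ and $w_t(x)=t^{-n}w(x/t)$, $\tilde w_t(x)=t^{-n}\tilde w(x/t)$ for $t>0$. Then $$c_{\alpha,m}\,f=\lim_{t\to0}\,\big(I^\alpha f\ast t^{-\alpha}w_t\big),\qquad c_{\alpha,m}=\gamma_n(2m-\alpha),$$ $$d_{\alpha,m}\,f=\int_0^\infty\frac{I^\alpha f\ast\tilde w_t}{t^{1+\alpha}}\,dt,\qquad d_{\alpha,m}=(2m-\alpha)\,c_{\alpha,m},$$ where $\int_0^\infty(\ldots)=\lim_{\varepsilon\to0}\int_\varepsilon^\infty(\ldots)$. The limit in both formulae exists in the $L^p$-norm and in the almost everywhere sense. If, moreover, $f\in C_0(\mathbb{R}^n)$, then it exists in the $\sup$-norm.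
   Context: The Riesz potential of order $\alpha\in(0,n)$ of a function $f$ on $\mathbb{R}^n$ is $$(I^\alpha f)(x)=\frac{1}{\gamma_n(\alpha)}\int_{\mathbb{R}^n}\frac{f(y)\,dy}{|x-y|^{n-\alpha}},\qquad \gamma_n(\alpha)=\frac{2^\alpha\pi^{n/2}\Gamma(\alpha/2)}{\Gamma((n-\alpha)/2)};$$ for $f\in L^p(\mathbb{R}^n)$, $1\le p<n/\alpha$, the integral converges for almost every $x$. The expression $\gamma_n(\beta)=2^\beta\pi^{n/2}\Gamma(\beta/2)/\Gamma((n-\beta)/2)$ is used for all $\beta>0$, with the convention $1/\Gamma(z)=0$ for $z\in\{0,-1,-2,\ldots\}$. $\Delta=\sum_{j=1}^n\partial^2/\partial x_j^2$ is the Laplacian, $\ast$ is convolution on $\mathbb{R}^n$, and $C_0(\mathbb{R}^n)$ is the space of continuous functions on $\mathbb{R}^n$ vanishing at infinity. *)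

(* Defs.v *)
From HB Require Import structures.
From mathcomp Require Import all_boot all_order all_algebra.
From mathcomp Require Import all_classical all_reals all_analysis.

Set Implicit Arguments.
Unset Strict Implicit.
Unset Printing Implicit Defensive.
Import Order.TTheory GRing.Theory Num.Theory.
Import numFieldNormedType.Exports.

Local Open Scope classical_set_scope.
Local Open Scope ring_scope.

(* Conventions.
   R^n is 'rV[R]_n.  Functions are real valued, and the classes of L^p are
   represented by measurable functions.  Integrals written \int are real valued
   (Rintegral): they are total, and take a junk value where the integral does
   not converge. *)

(* The product (equivalently, Borel) sigma-algebra on R^n. *)
Section measurable_rV.
Variables (R : realType) (n : nat).

Let coord (i : 'I_n) (x : 'rV[R]_n) : measurableTypeR R := x ord0 i.

Let rV_set0 : g_sigma_preimage coord set0.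
Proof. exact: sigma_algebra0. Qed.

Let rV_setC A : g_sigma_preimage coord A -> g_sigma_preimage coord (~` A).
Proof. exact: sigma_algebraC. Qed.

Let rV_bigcup (F : (set 'rV[R]_n)^nat) :
  (forall i, g_sigma_preimage coord (F i)) ->
  g_sigma_preimage coord (\bigcup_i (F i)).
Proof. exact: sigma_algebra_bigcup. Qed.

HB.instance Definition _ :=
  @isMeasurable.Build (measure_tuple_display default_measure_display)
    'rV[R]_n (g_sigma_preimage coord) rV_set0 rV_setC rV_bigcup.

Lemma measurable_rV_coord (i : 'I_n) :
  measurable_fun [set: 'rV[R]_n]
    (fun x : 'rV[R]_n => x ord0 i : measurableTypeR R).
Proof.
move=> _ Y mY; rewrite setTI; apply: sub_sigma_algebra => /=.
rewrite -bigcup_seq/=; exists i => /=; first by rewrite mem_index_enum.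
by exists Y => //; rewrite setTI.
Qed.

Lemma measurable_fun_rV d (T : measurableType d) (f : T -> 'rV[R]_n) :
  (forall i,
    measurable_fun [set: T] (fun t => f t ord0 i : measurableTypeR R)) ->
  measurable_fun [set: T] f.
Proof.
move=> mf; apply: (measurability _ (erefl : @measurable _ 'rV[R]_n = <<s _ >>)).
move=> _ [B + <-]; rewrite setTI.
rewrite -bigcup_seq => -[i _ [A mA <-]].
by rewrite setTI -[X in measurable X]setTI; exact: mf.
Qed.

End measurable_rV.

Section lebesgue_rV_cons.
Variables (R : realType) (n : nat).

Definition rV_cons (z : measurableTypeR R * 'rV[R]_n) : 'rV[R]_n.+1 :=
  \row_i (if unlift ord0 i is Some j then z.2 ord0 j else z.1).

Let rV_uncons (x : 'rV[R]_n.+1) : measurableTypeR R * 'rV[R]_n :=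
  (x ord0 ord0, \row_j x ord0 (lift ord0 j)).

Lemma measurable_rV_cons : measurable_fun setT rV_cons.
Proof.
apply: measurable_fun_rV => i; under eq_fun do rewrite mxE.
case: unliftP => [j _|_]; last exact: measurable_fst.
exact: (measurableT_comp (measurable_rV_coord j) measurable_snd).
Qed.

Let measurable_rV_uncons : measurable_fun setT rV_uncons.
Proof.
apply/measurable_fun_pairP; split; first exact: measurable_rV_coord.
apply: measurable_fun_rV => i; rewrite /comp/=.
by under eq_fun do rewrite mxE; exact: measurable_rV_coord.
Qed.

Let rV_consK : cancel rV_cons rV_uncons.
Proof.
move=> [a v]; congr pair; first by rewrite mxE unlift_none.
by apply/rowP => j; rewrite !mxE liftK.
Qed.

Variable mu : {sigma_finite_measure set 'rV[R]_n -> \bar R}.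

Definition lebesgue_rV_cons : set 'rV[R]_n.+1 -> \bar R :=
  pushforward (lebesgue_measure \x mu)%E rV_cons.


Let pushforward_cons : {measure set 'rV[R]_n.+1 -> \bar R} :=
  measure_function_pushforward__canonical__measure_function_Measure
    (lebesgue_measure \x mu)%E measurable_rV_cons.

HB.instance Definition _ := isMeasure.Build _ _ _ lebesgue_rV_cons
  (measure0 pushforward_cons) (measure_ge0 pushforward_cons)
  (@measure_semi_sigma_additive _ _ _ pushforward_cons).

Let lebesgue_rV_cons_sigma_finite : sigma_finite setT lebesgue_rV_cons.
Proof.
have /sigma_finiteP[F [FT ndF Foo]] :=
  sigma_finiteT (@lebesgue_measure R).
have /sigma_finiteP[G [GT ndG Goo]] := sigma_finiteT mu.
exists (fun k => rV_uncons @^-1` (F k `*` G k)).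
  rewrite -preimage_bigcup (_ : \bigcup_k _ = setT) ?preimage_setT//.
  apply/seteqP; split => // -[a v] _.
  have [k _ Fka] : (\bigcup_k F k) a by rewrite -FT.
  have [l _ Glv] : (\bigcup_k G k) v by rewrite -GT.
  exists (maxn k l) => //; split => /=.
    by move: a Fka; exact/subsetPset/ndF/leq_maxl.
  by move: v Glv; exact/subsetPset/ndG/leq_maxr.
move=> k; have [mF Fkoo] := Foo k; have [mG Gkoo] := Goo k; split.
  rewrite -[X in measurable X]setTI; apply: measurable_rV_uncons => //.
  exact: measurableX.
rewrite /lebesgue_rV_cons /pushforward -comp_preimage.
rewrite (_ : rV_uncons \o rV_cons = id); last exact/funext.
by rewrite product_measure1E// lte_mul_pinfty// ge0_fin_numE.
Qed.

HB.instance Definition _ := Measure_isSigmaFinite.Build _ _ _ lebesgue_rV_cons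
  lebesgue_rV_cons_sigma_finite.

End lebesgue_rV_cons.

(* n-fold product of the Lebesgue measure on R; R^0 carries the unit mass. *)
Fixpoint lebesgue_rV (R : realType) (n : nat) :
    {sigma_finite_measure set 'rV[R]_n -> \bar R} :=
  match n with
  | 0 => dirac (0 : 'rV[R]_0)
  | n'.+1 => lebesgue_rV_cons (lebesgue_rV R n')
  end.

Lemma lebesgue_rV_rect (R : realType) (n : nat)
    (A : 'I_n -> set (measurableTypeR R)) :
  (forall i, measurable (A i)) ->
  lebesgue_rV R n [set x | forall i, A i (x ord0 i)] =
  (\prod_(i < n) lebesgue_measure (A i))%E.
Proof.
elim: n A => [|n IHn] A mA.
  rewrite big_ord0 /= diracE mem_set//=; by case.
rewrite big_ord_recl -IHn//= /lebesgue_rV_cons /pushforward.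
rewrite -product_measure1E//; last first.
  rewrite (_ : (fun _ => _) = \big[setI/setT]_(i < n)
    ((fun x : 'rV[R]_n => x ord0 i : measurableTypeR R) @^-1` A (lift ord0 i))).
    apply: bigsetI_measurable => i _; rewrite -[X in measurable X]setTI.
    exact: measurable_rV_coord.
  rewrite -bigcap_seq; apply/seteqP; split => x /= Ax i; first by move=> _; exact: Ax.
  by apply: Ax; rewrite /= mem_index_enum.
congr (_ _); apply/seteqP; split => -[a v] /=.
  move=> Aav; split; first by have := Aav ord0; rewrite mxE unlift_none.
  by move=> i; have := Aav (lift ord0 i); rewrite mxE liftK.
by move=> [Aa Av] i; rewrite mxE /=; case: unliftP => [j ->|->].
Qed.

(* Euler's integral for 0 < x, continued to x <= 0 by
   Gamma(x) = Gamma(x + k) / (x (x + 1) ... (x + k - 1)).  At the poles one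
   factor vanishes and division by 0 returns 0, so that Gamma(x) = 0 there, and
   division by Gamma(x) implements the convention 1 / Gamma(x) = 0. *)
Definition Gamma (R : realType) (x : R) : R :=
  let euler s :=
    \int[lebesgue_measure]_(t in `]0, +oo[) (t `^ (s - 1) * expR (- t)) in
  if 0 < x then euler x
  else let k := (Num.truncn (- x)).+1 in
    euler (x + k%:R) / \prod_(i < k) (x + i%:R).

Definition riesz_gamma (R : realType) (n : nat) (beta : R) : R :=
  2 `^ beta * pi `^ (n%:R / 2) * Gamma (beta / 2) / Gamma ((n%:R - beta) / 2).

Section potentials.
Variables (R : realType) (n : nat).
Implicit Types (x : 'rV[R]_n) (f g h : 'rV[R]_n -> R) (t : R).

Local Notation mu := (lebesgue_rV R n).

(* The library norm `|x| on 'rV[R]_n is the sup norm. *)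
Definition enorm x : R := Num.sqrt (\sum_(i < n) x ord0 i ^+ 2).

Definition riesz_kernel (alpha : R) f x (y : 'rV[R]_n) : R :=
  f y / enorm (x - y) `^ (n%:R - alpha).

Definition riesz_potential (alpha : R) f x : R :=
  (riesz_gamma n alpha)^-1 * \int[mu]_y riesz_kernel alpha f x y.

Definition convolution g h x : R := \int[mu]_y (g (x - y) * h y).

Definition convolution_exists g h x : Prop :=
  mu.-integrable setT (EFin \o (fun y => g (x - y) * h y)).

Definition laplacian f x : R :=
  \sum_(i < n) 'D_(delta_mx ord0 i) ('D_(delta_mx ord0 i) f) x.

Definition neg_laplacian f x : R := - laplacian f x.

Definition wavelet (alpha : R) (m : nat) : 'rV[R]_n -> R :=
  iter m neg_laplacian
    (fun x => (1 + enorm x ^+ 2) `^ (m%:R - (n%:R + alpha) / 2)).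

Definition dilate t f x : R := t ^- n * f (t^-1 *: x).

Definition C0 f : Prop :=
  continuous f /\
  forall e, 0 < e -> exists M, forall x, M < enorm x -> `|f x| < e.

Definition Lp_limit (p : R) (F : R -> 'rV[R]_n -> R) g : Prop :=
  (\forall t \near 0^'+, F t \in Lfun mu p%:E) /\
  'N[mu]_p%:E[EFin \o (F t \- g)%R]%E @[t --> 0^'+] --> 0%E.

(* D t x : the integrals defining F t x converge. *)
Definition ae_limit (D : R -> 'rV[R]_n -> Prop) (F : R -> 'rV[R]_n -> R) g :
    Prop :=
  {ae mu, forall x,
    (forall t, 0 < t -> D t x) /\ F t x @[t --> 0^'+] --> g x}.

Definition sup_norm f : \bar R := ereal_sup (range (fun x => `|f x|%:E)).

Definition sup_limit (D : R -> 'rV[R]_n -> Prop) (F : R -> 'rV[R]_n -> R) g :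
    Prop :=
  (forall t x, 0 < t -> D t x) /\
  sup_norm (F t \- g) @[t --> 0^'+] --> 0%E.

End potentials.

(* Main.v *)
(* Put rho(x) = 1 + |x|^2, A = (n - alpha) / 2 and beta = alpha / 2.  The wavelet
   w is a multiple of a combination W_m of the powers rho^-(A + 2 beta + j),
   0 <= j <= m, whose weights come from the coefficients of (1 - z)^beta.
   Writing powers as Gamma integrals of Gaussians one computes the Riesz
   potential of each rho^-(A + 2 beta + j); since (1 - z)^beta (1 - z)^-beta = 1,
   the potential of W_m collapses to a multiple of the single power rho^-(A + m).
   Hence, by Fubini, I^alpha f * t^-alpha w_t is a multiple of the convolution of
   f with the dilate by t of the integrable kernel rho^-(A + m).  Moreover
   t^-(n + 1 + alpha) (- Delta w)(y / t) is, up to a factor, the t-derivative of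
   t^-(n + alpha) W_(m+1)(y / t), so that the integral over [e, +oo[ is a multiple
   of the convolution of f with the dilate by e of rho^-(A + m + 1).

   What remains is the convergence of an approximate identity: almost everywhere
   by a Vitali covering argument and density, in L^p by Riesz-Scheffe (convergence
   almost everywhere, contraction and Fatou), in sup norm by uniform continuity. *)
From HB Require Import structures.
Require Import Defs.
From mathcomp Require Import all_boot all_order all_algebra.
From mathcomp Require Import all_classical all_reals all_analysis.
From mathcomp Require Import measurable_realfun measurable_fun_approximation.
From mathcomp Require Import zify ring lra.
Set Implicit Arguments.
Unset Strict Implicit.
Unset Printing Implicit Defensive.
Import Order.TTheory GRing.Theory Num.Theory.
Import numFieldNormedType.Exports.
Local Open Scope classical_set_scope.
Local Open Scope ring_scope.

(** * Lebesgue measure and Gaussians on R^n *)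

(** No Fourier transform occurs: everything rests on integrals exchanged by Tonelli or Fubini. The
    exponents A + 2 beta + j are the right ones because A + beta = n / 2: once the potential is a
    double integral over Gaussian parameters, the power of 1 + s left over is exactly j, so it
    expands binomially into finitely many Beta integrals. The hypotheses act at separate places. The
    condition 2 m > alpha says A + m > n / 2: the limiting kernel is integrable. The condition p < n
    / alpha puts rho^-A in L^q with q conjugate to p, which makes the double integral behind Fubini
    finite. Two degenerate values are carried along. I^alpha f may diverge on a null set, where the
    real integral is 0; scaling of integrals is therefore proved in a form that includes this value.
    And (n + alpha) / 2 - m may be a pole of Gamma: the power of rho is then a polynomial that
    Delta^m annihilates, and both formulae read 0 = 0. Only the inverse of that Gamma value occurs,
    so no case distinction arises. *)

Lemma eqW d (T : porderType d) (a b : T) : a = b -> (a <= b)%O.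
Proof. by move=> ->. Qed.

Section rV_integral.
Context {R : realType}.
Local Open Scope ereal_scope.

Lemma ge0_integral_rV_cons n (F : 'rV[R]_n.+1 -> \bar R) :
  measurable_fun setT F -> (forall x, 0 <= F x) ->
  \int[lebesgue_rV R n.+1]_x F x =
  \int[lebesgue_measure]_a \int[lebesgue_rV R n]_v F (rV_cons (a, v)).
Proof.
move=> mF F0.
(* The measure on n + 1 coordinates is by definition the image of a product measure under [rV_cons],
   so this holds by conversion. *)
rewrite -[LHS]/(\int[pushforward (lebesgue_measure \x lebesgue_rV R n)%E
   (@rV_cons R n)]_x F x).
rewrite ge0_integral_pushforward//; last exact: measurable_rV_cons.
rewrite preimage_setT (fubini_tonelli1 (F \o @rV_cons R n))//.
  by apply: measurableT_comp => //; exact: measurable_rV_cons.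
by move=> z; exact: F0.
Qed.

Lemma ge0_integral_rV0 (F : 'rV[R]_0 -> \bar R) :
  measurable_fun setT F -> \int[lebesgue_rV R 0]_x F x = F 0%R.
Proof. by move=> mF; rewrite /= integral_dirac// diracT mul1e. Qed.

Lemma measurable_affine (a c : R) :
  measurable_fun [set: measurableTypeR R]
    (fun x : measurableTypeR R => (a + c * x)%R : measurableTypeR R).
Proof. by apply: measurable_funD => //; exact: measurable_funM. Qed.

(** Uniqueness of Lebesgue measure: |c| times the image measure gives each interval ]u, v] its
    length. For c < 0 the preimage is half open on the other side, hence the two cases. *)
Lemma pushforward_affine (a c : R) : (c != 0)%R ->
  forall A : set (measurableTypeR R), measurable A ->
  pushforward (lebesgue_measure : {measure set (measurableTypeR R) -> \bar R})
    (fun x : measurableTypeR R => (a + c * x)%R : measurableTypeR R) A =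
  (`|c|^-1)%R%:E * lebesgue_measure A.
Proof.
move=> c0 A mA.
pose phi := (fun x : measurableTypeR R => (a + c * x)%R : measurableTypeR R).
pose m0 := measure_function_pushforward__canonical__measure_function_Measure
  (@lebesgue_measure R) (measurable_affine a c).
pose m1 : {measure set (measurableTypeR R) -> \bar R} :=
  mscale (NngNum (normr_ge0 c)) m0.
have cc : (0 < `|c|)%R by rewrite normr_gt0.
suff /(_ _ mA) -> : forall A, measurable A -> lebesgue_measure A = m1 A.
  by rewrite /m1 /mscale/= muleA -EFinM mulVf ?mul1e// gt_eqF.
apply: lebesgue_measure_unique => _ [[u v] _ <-] /=.
rewrite /m1 /mscale/= /pushforward.
move: c0; rewrite neq_lt => /orP[c0|c0].
  rewrite (_ : _ @^-1` _ = `[((v - a) / c)%R, ((u - a) / c)%R[%classic); last first.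
    apply/seteqP; split => x /=; rewrite !in_itv/= ler_ndivrMr// ltr_ndivlMr//;
     by move=> /andP[? ?]; apply/andP; split; lra.
  rewrite !lebesgue_measure_itv/= !lte_fin ltr0_norm//.
  have -> : ((v - a) / c < (u - a) / c)%R = (u < v)%R.
    by rewrite ltr_ndivrMr// -mulrA mulVf ?lt_eqF// mulr1 ltrD2r.
  case: ifPn => _; last by rewrite mule0.
  by rewrite -!EFinB -EFinM; congr EFin; field; rewrite lt_eqF.
rewrite (_ : _ @^-1` _ = `]((u - a) / c)%R, ((v - a) / c)%R]%classic); last first.
  apply/seteqP; split => x /=; rewrite !in_itv/= ler_pdivlMr// ltr_pdivrMr//;
     by move=> /andP[? ?]; apply/andP; split; lra.
rewrite !lebesgue_measure_itv/= !lte_fin gtr0_norm//.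
have -> : ((u - a) / c < (v - a) / c)%R = (u < v)%R.
  by rewrite ltr_pdivrMr// -mulrA mulVf ?gt_eqF// mulr1 ltrD2r.
case: ifPn => _; last by rewrite mule0.
by rewrite -!EFinB -EFinM; congr EFin; field; rewrite gt_eqF.
Qed.

Lemma ge0_integral_affine (a c : R) (F : R -> \bar R) : (c != 0)%R ->
  measurable_fun [set: R] F -> (forall x, 0 <= F x) ->
  \int[lebesgue_measure]_x F (a + c * x)%R =
  (`|c|^-1)%R%:E * \int[lebesgue_measure]_x F x.
Proof.
move=> c0 mF F0.
have := @ge0_integral_pushforward _ _ _ _ R _ (measurable_affine a c)
  lebesgue_measure setT F measurableT mF (fun y _ => F0 y).
rewrite preimage_setT => <-.
have c1 : (0 <= `|c|^-1)%R by rewrite invr_ge0.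
rewrite -[`|c|^-1%R]/((NngNum c1)%:num).
rewrite -ge0_integral_mscale//.
apply: eq_measure_integral; first exact: measurable_affine.
by move=> mphi A mA _; exact: pushforward_affine.
Qed.

Lemma measurable_rV_affine n (a : 'rV[R]_n) (c : R) :
  measurable_fun setT (fun x : 'rV[R]_n => (a + c *: x)%R).
Proof.
apply: measurable_fun_rV => i; under eq_fun do rewrite !mxE.
by apply: measurable_funD => //; apply: measurable_funM => //; exact: measurable_rV_coord.
Qed.

(** Induction on n: the map acts on each coordinate separately, and the coordinate peeled off
    contributes one factor 1 / |c|. Negative c is included, which covers reflections. *)
Lemma ge0_integral_rV_affine n (a : 'rV[R]_n) (c : R) (F : 'rV[R]_n -> \bar R) :
  (c != 0)%R ->
  measurable_fun setT F -> (forall x, 0 <= F x) ->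
  \int[lebesgue_rV R n]_x F (a + c *: x)%R =
  ((`|c| ^+ n)^-1)%R%:E * \int[lebesgue_rV R n]_x F x.
Proof.
move=> c0; elim: n a F => [|n IHn] a F mF F0.
  rewrite !ge0_integral_rV0//; last first.
    exact: (measurableT_comp mF (measurable_rV_affine a c)).
  by rewrite expr0 invr1 mul1e; congr F; apply/rowP; case.
rewrite !ge0_integral_rV_cons//; last first.
  exact: (measurableT_comp mF (measurable_rV_affine a c)).
pose a' := (\row_j a ord0 (lift ord0 j))%R.
pose G (t : R) := \int[lebesgue_rV R n]_v F (rV_cons (t, v)).
have mG : measurable_fun [set: R] G.
  apply: (measurable_fun_fubini_tonelli_F (F \o @rV_cons R n)).
    by apply: (measurableT_comp mF); exact: measurable_rV_cons.
  by move=> z; exact: F0.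
have G0 t : 0 <= G t by exact: integral_ge0.
have mGc : measurable_fun [set: R] (fun t => G (a ord0 ord0 + c * t)%R).
  by apply: (measurableT_comp mG); exact: measurable_affine.
transitivity (\int[lebesgue_measure]_t
   (((`|c| ^+ n)^-1)%R%:E * G (a ord0 ord0 + c * t)%R)).
  apply: eq_integral => t _; rewrite -(IHn a'); last 2 first.
  - apply: (measurableT_comp mF); apply: measurableT_comp.
      exact: measurable_rV_cons.
    exact: measurable_pair1.
  - by move=> x; exact: F0.
  apply: eq_integral => v _; congr F; apply/rowP => i.
  by rewrite !mxE; case: unliftP => [j ->|->] /=; rewrite ?mxE.
rewrite -[X in _ = _ * X]/(\int[lebesgue_measure]_t G t); clearbody G.
rewrite ge0_integralZl; first last.
- by rewrite lee_fin invr_ge0 exprn_ge0.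
- by move=> t _; exact: G0.
- exact: mGc.
- exact: measurableT.
rewrite (ge0_integral_affine (a ord0 ord0) c0 mG G0) muleA -EFinM; congr (_%:E * _).
by rewrite exprS invfM mulrC.
Qed.

End rV_integral.

Section gaussian.
Context {R : realType}.

(** The square is preferred to [enorm]: it is polynomial, splits along [rV_cons], and turns powers
    of the norm into powers with half the exponent. *)
Definition normsq n (x : 'rV[R]_n) : R := \sum_(i < n) x ord0 i ^+ 2.

Lemma normsq_ge0 n (x : 'rV[R]_n) : 0 <= normsq x.
Proof. by apply: sumr_ge0 => i _; exact: sqr_ge0. Qed.

Lemma enorm_sqr n (x : 'rV[R]_n) : enorm x ^+ 2 = normsq x.
Proof. by rewrite sqr_sqrtr// normsq_ge0. Qed.

Lemma enorm_powR n (x : 'rV[R]_n) a : enorm x `^ a = normsq x `^ (a / 2).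
Proof.
by rewrite /enorm -/(normsq x) -powR12_sqrt ?normsq_ge0// -powRrM mulrC.
Qed.

Lemma normsqZ n (x : 'rV[R]_n) a : normsq (a *: x) = a ^+ 2 * normsq x.
Proof.
by rewrite /normsq mulr_sumr; apply: eq_bigr => i _; rewrite mxE exprMn.
Qed.

Lemma normsqN n (x : 'rV[R]_n) : normsq (- x) = normsq x.
Proof. by apply: eq_bigr => i _; rewrite mxE sqrrN. Qed.

Lemma normsq_cons n (a : R) (v : 'rV[R]_n) :
  normsq (rV_cons (a, v)) = a ^+ 2 + normsq v.
Proof.
rewrite /normsq big_ord_recl mxE unlift_none; congr (_ + _).
by apply: eq_bigr => i _; rewrite mxE liftK.
Qed.

Lemma measurable_normsq n : measurable_fun [set: 'rV[R]_n] (@normsq n).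
Proof.
apply: measurable_sum => i; apply: measurable_funX.
exact: measurable_rV_coord.
Qed.

(** Completing the square: with c^2 = r + s the exponent is (c t - r a / c)^2 + r s / (r + s) a^2,
    and an affine substitution leads to the standard Gaussian integral. *)
Lemma integral_gauss_affine (a r s : R) : 0 < r -> 0 <= s ->
  (\int[lebesgue_measure]_t (expR (- (r * (a - t) ^+ 2 + s * t ^+ 2)))%:E =
  ((pi / (r + s)) `^ 2^-1 * expR (- (r * s / (r + s) * a ^+ 2)))%:E)%E.
Proof.
move=> r0 s0.
have rs0 : 0 < r + s by rewrite ltr_wpDr.
pose c := Num.sqrt (r + s).
have c0 : 0 < c by rewrite sqrtr_gt0.
have c2 : c ^+ 2 = r + s by rewrite sqr_sqrtr// ltW.
have mg : measurable_fun [set: R] (EFin \o @gauss_fun R).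
  by apply/measurable_EFinP; exact: measurable_gauss_fun.
pose E := expR (- (r * s / (r + s) * a ^+ 2)).
transitivity (\int[lebesgue_measure]_t
   (E%:E * (EFin \o gauss_fun) (- (r * a / c) + c * t)%R))%E.
  apply: eq_integral => t _; rewrite /= -EFinM /E /gauss_fun -expRD; congr (expR _)%:E.
  have -> : s = c ^+ 2 - r by rewrite c2 addrC addKr.
  by field; rewrite subrKC expf_neq0 ?gt_eqF.
rewrite ge0_integralZl; first last.
- by rewrite lee_fin expR_ge0.
- by move=> t _; rewrite lee_fin expR_ge0.
- by apply: (measurableT_comp mg); exact: measurable_affine.
- exact: measurableT.
rewrite (ge0_integral_affine (- (r * a / c)) (lt0r_neq0 c0) mg); last first.
  by move=> t; rewrite lee_fin expR_ge0.
rewrite integralT_gauss -!EFinM; congr EFin; rewrite mulrC; congr (_ * _).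
rewrite gtr0_norm// powR12_sqrt; last by rewrite divr_ge0// ?pi_ge0// ltW.
by rewrite sqrtrM ?pi_ge0// sqrtrV// 1?ltW// mulrC.
Qed.

Lemma measurable_gauss_rV n (x : 'rV[R]_n) r s :
  measurable_fun [set: 'rV[R]_n]
    (fun y => (expR (- (r * normsq (x - y) + s * normsq y)))%:E).
Proof.
apply/measurable_EFinP; apply: measurableT_comp => //.
apply: measurableT_comp => //; apply: measurable_funD; apply: measurable_funM => //.
  apply: measurableT_comp; first exact: measurable_normsq.
  under eq_fun do rewrite -(scaleN1r _).
  exact: measurable_rV_affine.
exact: measurable_normsq.
Qed.

Lemma integral_gauss_rV n (x : 'rV[R]_n) (r s : R) : 0 < r -> 0 <= s ->
  (\int[lebesgue_rV R n]_y (expR (- (r * normsq (x - y) + s * normsq y)))%:E =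
  ((pi / (r + s)) `^ (n%:R / 2) * expR (- (r * s / (r + s) * normsq x)))%:E)%E.
Proof.
move=> r0 s0; elim: n x => [|n IHn] x.
  rewrite ge0_integral_rV0; last exact: measurable_gauss_rV.
  by rewrite /normsq !big_ord0 !mulr0 addr0 oppr0 expR0 mul0r powRr0 mulr1.
rewrite ge0_integral_rV_cons; last 2 first.
- exact: measurable_gauss_rV.
- by move=> y; rewrite lee_fin expR_ge0.
pose x' := (\row_j x ord0 (lift ord0 j)) : 'rV[R]_n.
pose E := (pi / (r + s)) `^ (n%:R / 2) * expR (- (r * s / (r + s) * normsq x')).
transitivity (\int[lebesgue_measure]_t
  (E%:E * (expR (- (r * (x ord0 ord0 - t) ^+ 2 + s * t ^+ 2)))%:E))%E.
  apply: eq_integral => t _; rewrite muleC.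
  rewrite -IHn -ge0_integralZl; first last.
  - by rewrite lee_fin expR_ge0.
  - by move=> y _; rewrite lee_fin expR_ge0.
  - exact: measurable_gauss_rV.
  - exact: measurableT.
  apply: eq_integral => v _; rewrite -EFinM -expRD; congr (expR _)%:E.
  have -> : x - rV_cons (t, v) = rV_cons (x ord0 ord0 - t, x' - v).
    by apply/rowP => i; rewrite !mxE; case: unliftP => [j ->|->] /=; rewrite ?mxE.
  by rewrite !normsq_cons; ring.
rewrite ge0_integralZl; first last.
- by rewrite lee_fin mulr_ge0 ?powR_ge0 ?expR_ge0.
- by move=> t _; rewrite lee_fin expR_ge0.
- apply/measurable_EFinP; apply: measurableT_comp => //.
  apply: measurableT_comp => //.
  by apply: measurable_funD => //; apply: measurable_funM => //;
    apply: measurable_funX => //; apply: measurable_funB.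
- exact: measurableT.
rewrite integral_gauss_affine// -EFinM; congr EFin.
rewrite /E mulrACA -powRD; last first.
  by apply/implyP => _; rewrite gt_eqF// divr_gt0 ?pi_gt0// ltr_wpDr.
rewrite -expRD; congr (_ `^ _ * expR _).
  by rewrite -natr1; field.
have -> : normsq x = x ord0 ord0 ^+ 2 + normsq x'.
  rewrite -normsq_cons; congr normsq.
  by apply/rowP => i; rewrite !mxE; case: unliftP => [j ->|->] /=; rewrite ?mxE.
by ring.
Qed.

End gaussian.

(** * The Gamma function *)

Lemma tonelli d1 d2 (T1 : measurableType d1) (T2 : measurableType d2) (R : realType)
    (m1 : {sigma_finite_measure set T1 -> \bar R})
    (m2 : {sigma_finite_measure set T2 -> \bar R}) (k : T1 -> T2 -> \bar R) :
  measurable_fun [set: T1 * T2] (fun z : T1 * T2 => k z.1 z.2) ->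
  (forall x y, 0 <= k x y)%E ->
  (\int[m1]_x \int[m2]_y k x y = \int[m2]_y \int[m1]_x k x y)%E.
Proof.
move=> mk k0.
exact: (fubini_tonelli (fun z : T1 * T2 => k z.1 z.2) mk (fun z => k0 _ _)).
Qed.

Lemma measurable_fun_integral d1 d2 (T1 : measurableType d1) (T2 : measurableType d2)
    (R : realType) (m2 : {sigma_finite_measure set T2 -> \bar R})
    (k : T1 -> T2 -> \bar R) :
  measurable_fun [set: T1 * T2] (fun z : T1 * T2 => k z.1 z.2) ->
  (forall x y, 0 <= k x y)%E ->
  measurable_fun setT (fun x => \int[m2]_y k x y)%E.
Proof.
move=> mk k0.
exact: (measurable_fun_fubini_tonelli_F (m2 := m2) (fun z : T1 * T2 => k z.1 z.2) mk (fun z => k0 _ _)).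
Qed.

Section gamma.
Context {R : realType}.
Implicit Types s l : R.

Lemma gt0_powRD (x a b : R) : 0 < x -> x `^ (a + b) = x `^ a * x `^ b.
Proof. by move=> x0; rewrite powRD// (gt_eqF x0) implybT. Qed.

Lemma measurable_fun_powR d (T : measurableType d) (D : set T) (g : T -> R) (a : R) :
  measurable_fun D g -> measurable_fun D (fun x => g x `^ a).
Proof. by move=> mg; apply: (measurableT_comp (measurable_powR a)). Qed.

Lemma measurable_fun_expR d (T : measurableType d) (D : set T) (g : T -> R) :
  measurable_fun D g -> measurable_fun D (fun x => expR (g x)).
Proof. by move=> mg; apply: (measurableT_comp (@measurable_expR R)). Qed.

(** The integrand of Gamma(s) l^-s, extended by 0 to the whole line so that Tonelli applies without
    restricting domains. *)
Definition gammak s l (t : R) : R :=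
  if 0 < t then t `^ (s - 1) * expR (- (l * t)) else 0.

Lemma gammak_ge0 s l (t : R) : 0 <= gammak s l t.
Proof. by rewrite /gammak; case: ifP => // _; rewrite mulr_ge0 ?powR_ge0 ?expR_ge0. Qed.

Lemma measurable_pos_if d (T : measurableType d) (g h : T -> R) :
  measurable_fun setT g -> measurable_fun setT h ->
  measurable_fun setT (fun t => if 0 < g t then h t else 0).
Proof.
move=> mg mh; apply: measurable_fun_if => //.
- exact: measurable_fun_ltr.
- exact: measurable_funTS.
Qed.

Lemma measurable_gammak s l : measurable_fun [set: R] (gammak s l).
Proof.
apply: measurable_pos_if => //; apply: measurable_funM; first exact: measurable_powR.
by apply: measurableT_comp => //; apply: measurableT_comp => //; exact: measurable_funM.
Qed.

Lemma measurable_gammakE s l : measurable_fun [set: R] (fun t => (gammak s l t)%:E).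
Proof. by apply/measurable_EFinP; exact: measurable_gammak. Qed.

(** Extended real valued on purpose: the functional equation comes first, and finiteness for small s
    is deduced from it. *)
Let eG s : \bar R := \int[lebesgue_measure]_t (gammak s 1 t)%:E.

Let eG_ge0 s : (0 <= eG s)%E.
Proof. by apply: integral_ge0 => t _; rewrite lee_fin gammak_ge0. Qed.

Let eG_scale s l : 0 < l ->
  (\int[lebesgue_measure]_t (gammak s l t)%:E = (l `^ (- s))%:E * eG s)%E.
Proof.
move=> l0; transitivity (\int[lebesgue_measure]_t
  ((l `^ (1 - s))%:E * (EFin \o gammak s 1) (0 + l * t)%R))%E.
  apply: eq_integral => t _; rewrite /= -EFinM add0r /gammak pmulr_rgt0//.
  case: ifPn => t0; last by rewrite mulr0.
  rewrite mul1r mulrA; congr (_ * _)%:E.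
  rewrite powRM ?ltW// mulrA -gt0_powRD//.
  by rewrite (_ : 1 - s + (s - 1) = 0) ?powRr0 ?mul1r//; ring.
rewrite ge0_integralZl; first last.
- by rewrite lee_fin powR_ge0.
- by move=> t _; rewrite lee_fin gammak_ge0.
- by apply: (measurableT_comp (measurable_gammakE _ _)); exact: measurable_affine.
- exact: measurableT.
rewrite (ge0_integral_affine 0 (lt0r_neq0 l0) (measurable_gammakE _ _)); last first.
  by move=> t; rewrite lee_fin gammak_ge0.
rewrite muleA -EFinM gtr0_norm//; congr (_%:E * _)%E.
by rewrite -powR_inv1 1?ltW// -gt0_powRD//; congr (_ `^ _); ring.
Qed.

Lemma powR_cvgy0 s : 0 < s -> x `^ (- s) @[x --> +oo] --> (0 : R).
Proof.
move=> s0; apply/cvgr0Pnorm_lt => e e0.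
exists (e^-1 `^ s^-1); split => [|x Mx]; first exact: num_real.
have x0 : 0 < x by rewrite (le_lt_trans _ Mx)// powR_ge0.
rewrite ger0_norm ?powR_ge0// powRN invf_plt ?posrE ?powR_gt0//.
have -> : e^-1 = (e^-1 `^ s^-1) `^ s.
  by rewrite -powRrM mulVf ?gt_eqF// powRr1// invr_ge0 ltW.
by apply: gt0_ltr_powR; rewrite ?nnegrE ?powR_ge0 ?(ltW x0).
Qed.

Lemma ge0_is_derive_FTC2y (f F : R -> R) (a l : R) :
  (forall x, a <= x -> 0 <= f x) -> (forall x, a <= x -> {for x, continuous f}) ->
  (forall x, a <= x -> is_derive x 1 F (f x)) -> F x @[x --> +oo] --> l ->
  (\int[lebesgue_measure]_(x in `[a, +oo[) (f x)%:E = (l - F a)%:E)%E.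
Proof.
move=> f0 cf dF Fl; rewrite (@ge0_continuous_FTC2y _ f F a l) //.
- apply: continuous_in_subspaceT => x /set_mem/=; rewrite in_itv/= andbT.
  exact: cf.
- by move=> x /ltW ax; apply: ex_derive; exact: dF.
- apply: cvg_at_right_filter; apply: differentiable_continuous.
  by apply/derivable1_diffP; apply: ex_derive; exact: dF.
- move=> x; rewrite in_itv/= andbT => /ltW ax.
  by rewrite derive1E; apply: derive_val; exact: dF.
Qed.

Let integral_expR_y l : 0 < l ->
  (\int[lebesgue_measure]_(v in `[1%R, +oo[) (expR (- (l * v)))%:E =
   (expR (- l) / l)%:E)%E.
Proof.
move=> l0; pose F (v : R) := - (expR (- (l * v)) / l).
have dF (v : R) : 1 <= v -> is_derive v 1 F (expR (- (l * v))).
  move=> _; rewrite /F; apply: is_derive_eq; rewrite /GRing.scale/=.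
  by field; rewrite gt_eqF.
have Fl : F v @[v --> +oo] --> (0 : R).
  rewrite -oppr0; apply: cvgN; rewrite -(mul0r l^-1); apply: cvgM; last exact: cvg_cst.
  apply: (@cvg_comp _ _ _ (fun v => l * v) (fun x => expR (- x)) _ (pinfty_nbhs R)).
    exact: gt0_cvgMry.
  exact: cvgr_expR.
rewrite (ge0_is_derive_FTC2y _ _ dF Fl) /F.
- by rewrite mulr1 sub0r opprK.
- by move=> v _; exact: expR_ge0.
- move=> v _; apply: continuous_comp; last exact: continuous_expR.
  by apply: continuousN; apply: cvgM; [exact: cvg_cst|exact: cvg_id].
Qed.

Let integral_powR_y s : 0 < s ->
  (\int[lebesgue_measure]_(v in `[1%R, +oo[) (v `^ (- (s + 1)))%:E = (s^-1)%:E)%E.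
Proof.
move=> s0; pose F (v : R) := - (v `^ (- s) / s).
have dF (v : R) : 1 <= v -> is_derive v 1 F (v `^ (- (s + 1))).
  move=> v1; have v0 : 0 < v by rewrite (lt_le_trans ltr01).
  have dp := is_derive1_powR (- s) v0; rewrite /F.
  apply: is_derive_eq; rewrite /GRing.scale/= (opprD s).
  by field; rewrite gt_eqF.
have Fl : F v @[v --> +oo] --> (0 : R).
  rewrite -oppr0; apply: cvgN; rewrite -(mul0r s^-1).
  by apply: cvgM; [exact: powR_cvgy0|exact: cvg_cst].
rewrite (ge0_is_derive_FTC2y _ _ dF Fl) /F.
- by rewrite powR1 sub0r opprK mul1r.
- by move=> v _; exact: powR_ge0.
- move=> v v1; apply: differentiable_continuous; apply/derivable1_diffP.
  by apply: derivable_powR; rewrite in_itv/= andbT (lt_le_trans ltr01).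
Qed.

(** Tonelli instead of integration by parts: t^s e^(-v t) is integrated over v > 1 and t > 0.
    Integrating in t first gives eG (s + 1) times the integral of v^-(s + 1), which is 1 / s;
    integrating in v first gives t^(s - 1) e^(-t), hence eG s. *)
Let eGS s : 0 < s -> eG (s + 1) = (s%:E * eG s)%E.
Proof.
move=> s0.
pose k (v t : R) := if 1 < v then gammak (s + 1) v t else 0.
have mk : measurable_fun [set: R * R] (fun z : R * R => (k z.1 z.2)%:E).
  apply/measurable_EFinP.
  rewrite (_ : (fun _ => _) = (fun z : R * R => if 0 < z.1 - 1 then
    (if 0 < z.2 then z.2 `^ (s + 1 - 1) * expR (- (z.1 * z.2)) else 0) else 0)); last first.
    by apply/funext => z; rewrite /k subr_gt0.
  apply: measurable_pos_if; first exact: measurable_funB.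
  apply: measurable_pos_if => //; apply: measurable_funM.
    exact: measurable_fun_powR.
  by apply: measurableT_comp => //; apply: measurableT_comp => //; exact: measurable_funM.
have k0 v t : (0 <= (k v t)%:E)%E.
  by rewrite lee_fin /k; case: ifP => // _; exact: gammak_ge0.
have E1 : (\int[lebesgue_measure]_v \int[lebesgue_measure]_t (k v t)%:E =
    (s^-1)%:E * eG (s + 1))%E.
  rewrite -(integral_powR_y s0) -ge0_integralZr => [|//| |v _|//]; last 2 first.
  - by apply/measurable_EFinP; apply: measurable_funTS; exact: measurable_powR.
  - by rewrite lee_fin powR_ge0.
  rewrite -integral_itv_obnd_cbnd.
    rewrite [RHS]integral_mkcond; apply: eq_integral => v _.
    rewrite patchE; case: ifPn => [/set_mem/=|/negP v1].
      rewrite in_itv/= andbT => v1; rewrite -eG_scale ?(lt_trans _ v1)//.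
      by apply: eq_integral => t _; rewrite /k v1.
    rewrite integral0_eq// => t _; rewrite /k; case: ifPn => // v1'.
    by case: v1; apply/mem_set; rewrite /= in_itv/= v1'.
  apply: emeasurable_funM => //.
  by apply/measurable_EFinP; apply: measurable_funTS; exact: measurable_powR.
have E2 : (\int[lebesgue_measure]_v \int[lebesgue_measure]_t (k v t)%:E = eG s)%E.
  etransitivity; first exact: (tonelli (@lebesgue_measure R) (@lebesgue_measure R) mk k0).
  apply: eq_integral => t _.
  have [t0|t0] := ltP 0 t; last first.
    rewrite /gammak ltNge t0/= integral0_eq// => v _.
    by rewrite /k /gammak [0 < t]ltNge t0/= if_same.
  have -> : gammak s 1 t = t `^ s * (expR (- t) / t).
    rewrite /gammak t0 mul1r gt0_powRD// powRN powRr1 ?ltW//; ring.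
  rewrite EFinM -integral_expR_y// -ge0_integralZl => [|//| |v _|]; last 3 first.
  - by apply/measurable_EFinP; apply: measurable_funTS; apply: measurableT_comp => //;
      apply: measurableT_comp => //; exact: measurable_funM.
  - by rewrite lee_fin expR_ge0.
  - by rewrite lee_fin powR_ge0.
  rewrite -integral_itv_obnd_cbnd.
    rewrite [RHS]integral_mkcond; apply: eq_integral => v _.
    rewrite patchE /k; case: ifPn => [v1|v1].
      by rewrite mem_set /= ?in_itv/= ?v1// /gammak t0 addrK mulrC [v * t]mulrC EFinM muleC.
    by rewrite memNset//= in_itv/= andbT; exact/negP.
  apply: emeasurable_funM => //.
  by apply/measurable_EFinP; apply: measurable_funTS; apply: measurableT_comp => //;
      apply: measurableT_comp => //; exact: measurable_funM.
rewrite -[in RHS]E2 E1 muleA -EFinM mulfV ?mul1e// gt_eqF//.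
Qed.

Let eG1 : eG 1 = 1%E.
Proof.
pose F (v : R) := - expR (- v).
have dF (v : R) : 0 <= v -> is_derive v 1 F (expR (- v)).
  by move=> _; rewrite /F; apply: is_derive_eq; rewrite /GRing.scale/=; ring.
have Fl : F v @[v --> +oo] --> (0 : R).
  by rewrite -oppr0; apply: cvgN; exact: cvgr_expR.
have := ge0_is_derive_FTC2y _ _ dF Fl; rewrite /F oppr0 expR0 sub0r opprK => <-.
- rewrite -integral_itv_obnd_cbnd; last first.
    by apply/measurable_EFinP; apply: measurable_funTS; apply: measurable_fun_expR.
  rewrite [RHS]integral_mkcond; apply: eq_integral => v _.
  rewrite patchE; case: ifPn => [/set_mem/=|/negP v1].
    by rewrite in_itv/= andbT /gammak => ->; rewrite subrr powRr0 !mul1r.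
  rewrite /gammak; case: ifPn => // v1'.
  by case: v1; apply/mem_set; rewrite /= in_itv/= v1'.
- by move=> v _; exact: expR_ge0.
- move=> v _; apply: continuous_comp; last exact: continuous_expR.
  exact: opp_continuous.
Qed.

Let eG_nat k : (eG (k.+1)%:R < +oo)%E.
Proof.
elim: k => [|k IHk]; first by rewrite eG1 ltry.
by rewrite -natr1 eGS// lte_mul_pinfty// lee_fin.
Qed.

(** For u at least 1, t^(u - 1) is at most 1 plus a natural power of t, whose integral [eG_nat]
    bounds. Smaller s follow from the functional equation. *)
Let eG_fin s : 0 < s -> (eG s < +oo)%E.
Proof.
move=> s0.
have ge1 u : 1 <= u -> (eG u < +oo)%E.
  move=> u1; pose k := (Num.truncn u).+1.
  apply: (@le_lt_trans _ _ (eG 1 + eG k.+1%:R)%E); last by rewrite lte_add_pinfty// eG1 ltry.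
  rewrite /eG -ge0_integralD//; last 4 first.
  - by move=> t _; rewrite lee_fin gammak_ge0.
  - exact: measurable_gammakE.
  - by move=> t _; rewrite lee_fin gammak_ge0.
  - exact: measurable_gammakE.
  apply: ge0_le_integral => //.
  - by move=> t _; rewrite lee_fin gammak_ge0.
  - exact: measurable_gammakE.
  - by apply: emeasurable_funD; exact: measurable_gammakE.
  move=> t _; rewrite -EFinD lee_fin /gammak; case: ifPn => [t0|_]; last by rewrite addr0.
  rewrite -mulrDl ler_wpM2r ?expR_ge0// subrr powRr0.
  have [t1|t1] := leP t 1.
    rewrite ler_wpDr ?powR_ge0//; apply: (@le_trans _ _ (1 `^ (u - 1))); last by rewrite powR1.
    by apply: ge0_ler_powR; rewrite ?nnegrE ?subr_ge0// ltW.
  rewrite ler_wpDl// ler_powR// ?(ltW t1)// lerD2r.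
  by rewrite (le_trans (ltW (truncnS_gt u)))// ler_nat.
have [/ge1//|s1] := leP 1 s.
have : (eG (s + 1) < +oo)%E by apply: ge1; rewrite lerDr ltW.
rewrite eGS// !ltey; apply: contra => /eqP ->.
by rewrite mulry gtr0_sg// mul1e.
Qed.

(** For u at least 1 the integrand dominates e^(-t) on [1, +oo[, of integral 1 / e. Smaller s again
    follow from the functional equation. *)
Let eG_gt0 s : 0 < s -> (0 < eG s)%E.
Proof.
move=> s0.
have ge1 u : 1 <= u -> (0 < eG u)%E.
  move=> u1; apply: (@lt_le_trans _ _ (expR (- 1) / 1)%:E).
    by rewrite lte_fin divr_gt0// expR_gt0.
  rewrite -integral_expR_y// /eG integral_mkcond; apply: ge0_le_integral => //.
  - by move=> v _; rewrite patchE; case: ifP => // _; rewrite lee_fin expR_ge0.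
  - apply/(measurable_restrictT _ _).1 => //; apply/measurable_EFinP; apply: measurable_funTS.
    by apply: measurable_fun_expR; apply: measurableT_comp => //; exact: measurable_funM.
  - exact: measurable_gammakE.
  move=> v _; rewrite patchE; case: ifPn => [/set_mem/=|_]; last by rewrite lee_fin gammak_ge0.
  rewrite in_itv/= andbT => v1; rewrite lee_fin /gammak (lt_le_trans ltr01 v1).
  rewrite ler_peMl ?expR_ge0//; apply: (@le_trans _ _ (1 `^ (u - 1))); first by rewrite powR1.
  by apply: ge0_ler_powR; rewrite ?nnegrE ?subr_ge0// (le_trans _ v1).
have [/ge1//|s1] := leP 1 s.
have : (0 < eG (s + 1))%E by apply: ge1; rewrite lerDr ltW.
by rewrite eGS// pmule_rgt0.
Qed.

Let GammaE s : 0 < s -> (Gamma s)%:E = eG s.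
Proof.
move=> s0; rewrite /Gamma s0 /Rintegral fineK.
  rewrite [LHS]integral_mkcond; apply: eq_integral => v _.
  rewrite patchE /gammak mul1r; case: ifPn => [/set_mem/=|/negP v1].
    by rewrite in_itv/= andbT => ->.
  case: ifPn => // v1'.
  by case: v1; apply/mem_set; rewrite /= in_itv/= v1'.
have -> : (\int[lebesgue_measure]_(x in `]0%R, +oo[) (x `^ (s - 1) * expR (- x))%:E = eG s)%E.
  rewrite [LHS]integral_mkcond; apply: eq_integral => v _.
  rewrite patchE /gammak mul1r; case: ifPn => [/set_mem/=|/negP v1].
    by rewrite in_itv/= andbT => ->.
  case: ifPn => // v1'.
  by case: v1; apply/mem_set; rewrite /= in_itv/= v1'.
by rewrite ge0_fin_numE// eG_fin.
Qed.

Lemma Gamma_gt0 s : 0 < s -> 0 < Gamma s.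
Proof. by move=> s0; rewrite -lte_fin GammaE// eG_gt0. Qed.

Lemma GammaS s : 0 < s -> Gamma (s + 1) = s * Gamma s.
Proof.
by move=> s0; apply/EFin_inj; rewrite EFinM !GammaE ?eGS// addr_gt0.
Qed.

Lemma integral_gammak s l : 0 < s -> 0 < l ->
  (\int[lebesgue_measure]_t (gammak s l t)%:E = (Gamma s * l `^ (- s))%:E)%E.
Proof. by move=> s0 l0; rewrite eG_scale// EFinM GammaE// muleC. Qed.

End gamma.

(** * Riesz potentials of powers of 1 + |x|^2 *)

Lemma measurable_fun_oppr {R : realType} d (T : measurableType d) (D : set T) (g : T -> R) :
  measurable_fun D g -> measurable_fun D (fun t => - g t).
Proof. by move=> mg; apply: (measurableT_comp (@oppr_measurable R setT)). Qed.

Section measurability.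
Context {R : realType} d (T : measurableType d).
Implicit Types (D : set T).

Lemma measurable_fun_normsq n D (g : T -> 'rV[R]_n) :
  measurable_fun D g -> measurable_fun D (fun t => normsq (g t)).
Proof. by move=> mg; apply: (measurableT_comp (@measurable_normsq R n)). Qed.

Lemma measurable_fun_rVB n (g h : T -> 'rV[R]_n) :
  measurable_fun setT g -> measurable_fun setT h ->
  measurable_fun setT (fun t => g t - h t).
Proof.
move=> mg mh; apply: measurable_fun_rV => i; under eq_fun do rewrite !mxE.
apply: measurable_funB.
  by apply: (measurableT_comp (measurable_rV_coord i)).
by apply: (measurableT_comp (measurable_rV_coord i)).
Qed.

Lemma measurable_fun_rVZ n (a : T -> R) (g : T -> 'rV[R]_n) :
  measurable_fun setT a -> measurable_fun setT g ->
  measurable_fun setT (fun t => a t *: g t).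
Proof.
move=> ma mg; apply: measurable_fun_rV => i; under eq_fun do rewrite !mxE.
apply: measurable_funM => //.
by apply: (measurableT_comp (measurable_rV_coord i)).
Qed.

Lemma measurable_fun_rVD n (g h : T -> 'rV[R]_n) :
  measurable_fun setT g -> measurable_fun setT h ->
  measurable_fun setT (fun t => g t + h t).
Proof.
move=> mg mh; apply: measurable_fun_rV => i; under eq_fun do rewrite !mxE.
apply: measurable_funD.
  by apply: (measurableT_comp (measurable_rV_coord i)).
by apply: (measurableT_comp (measurable_rV_coord i)).
Qed.

Lemma measurable_fun_rVN n (g : T -> 'rV[R]_n) :
  measurable_fun setT g -> measurable_fun setT (fun t => - g t).
Proof.
move=> mg; under eq_fun do rewrite -scaleN1r.
by apply: measurable_fun_rVZ.
Qed.

Lemma measurable_fun_gammak s (l g : T -> R) :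
  measurable_fun setT l -> measurable_fun setT g ->
  measurable_fun setT (fun t => gammak s (l t) (g t)).
Proof.
move=> ml mg; apply: measurable_pos_if => //; apply: measurable_funM.
  exact: measurable_fun_powR.
apply: measurable_fun_expR; apply: measurableT_comp => //.
exact: measurable_funM.
Qed.

Lemma measurable_fun_invr D (g : T -> R) :
  measurable_fun D g -> measurable_fun D (fun t => (g t)^-1).
Proof.
move=> mg; apply: measurableT_comp => //.
(* Inversion is discontinuous at 0, so it is written piecewise through the power -1, with its value
   0 at 0. *)
rewrite (_ : GRing.inv = (fun x : R => if 0 < x then x `^ (-1) else
  if 0 < - x then - ((- x) `^ (-1)) else 0)); last first.
  apply/funext => x; case: ltgtP => [x0||<-]; rewrite ?oppr_gt0.
  - by rewrite powR_inv1// ltW.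
  - by move=> x0; rewrite x0 powR_inv1 ?invrN ?opprK// oppr_ge0 ltW.
  - by rewrite ltxx invr0.
apply: measurable_fun_if => //; first exact: measurable_fun_ltr.
  by apply: measurable_funTS; exact: measurable_powR.
apply: measurable_funTS; apply: measurable_fun_if => //.
- by apply: measurable_fun_ltr => //.
- apply: measurable_funTS; apply: measurable_fun_oppr; apply: measurable_fun_powR.
  exact: measurable_fun_oppr.
Qed.

End measurability.

Ltac meas :=
  lazymatch goal with
  | |- measurable_fun _ (fun _ => ?c) => exact: measurable_cst
  | |- measurable_fun _ (fun x => GRing.mul (@?a x) (@?b x)) =>
      apply: measurable_funM; meas
  | |- measurable_fun _ (fun x => expR (@?a x)) => apply: measurable_fun_expR; meas
  | |- measurable_fun _ (fun x => powR (@?a x) _) => apply: measurable_fun_powR; meas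
  | |- measurable_fun _ (fun x => gammak _ (@?a x) (@?b x)) =>
      apply: measurable_fun_gammak; meas
  | |- measurable_fun _ (fun x => normsq (@?a x)) => apply: measurable_fun_normsq; meas
  | |- measurable_fun _ (fun x => GRing.inv (@?a x)) => apply: measurable_fun_invr; meas
  | |- measurable_fun _ (fun x => GRing.exp (@?a x) _) => apply: measurable_funX; meas
  | |- _ => first [meas_leaf | meas_op]
  end
with meas_op := first [ apply: measurable_fun_rVB; meas
  | apply: measurable_fun_rVZ; meas | apply: measurable_fun_rVN; meas
  | apply: measurable_fun_rVD; meas | apply: measurable_funD; meas
  | apply: measurable_fun_oppr; meas ]
with meas_leaf := first [ exact: measurable_cst | exact: measurable_id
  | exact: measurable_fst | exact: measurable_snd | assumption | exact: measurable_normsq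
  | exact: measurable_gammak | exact: measurable_powR | exact: measurable_expR ].
Ltac emeas := apply/measurable_EFinP; meas.

Section rho.
Context {R : realType}.
Implicit Types (n : nat).

Definition rho n (x : 'rV[R]_n) : R := 1 + normsq x.

Lemma rho_ge1 n (x : 'rV[R]_n) : 1 <= rho x.
Proof. by rewrite lerDl normsq_ge0. Qed.

Lemma rho_gt0 n (x : 'rV[R]_n) : 0 < rho x.
Proof. exact: lt_le_trans ltr01 (rho_ge1 x). Qed.

Lemma normsq_eq0 n (x : 'rV[R]_n) : (normsq x == 0) = (x == 0).
Proof.
apply/eqP/eqP => [|->]; last by rewrite /normsq big1// => i _; rewrite mxE expr0n.
move=> /psumr_eq0P x0; apply/rowP => i; rewrite mxE; apply/eqP.
by rewrite -sqrf_eq0 x0// => j _; exact: sqr_ge0.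
Qed.

Lemma powR_div (a b c : R) : 0 <= a -> 0 < b -> (a / b) `^ c = a `^ c * b `^ (- c).
Proof.
move=> a0 b0; rewrite powRM ?invr_ge0 ?(ltW b0)// -(powR_inv1 (ltW b0)).
by rewrite -powRrM mulN1r.
Qed.

Lemma gammak_split (b l l' t : R) :
  gammak b (l + l') t = gammak b l t * expR (- (l' * t)).
Proof.
rewrite /gammak; case: ifP; last by rewrite mul0r.
by rewrite -mulrA -expRD mulrDl opprD.
Qed.

Lemma gammak_powR (a b l t : R) :
  gammak (a + b) l t = t `^ b * gammak a l t.
Proof.
rewrite /gammak; case: ifPn; last by rewrite mulr0.
move=> t0; rewrite mulrA; congr (_ * _); rewrite -gt0_powRD//.
by congr powR; ring.
Qed.

(** The power rho^-k is a Gamma integral of Gaussians; after Tonelli the integral in y is (pi /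
    r)^(n / 2), which lowers the Gamma exponent from k to k - n / 2. The hypothesis is the
    convergence condition of that last integral. *)
Lemma integral_rho_powR n (k : R) : n%:R / 2 < k ->
  (\int[lebesgue_rV R n]_y (rho y `^ (- k))%:E =
   (pi `^ (n%:R / 2) * Gamma (k - n%:R / 2) / Gamma k)%:E)%E.
Proof.
move=> nk; have k0 : 0 < k by rewrite (le_lt_trans _ nk).
have Gk := Gamma_gt0 k0.
transitivity (\int[lebesgue_rV R n]_y ((Gamma k)^-1%:E *
   \int[lebesgue_measure]_r (gammak k (rho y) r)%:E))%E.
  apply: eq_integral => y _; rewrite integral_gammak ?rho_gt0//.
  by rewrite -EFinM mulrA mulVf ?mul1r// gt_eqF.
rewrite ge0_integralZl; first last.
- by rewrite lee_fin invr_ge0 ltW.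
- by move=> y _; apply: integral_ge0 => r _; rewrite lee_fin gammak_ge0.
- under eq_fun do rewrite integral_gammak ?rho_gt0//.
  by rewrite /rho; emeas.
- exact: measurableT.
rewrite mulrC EFinM; congr (_ * _)%E.
etransitivity.
  apply: (tonelli (lebesgue_rV R n) (@lebesgue_measure R)
     (k := fun y r => (gammak k (rho y) r)%:E)).
    by rewrite /rho; emeas.
  by move=> y r; rewrite lee_fin gammak_ge0.
transitivity (\int[lebesgue_measure]_r
  ((pi `^ (n%:R / 2))%:E * (gammak (k - n%:R / 2) 1 r)%:E))%E.
  apply: eq_integral => r _; have [r0|r0] := leP r 0.
    rewrite /gammak ltNge r0/= mule0 integral0_eq//.
  transitivity ((gammak k 1 r)%:E * \int[lebesgue_rV R n]_y
    (expR (- (r * normsq (0 - y) + 0 * normsq y)))%:E)%E.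
    rewrite -ge0_integralZl => [|//| |y _|]; last 3 first.
    - exact: measurable_gauss_rV.
    - by rewrite lee_fin expR_ge0.
    - by rewrite lee_fin gammak_ge0.
    apply: eq_integral => y _; rewrite /rho gammak_split EFinM; congr (_ * (expR _)%:E)%E.
    by rewrite mul0r addr0 sub0r normsqN mulrC.
  rewrite integral_gauss_rV// -!EFinM; congr EFin.
  rewrite mulr0 mul0r mul0r oppr0 expR0 mulr1 addr0 gammak_powR.
  by rewrite powR_div ?pi_ge0// mulrC mulrA.
rewrite ge0_integralZl => [|//| |r _|]; last 3 first.
- exact: measurable_gammakE.
- by rewrite lee_fin gammak_ge0.
- by rewrite lee_fin powR_ge0.
by rewrite integral_gammak ?subr_gt0// powR1 mulr1.
Qed.

End rho.

Section riesz_of_rho.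
Context {R : realType}.
Variables (n : nat) (A beta : R).
Hypotheses (n_gt0 : (0 < n)%N) (A_gt0 : 0 < A) (beta_gt0 : 0 < beta)
  (AbetaE : A + beta = n%:R / 2).

Lemma measurable_rV_set1 (x : 'rV[R]_n) : measurable [set x].
Proof.
rewrite (_ : [set x] = \big[setI/setT]_(i < n)
    ((fun y : 'rV[R]_n => y ord0 i : measurableTypeR R) @^-1` [set x ord0 i])).
  apply: bigsetI_measurable => i _; rewrite -[X in measurable X]setTI.
  by apply: measurable_rV_coord => //; exact: measurable_set1.
rewrite -bigcap_seq; apply/seteqP; split => [y -> //|y /= yx].
by apply/rowP => i; apply: yx; rewrite /= mem_index_enum.
Qed.

(** Allows the singularity of the Riesz kernel to be discarded; in dimension 0 the point has mass
    1. *)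
Lemma lebesgue_rV_set1 (x : 'rV[R]_n) : lebesgue_rV R n [set x] = 0%E.
Proof.
have := @lebesgue_rV_rect R n (fun i => [set x ord0 i]).
rewrite (_ : (fun _ => _) = [set x]); last first.
  apply/seteqP; split => y /=; first by move=> yx; apply/rowP => i; exact: yx.
  by move=> ->.
move=> ->; last by move=> i; exact: measurable_set1.
case: n n_gt0 x => // k _ x.
by rewrite big_ord_recl lebesgue_measure_set1 mul0e.
Qed.

(** The Riesz kernel, too, is a Gamma integral of Gaussians, in a parameter s; the integral in y is
    then that of a product of two Gaussians. *)
Let gauss_riesz (x : 'rV[R]_n) (r : R) : 0 < r ->
  (\int[lebesgue_rV R n]_y
     (normsq (x - y) `^ (- A) * expR (- (r * normsq y)))%:E =
   ((Gamma A)^-1)%:E * \int[lebesgue_measure]_s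
     (gammak A (r / (s + r) * normsq x) s * (pi / (s + r)) `^ (n%:R / 2))%:E)%E.
Proof.
move=> r0; have GA := Gamma_gt0 A_gt0.
have mk : measurable_fun setT (fun z : 'rV[R]_n * R => (gammak A 0 z.2 *
    expR (- (z.2 * normsq (x - z.1) + r * normsq z.1)))%:E) by emeas.
have k0 (y : 'rV[R]_n) (s : R) : (0 <= (gammak A 0 s *
    expR (- (s * normsq (x - y) + r * normsq y)))%:E)%E.
  by rewrite lee_fin mulr_ge0 ?gammak_ge0 ?expR_ge0.
transitivity (\int[lebesgue_rV R n]_y ((Gamma A)^-1%:E *
   \int[lebesgue_measure]_s (gammak A 0 s *
     expR (- (s * normsq (x - y) + r * normsq y)))%:E))%E.
  apply: ge0_ae_eq_integral => //.
  - by emeas.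
  - apply: emeasurable_funM => //.
    exact: (measurable_fun_integral (@lebesgue_measure R) mk k0).
  - by move=> y _; rewrite lee_fin mulr_ge0 ?powR_ge0 ?expR_ge0.
  - move=> y _; apply: mule_ge0; first by rewrite lee_fin invr_ge0 ltW.
    by apply: integral_ge0 => s _; rewrite lee_fin mulr_ge0 ?gammak_ge0 ?expR_ge0.
  (* At y = x the power 0^(-A) evaluates to 0 while the Gamma integral diverges, so the two
     integrands agree only off this point. *)
  exists [set x]; split; [exact: measurable_rV_set1|exact: lebesgue_rV_set1|].
  move=> y /= yx; apply: contrapT => xy; apply: yx => _.
  have xy0 : 0 < normsq (x - y).
    by rewrite lt_def normsq_ge0 normsq_eq0 subr_eq0 andbT; apply/eqP => xy'; exact: xy.
  transitivity ((Gamma A)^-1%:E * \int[lebesgue_measure]_s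
     ((expR (- (r * normsq y)))%:E * (gammak A (normsq (x - y)) s)%:E))%E; last first.
    congr (_ * _)%E; apply: eq_integral => s _; rewrite -EFinM; congr EFin.
    rewrite -[normsq (x - y)]add0r gammak_split add0r mulrC -mulrA -expRD opprD.
    by rewrite [s * _]mulrC.
  rewrite ge0_integralZl => [|//| |s _|]; last 3 first.
  - exact: measurable_gammakE.
  - by rewrite lee_fin gammak_ge0.
  - by rewrite lee_fin expR_ge0.
  rewrite integral_gammak// -!EFinM; congr EFin.
  by field; rewrite gt_eqF.
rewrite ge0_integralZl; first last.
- by rewrite lee_fin invr_ge0 ltW.
- by move=> y _; apply: integral_ge0 => s _; rewrite lee_fin mulr_ge0 ?gammak_ge0 ?expR_ge0.
- exact: (measurable_fun_integral (@lebesgue_measure R) mk k0).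
- exact: measurableT.
congr (_ * _)%E; etransitivity.
  by apply: (tonelli (lebesgue_rV R n) (@lebesgue_measure R) mk k0).
apply: eq_integral => s _; have [s0|s0] := leP s 0.
  by rewrite /gammak ltNge s0/= integral0_eq ?mul0r// => y _; rewrite mul0r.
under eq_integral do rewrite EFinM.
rewrite ge0_integralZl => [|//| |y _|]; last 3 first.
- exact: measurable_gauss_rV.
- by rewrite lee_fin expR_ge0.
- by rewrite lee_fin gammak_ge0.
rewrite integral_gauss_rV// ?(ltW r0)// -EFinM; congr EFin.
rewrite mulrCA mulrC; congr (_ * _).
rewrite -[r / (s + r) * _]add0r gammak_split; congr (_ * expR _).
by ring.
Qed.

Let riesz_rho_double (x : 'rV[R]_n) (b : R) : 0 < b ->
  (\int[lebesgue_rV R n]_y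
     (normsq (x - y) `^ (- A) * rho y `^ (- b))%:E =
   ((Gamma A * Gamma b)^-1)%:E * \int[lebesgue_measure]_r \int[lebesgue_measure]_s
     (gammak b 1 r * (gammak A (r / (s + r) * normsq x) s * (pi / (s + r)) `^ (n%:R / 2)))%:E)%E.
Proof.
move=> b0; have Gb := Gamma_gt0 b0; have GA := Gamma_gt0 A_gt0.
transitivity (\int[lebesgue_rV R n]_y ((Gamma b)^-1%:E *
   \int[lebesgue_measure]_r (gammak b 1 r *
     (normsq (x - y) `^ (- A) * expR (- (r * normsq y))))%:E))%E.
  apply: eq_integral => y _.
  transitivity ((Gamma b)^-1%:E * \int[lebesgue_measure]_r
     ((normsq (x - y) `^ (- A))%:E * (gammak b (rho y) r)%:E))%E; last first.
    congr (_ * _)%E; apply: eq_integral => s _; rewrite -EFinM; congr EFin.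
    by rewrite /rho gammak_split mulrCA [s * _]mulrC.
  rewrite ge0_integralZl => [|//| |s _|]; last 3 first.
  - exact: measurable_gammakE.
  - by rewrite lee_fin gammak_ge0.
  - by rewrite lee_fin powR_ge0.
  rewrite integral_gammak ?rho_gt0// -!EFinM; congr EFin.
  by field; rewrite gt_eqF.
have mk : measurable_fun setT (fun z : 'rV[R]_n * R => (gammak b 1 z.2 *
     (normsq (x - z.1) `^ (- A) * expR (- (z.2 * normsq z.1))))%:E) by emeas.
have k0 (y : 'rV[R]_n) (r : R) : (0 <= (gammak b 1 r *
     (normsq (x - y) `^ (- A) * expR (- (r * normsq y))))%:E)%E.
  by rewrite lee_fin !mulr_ge0 ?gammak_ge0 ?powR_ge0 ?expR_ge0.
rewrite ge0_integralZl; first last.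
- by rewrite lee_fin invr_ge0 ltW.
- by move=> y _; apply: integral_ge0 => s _; exact: k0.
- exact: (measurable_fun_integral (@lebesgue_measure R) mk k0).
- exact: measurableT.
rewrite invfM mulrC EFinM -muleA; congr (_ * _)%E; etransitivity.
  by apply: (tonelli (lebesgue_rV R n) (@lebesgue_measure R) mk k0).
have mk2 : measurable_fun setT (fun z : R * R => (gammak b 1 z.1 *
     (gammak A (z.1 / (z.2 + z.1) * normsq x) z.2 *
       (pi / (z.2 + z.1)) `^ (n%:R / 2)))%:E) by emeas.
have k20 (r s : R) : (0 <= (gammak b 1 r *
     (gammak A (r / (s + r) * normsq x) s * (pi / (s + r)) `^ (n%:R / 2)))%:E)%E.
  by rewrite lee_fin !mulr_ge0 ?gammak_ge0 ?powR_ge0.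
rewrite -ge0_integralZl; first last.
- by rewrite lee_fin invr_ge0 ltW.
- by move=> y _; apply: integral_ge0 => s _; exact: k20.
- exact: (measurable_fun_integral (@lebesgue_measure R) mk2 k20).
- exact: measurableT.
apply: eq_integral => r _; have [r0|r0] := leP r 0.
  rewrite integral0_eq; last by move=> y _; rewrite /gammak ltNge r0 mul0r.
  by rewrite integral0_eq ?mule0// => y _; rewrite /gammak ltNge r0 mul0r.
under eq_integral do rewrite EFinM.
rewrite ge0_integralZl => [|//| |y _|]; last 3 first.
- by emeas.
- by rewrite lee_fin mulr_ge0 ?powR_ge0 ?expR_ge0.
- by rewrite lee_fin gammak_ge0.
rewrite gauss_riesz// muleCA; congr (_ * _)%E.
under [RHS]eq_integral do rewrite EFinM.
rewrite ge0_integralZl => [//|//| |y _|].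
- by emeas.
- by rewrite lee_fin mulr_ge0 ?powR_ge0 ?gammak_ge0.
- by rewrite lee_fin gammak_ge0.
Qed.

(** A Beta integral: integrating in u first would give Gamma(c) times the integral of s^(a - 1) (1 +
    r s)^-c. Integrating in s first instead lowers the exponent of u from c to c - a, and only Gamma
    integrals are needed. *)
Let integral_gammak2 (a c r : R) : 0 < a -> a < c -> 0 < r ->
  (\int[lebesgue_measure]_s \int[lebesgue_measure]_u
     (gammak a (u * r) s * gammak c 1 u)%:E =
   (Gamma a * Gamma (c - a) * r `^ (- a))%:E)%E.
Proof.
move=> a0 ac r0.
have mk : measurable_fun setT (fun z : R * R =>
  (gammak a (z.2 * r) z.1 * gammak c 1 z.2)%:E) by emeas.
have k0 (s u : R) : (0 <= (gammak a (u * r) s * gammak c 1 u)%:E)%E.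
  by rewrite lee_fin mulr_ge0 ?gammak_ge0.
etransitivity; first exact: (tonelli (@lebesgue_measure R) (@lebesgue_measure R) mk k0).
transitivity (\int[lebesgue_measure]_u
   ((Gamma a * r `^ (- a))%:E * (gammak (c - a) 1 u)%:E))%E.
  apply: eq_integral => u _; have [u0|u0] := leP u 0.
    rewrite integral0_eq; last by move=> y _; rewrite /gammak [0 < u]ltNge u0 mulr0.
    by rewrite /gammak ltNge u0 mule0.
  under eq_integral do rewrite EFinM muleC.
  rewrite ge0_integralZl => [|//| |y _|]; last 3 first.
  - by emeas.
  - by rewrite lee_fin gammak_ge0.
  - by rewrite lee_fin gammak_ge0.
  rewrite integral_gammak ?mulr_gt0// -!EFinM; congr EFin.
  rewrite gammak_powR powRM ?ltW//; ring.
rewrite ge0_integralZl => [|//| |y _|]; last 3 first.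
- by emeas.
- by rewrite lee_fin gammak_ge0.
- by rewrite lee_fin mulr_ge0 ?powR_ge0// ltW// Gamma_gt0.
by rewrite integral_gammak ?subr_gt0// powR1 mulr1 -EFinM; congr EFin; ring.
Qed.

(** The double integral in r and s becomes explicit after the substitution s -> r s: the integral in
    r is a Gamma integral, the remaining factor (1 + s)^j is a polynomial, and each of its monomials
    gives a Beta integral. This is the origin of the binomial coefficients and of the powers A +
    i. *)
Lemma riesz_rho (x : 'rV[R]_n) (j : nat) :
  (\int[lebesgue_rV R n]_y
     (normsq (x - y) `^ (- A) * rho y `^ (- (A + 2 * beta + j%:R)))%:E =
   (pi `^ (n%:R / 2) / (Gamma A * Gamma (A + 2 * beta + j%:R)) *
     \sum_(i < j.+1) 'C(j, i)%:R * Gamma (A + i%:R) * Gamma (beta + (j - i)%:R) *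
        rho x `^ (- (A + i%:R)))%:E)%E.
Proof.
set b := A + 2 * beta + j%:R; pose c : R := n%:R / 2 + j%:R.
have b0 : 0 < b by rewrite /b ltr_wpDr// addr_gt0// mulr_gt0.
have c0 : 0 < c by rewrite /c -AbetaE ltr_wpDr// addr_gt0.
rewrite riesz_rho_double// -[in RHS]mulrA [in RHS]mulrCA [in RHS]EFinM; congr (_ * _)%E.
set nx := normsq x; have nx0 : 0 <= nx := normsq_ge0 x.
have rx0 := rho_gt0 x.
(* The integrand after s -> r s. All powers of r combine to r^(c - 1), because b + A - n / 2 = c. *)
pose g (r s : R) := if 0 < s then (pi `^ (n%:R / 2) * (s `^ (A - 1) *
  (1 + s) `^ (- (n%:R / 2)))) * gammak c (1 + s / (1 + s) * nx) r else 0.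
have g0 r s : (0 <= (g r s)%:E)%E.
  by rewrite lee_fin /g; case: ifP => // _; rewrite !mulr_ge0 ?powR_ge0 ?gammak_ge0.
have mg : measurable_fun [set: R * R] (fun z : R * R => (g z.1 z.2)%:E).
  by apply/measurable_EFinP; apply: measurable_pos_if; meas.
transitivity (\int[lebesgue_measure]_r \int[lebesgue_measure]_s (g r s)%:E)%E.
  apply: eq_integral => r _; have [r0|r0] := leP r 0.
    rewrite integral0_eq; last by move=> y _; rewrite /gammak ltNge r0 mul0r.
    rewrite integral0_eq// => y _; rewrite /g; case: ifP => // _.
    by rewrite /gammak ltNge r0 mulr0.
  pose H (s : R) := (gammak b 1 r * (gammak A (r / (s + r) * nx) s *
     (pi / (s + r)) `^ (n%:R / 2)))%:E.
  have mH : measurable_fun [set: R] H by rewrite /H; emeas.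
  have H0 s : (0 <= H s)%E.
    by rewrite lee_fin !mulr_ge0 ?gammak_ge0 ?powR_ge0.
  have := ge0_integral_affine 0 (lt0r_neq0 r0) mH H0.
  move=> /(congr1 (fun z => r%:E * z)%E); rewrite muleA -EFinM gtr0_norm//.
  rewrite mulfV ?gt_eqF// mul1e => <-.
  rewrite -ge0_integralZl => [|//| |y _|]; last 3 first.
  - by apply: (measurableT_comp mH); exact: measurable_affine.
  - exact: H0.
  - by rewrite lee_fin ltW.
  apply: eq_integral => s _; rewrite /H /g add0r -EFinM; congr EFin.
  have [s0|s0] := ltP 0 s; last first.
    by rewrite [gammak A _ _]/gammak pmulr_rgt0// ltNge s0 mul0r !mulr0.
  rewrite /gammak r0 pmulr_rgt0// s0.
  have -> : r * s + r = r * (1 + s) by ring.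
  have s1 : 0 < 1 + s by rewrite addr_gt0.
  rewrite powR_div ?pi_ge0 ?mulr_gt0// !powRM ?(ltW r0) ?(ltW s0) ?(ltW s1)//.
  have -> : expR (- ((1 + s / (1 + s) * nx) * r)) =
     expR (- (1 * r)) * expR (- (r / (r * (1 + s)) * nx * (r * s))).
    rewrite -expRD; congr expR.
    by field; rewrite !gt_eqF.
  have -> : r `^ (c - 1) = r * r `^ (b - 1) * r `^ (A - 1) * r `^ (- (n%:R / 2)).
    rewrite -{2}(powRr1 (ltW r0)) -!gt0_powRD//; congr (_ `^ _).
    by rewrite /b /c -AbetaE; ring.
  by ring.
etransitivity; first exact: (tonelli (@lebesgue_measure R) (@lebesgue_measure R) mg g0).
(* The factor (1 + rho x s)^-c is reopened as a Gamma integral in u, which brings each monomial s^i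
   into the form of [integral_gammak2]. *)
pose h i (s : R) := (\int[lebesgue_measure]_u
     (gammak (A + i%:R) (u * rho x) s * gammak c 1 u)%:E)%E.
have mh i : measurable_fun [set: R] (h i).
  apply: (@measurable_fun_integral _ _ _ _ R (@lebesgue_measure R)
    (fun s u => (gammak (A + i%:R) (u * rho x) s * gammak c 1 u)%:E)).
    by emeas.
  by move=> s u; rewrite lee_fin mulr_ge0 ?gammak_ge0.
have h0 i s : (0 <= h i s)%E.
  by apply: integral_ge0 => u _; rewrite lee_fin mulr_ge0 ?gammak_ge0.
transitivity (\int[lebesgue_measure]_s \sum_(i < j.+1)
   ((pi `^ (n%:R / 2) * 'C(j, i)%:R)%:E * h i s))%E.
  apply: eq_integral => s _; have [s0|s0] := leP s 0.
    rewrite integral0_eq; last by move=> r _; rewrite /g ltNge s0.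
    rewrite big1// => i _; rewrite /h integral0_eq ?mule0// => u _.
    by rewrite /gammak ltNge s0 mul0r.
  have s1 : 0 < 1 + s by rewrite addr_gt0.
  have l0 : 0 < 1 + s / (1 + s) * nx.
    by rewrite ltr_wpDr// mulr_ge0// divr_ge0// ltW.
  under eq_integral do rewrite /g s0 EFinM.
  rewrite ge0_integralZl => [|//| |y _|]; last 3 first.
  - by emeas.
  - by rewrite lee_fin gammak_ge0.
  - by rewrite lee_fin !mulr_ge0 ?powR_ge0.
  rewrite integral_gammak//.
  have L0 : 0 < 1 + rho x * s by rewrite addr_gt0// mulr_gt0.
  transitivity (\sum_(i < j.+1) (pi `^ (n%:R / 2) * 'C(j, i)%:R *
     (s `^ (A + i%:R - 1) * (Gamma c * (1 + rho x * s) `^ (- c))))%:E)%E; last first.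
    apply: eq_bigr => i _; rewrite [LHS]EFinM; congr (_ * _)%E.
    rewrite EFinM -integral_gammak// -ge0_integralZl => [|//| |y _|]; last 3 first.
    - by emeas.
    - by rewrite lee_fin gammak_ge0.
    - by rewrite lee_fin powR_ge0.
    apply: eq_integral => u _; rewrite -EFinM; congr EFin.
    rewrite gammak_split [in RHS]/gammak s0 mulrCA mulrC; congr (_ * expR _ * _).
    by ring.
  rewrite sumEFin -EFinM; congr EFin.
  (* The rate of the integral in r equals (1 + rho x s) / (1 + s). Its power -c contributes (1 +
     s)^(n / 2 + j), and the factor (1 + s)^(- n / 2) in g leaves (1 + s)^j. *)
  transitivity (pi `^ (n%:R / 2) * (s `^ (A - 1) * (Gamma c * (1 + rho x * s) `^ (- c))) *
     (1 + s) ^+ j).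
    have -> : 1 + s / (1 + s) * nx = (1 + rho x * s) / (1 + s).
      by rewrite /rho -/nx; field; rewrite gt_eqF.
    rewrite powR_div ?(ltW L0)// opprK.
    have -> : (1 + s) `^ c = (1 + s) `^ (n%:R / 2) * (1 + s) ^+ j.
      by rewrite gt0_powRD// powR_mulrn// ltW.
    have : (1 + s) `^ (- (n%:R / 2)) * (1 + s) `^ (n%:R / 2) = 1.
      by rewrite -gt0_powRD// addNr powRr0.
    move: ((1 + s) `^ (- (n%:R / 2))) ((1 + s) `^ (n%:R / 2)) => p q pq.
    transitivity (pi `^ (n%:R / 2) * (s `^ (A - 1) * (Gamma c * (1 + rho x * s) `^ (- c))) *
     (1 + s) ^+ j * (p * q)); first by ring.
    by rewrite pq mulr1.
  rewrite exprDn mulr_sumr; apply: eq_bigr => i _.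
  rewrite expr1n mul1r -[_ *+ 'C(j, i)]mulr_natr.
  have -> : A + i%:R - 1 = (A - 1) + i%:R by ring.
  by rewrite (gt0_powRD (A - 1) i%:R s0) powR_mulrn ?(ltW s0)//; ring.
rewrite ge0_integral_sum//; last 2 first.
- by move=> i; apply: emeasurable_funM => //; exact: mh.
- by move=> i s _; rewrite mule_ge0// lee_fin mulr_ge0 ?powR_ge0.
rewrite mulr_sumr -sumEFin; apply: eq_bigr => i _.
rewrite ge0_integralZl => [|//| |y _|]; last 3 first.
- exact: mh.
- exact: h0.
- by rewrite lee_fin mulr_ge0 ?powR_ge0.
have ij : (i <= j)%N by rewrite -ltnS ltn_ord.
have ic : A + i%:R < c.
  have : (i%:R : R) <= j%:R by rewrite ler_nat.
  by move: beta_gt0; rewrite /c -AbetaE; lra.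
rewrite /h (integral_gammak2 _ ic rx0) ?ltr_wpDr//.
rewrite -EFinM; congr EFin.
have -> : c - (A + i%:R) = beta + (j - i)%:R.
  by rewrite natrB// /c -AbetaE; ring.
by ring.
Qed.

End riesz_of_rho.

(** * The wavelet *)

Section binomial_series.
Context {R : realType}.
Implicit Types (a b : R) (j k m : nat).

(** This is (-1)^k times the generalized binomial coefficient of a over k, the coefficient of z^k in
    (1 - z)^a. *)
Fixpoint bincoef a k : R :=
  if k is k'.+1 then bincoef a k' * (k'%:R - a) / k'.+1%:R else 1.

Lemma bincoefSE a k : k.+1%:R * bincoef a k.+1 = (k%:R - a) * bincoef a k.
Proof. by rewrite /= mulrC mulfVK ?pnatr_eq0// mulrC. Qed.

Lemma bincoef_addr1 a k : bincoef (a + 1) k.+1 = bincoef a k.+1 - bincoef a k.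
Proof.
elim: k => [|k IHk]; first by rewrite /= !mul1r !sub0r divr1 divr1; ring.
have k2 : (k.+2%:R : R) != 0 by rewrite pnatr_eq0.
apply: (mulfI k2); rewrite mulrBr !bincoefSE IHk.
have E := bincoefSE a k; apply/eqP; rewrite -subr_eq0; apply/eqP.
transitivity (k.+1%:R * bincoef a k.+1 - (k%:R - a) * bincoef a k).
  by rewrite -!natr1; ring.
by rewrite E subrr.
Qed.

(** The identity (1 - z)^a (1 - z)^-a = 1 without power series. Splitting the weight k + 1 as i + (k
    + 1 - i) and applying [bincoefSE] to each part gives the factors i - a and k - i + a, of sum k;
    so (k + 1) c_(k+1) = k c_k, and all terms after the first vanish. *)
Lemma bincoef_convolution a j :
  \sum_(i < j.+1) bincoef a i * bincoef (- a) (j - i) = (j == 0%N)%:R.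
Proof.
pose c j := \sum_(i < j.+1) bincoef a i * bincoef (- a) (j - i).
have cS k : k.+1%:R * c k.+1 = k%:R * c k.
  rewrite /c mulr_sumr.
  transitivity (\sum_(i < k.+2) i%:R * bincoef a i * bincoef (- a) (k.+1 - i) +
    \sum_(i < k.+2) (k.+1 - i)%:R * bincoef a i * bincoef (- a) (k.+1 - i)).
    rewrite -big_split; apply: eq_bigr => i _ /=.
    rewrite -!mulrA -mulrDl -natrD subnKC// -ltnS; exact: ltn_ord.
  rewrite big_ord_recl/= !mul0r add0r [X in _ + X]big_ord_recr/= subnn !mul0r addr0.
  rewrite -big_split mulr_sumr; apply: eq_bigr => i _ /=.
  have ik : (i <= k)%N by rewrite -ltnS ltn_ord.
  rewrite -[bump 0 i]/(i.+1) subSS subSn//.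
  rewrite bincoefSE -mulrA [_ * (_ * bincoef (- a) _)]mulrCA bincoefSE natrB//.
  by ring.
elim: j => [|j IHj]; first by rewrite big_ord1 mulr1.
have : j.+1%:R * c j.+1 = 0.
  by rewrite cS /c IHj; case: (j) => [|l]; rewrite ?mul0r ?mulr0.
by move/eqP; rewrite mulf_eq0 pnatr_eq0/= => /eqP.
Qed.

(** The Pochhammer symbol (a)_k, a quotient of Gamma values away from the poles. *)
Definition rising a k : R := \prod_(i < k) (a + i%:R).

Lemma risingS a k : rising a k.+1 = rising a k * (a + k%:R).
Proof. exact: big_ord_recr. Qed.

Lemma rising_add a k j : rising a (k + j) = rising a k * rising (a + k%:R) j.
Proof.
elim: j => [|j IHj]; first by rewrite addn0 [rising _ 0]big_ord0 mulr1.
by rewrite addnS !risingS IHj natrD; ring.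
Qed.

Lemma Gamma_add_nat a k : 0 < a -> Gamma (a + k%:R) = rising a k * Gamma a.
Proof.
move=> a0; elim: k => [|k IHk]; first by rewrite addr0 /rising big_ord0 mul1r.
rewrite -natr1 addrA GammaS ?ltr_wpDr// IHk risingS; ring.
Qed.

(** For a <= 0 the inverse of Gamma(a) is rising a l / Gamma(a + l) by the way Gamma is continued.
    At a pole this is 0, and so is the left side, since k is at least l and the vanishing factor is
    included. *)
Lemma risingE a k : 0 < a + k%:R -> rising a k = (Gamma a)^-1 * Gamma (a + k%:R).
Proof.
move=> ak; have [a0|a0] := ltP 0 a.
  by rewrite Gamma_add_nat//; field; rewrite gt_eqF// Gamma_gt0.
have Na0 : 0 <= - a by rewrite oppr_ge0.
pose l := (Num.truncn (- a)).+1.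
have al : 0 < a + l%:R by have := truncnS_gt (- a); rewrite -/l; lra.
have -> : Gamma a = Gamma (a + l%:R) / rising a l.
  by rewrite {1}/Gamma ltNge a0/= -/l /Gamma al.
have lk : (l <= k)%N.
  by rewrite truncn_lt_nat//; lra.
rewrite invf_div -(subnKC lk) rising_add natrD addrA (Gamma_add_nat (k - l) al).
by field; rewrite gt_eqF// Gamma_gt0.
Qed.

Lemma bincoef_risingE a k : k`!%:R * bincoef (- a) k = rising a k.
Proof.
elim: k => [|k IHk]; first by rewrite /rising big_ord0 mulr1.
rewrite risingS -IHk factS natrM.
transitivity (k`!%:R * (k.+1%:R * bincoef (- a) k.+1)); first by ring.
by rewrite bincoefSE opprK; ring.
Qed.

Lemma ffactSr (j k : nat) : (j.+1 ^_ k.+1 = j ^_ k.+1 + k.+1 * j ^_ k)%N.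
Proof.
rewrite ffactSS ffactnSr; have [kj|jk] := leqP k j.
  by rewrite [(_ ^_ _ * _)%N]mulnC -mulnDl addnS subnK.
by rewrite ffact_small// !muln0.
Qed.

Lemma natr_ffactS (j k : nat) : (j ^_ k.+1)%:R = (j ^_ k)%:R * (j%:R - k%:R) :> R.
Proof.
rewrite ffactnSr natrM; have [kj|jk] := leqP k j; first by rewrite natrB.
by rewrite ffact_small// !mul0r.
Qed.

(** The recurrence that carries the coefficients of the j-th iterated Laplacian of a power of rho to
    those of the next one. *)
Lemma bincoef_ffactS a j k :
  bincoef (a + 1) k.+1 * (j.+1 ^_ k.+1)%:R =
  bincoef a k.+1 * (j ^_ k.+1)%:R +
  (k%:R - 1 - j%:R - a) * (bincoef a k * (j ^_ k)%:R).
Proof.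
rewrite bincoef_addr1 ffactSr natrD natrM natr_ffactS.
have E := bincoefSE a k; apply/eqP; rewrite -subr_eq0; apply/eqP.
transitivity ((j ^_ k)%:R * (k.+1%:R * bincoef a k.+1 - (k%:R - a) * bincoef a k)).
  by rewrite -!natr1; ring.
by rewrite E subrr mulr0.
Qed.

(** The counterpart with j fixed, which governs the derivative in the scale parameter. *)
Lemma bincoef_ffact_addr1 a j k :
  bincoef (a + 1) k.+1 * (j ^_ k.+1)%:R =
  bincoef a k.+1 * (j ^_ k.+1)%:R - (j%:R - k%:R) * (bincoef a k * (j ^_ k)%:R).
Proof. by rewrite bincoef_addr1 natr_ffactS; ring. Qed.

End binomial_series.

(** * The Laplacian on powers of 1 + |x|^2 *)

Section laplacian_rho.
Context {R : realType} {n : nat}.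
Implicit Types (x : 'rV[R]_n) (N : nat).

Lemma is_derive_line (f : 'rV[R]_n -> R) x v l :
  is_derive (0 : R) 1 (fun h => f (h *: v + x)) l -> is_derive x v f l.
Proof.
move=> [df <-].
have E : (fun h : R => h^-1 *: ((f \o shift x) (h *: v) - f x)) =
  (fun h : R => h^-1 *: (((fun h => f (h *: v + x)) \o shift 0) (h *: (1 : R)) -
     (fun h => f (h *: v + x)) 0)).
  by apply/funext => h /=; rewrite addr0 scale0r add0r /GRing.scale/= mulr1.
split; first by rewrite /derivable E.
by rewrite /derive E.
Qed.

Lemma rho_line x i (h : R) :
  rho (h *: delta_mx ord0 i + x) = rho x + 2 * h * x ord0 i + h ^+ 2.
Proof.
rewrite /rho -!addrA; congr (_ + _).
rewrite /normsq (bigD1 i)//= [X in _ = X + _](bigD1 i)//= !mxE !eqxx.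
rewrite [X in _ + X](eq_bigr (fun k => x ord0 k ^+ 2)); last first.
  by move=> k /negPf ki; rewrite !mxE ki andbF mulr0 add0r.
by rewrite /=; ring.
Qed.

Let is_derive_rho_line x i (c : R) :
  is_derive (0 : R) 1 (fun h => (rho x + 2 * h * x ord0 i + h ^+ 2) `^ c)
   (2 * c * x ord0 i * rho x `^ (c - 1)).
Proof.
pose g (h : R) := rho x + 2 * h * x ord0 i + h ^+ 2.
have g0 : g 0 = rho x by rewrite /g; ring.
have dg : is_derive (0 : R) 1 g (2 * x ord0 i).
  by apply: is_derive_eq; rewrite /GRing.scale/=; ring.
have dp : is_derive (g 0) 1 ((@powR R)^~ c) (c * g 0 `^ (c - 1)).
  by apply: is_derive1_powR; rewrite g0 rho_gt0.
have := @is_derive1_comp _ _ _ _ _ _ dp dg; rewrite g0 => H.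
by apply: is_derive_eq; ring.
Qed.

Lemma is_derive_rho_powR x i (c : R) :
  is_derive x (delta_mx ord0 i) (fun y => rho y `^ c)
    (2 * c * x ord0 i * rho x `^ (c - 1)).
Proof.
apply: is_derive_line; under eq_fun do rewrite rho_line.
exact: is_derive_rho_line.
Qed.

Lemma is_derive_coord_rho_powR x i (c : R) :
  is_derive x (delta_mx ord0 i) (fun y => y ord0 i * rho y `^ c)
    (rho x `^ c + 2 * c * x ord0 i ^+ 2 * rho x `^ (c - 1)).
Proof.
apply: is_derive_line.
rewrite (_ : (fun _ => _) = (fun h : R => h + x ord0 i) \*
   (fun h => (rho x + 2 * h * x ord0 i + h ^+ 2) `^ c)); last first.
  by apply/funext => h; rewrite /= rho_line !mxE !eqxx mulr1.
have d1 : is_derive (0 : R) 1 (fun h : R => h + x ord0 i) 1.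
  by apply: is_derive_eq; rewrite addr0.
have d2 := is_derive_rho_line x i c.
have := @is_deriveM _ _ _ _ _ _ _ _ d1 d2.
rewrite /GRing.scale/= add0r mulr0 mul0r addr0 expr0n/= addr0 => H.
by apply: is_derive_eq; ring.
Qed.

(** Summing the squares of the coordinates gives |x|^2 = rho - 1, so the span of the powers of rho
    is stable: each power goes to a combination of the next two. *)
Lemma neg_laplacian_sum_rho N (c e : 'I_N -> R) :
  neg_laplacian (fun x => \sum_(k < N) c k * rho x `^ (- e k)) =
  (fun x : 'rV[R]_n => \sum_(k < N) c k *
     ((2 * n%:R * e k - 4 * e k * (e k + 1)) * rho x `^ (- (e k + 1)) +
      4 * e k * (e k + 1) * rho x `^ (- (e k + 2)))).
Proof.
apply/funext => x; rewrite /neg_laplacian /laplacian.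
under eq_bigr => i _.
  have -> : 'D_(delta_mx ord0 i) (fun x => \sum_(k < N) c k * rho x `^ (- e k)) =
      (fun x : 'rV[R]_n => \sum_(k < N) (- 2 * c k * e k) *
        (x ord0 i * rho x `^ (- e k - 1))).
    apply/funext => y; apply: derive_val.
    rewrite (_ : (fun _ => _) = \sum_(k < N) (c k *: (fun x : 'rV[R]_n => rho x `^ (- e k)))); last first.
      by apply/funext => z; rewrite fct_sumE; apply: eq_bigr => k _.
    have dk k : is_derive y (delta_mx ord0 i) (c k *: (fun x : 'rV[R]_n => rho x `^ (- e k)))
        (- 2 * c k * e k * (y ord0 i * rho y `^ (- e k - 1))).
      have := is_derive_rho_powR y i (- e k) => H.
      by apply: is_derive_eq; rewrite /GRing.scale/=; ring.
    exact: is_derive_sum.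
  have -> : 'D_(delta_mx ord0 i) (fun x : 'rV[R]_n => \sum_(k < N) (- 2 * c k * e k) *
        (x ord0 i * rho x `^ (- e k - 1))) x = \sum_(k < N) (- 2 * c k * e k) *
     (rho x `^ (- e k - 1) + 2 * (- e k - 1) * x ord0 i ^+ 2 * rho x `^ (- e k - 1 - 1)).
    apply: derive_val.
    rewrite (_ : (fun _ => _) = \sum_(k < N) ((- 2 * c k * e k) *:
       (fun x : 'rV[R]_n => x ord0 i * rho x `^ (- e k - 1)))); last first.
      by apply/funext => z; rewrite fct_sumE; apply: eq_bigr => k _.
    have dk k : is_derive x (delta_mx ord0 i) ((- 2 * c k * e k) *:
       (fun x : 'rV[R]_n => x ord0 i * rho x `^ (- e k - 1)))
      ((- 2 * c k * e k) *
     (rho x `^ (- e k - 1) + 2 * (- e k - 1) * x ord0 i ^+ 2 * rho x `^ (- e k - 1 - 1))).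
      have := is_derive_coord_rho_powR x i (- e k - 1) => H.
      by apply: is_derive_eq; rewrite /GRing.scale/=; ring.
    exact: is_derive_sum.
  over.
rewrite exchange_big/= -sumrN; apply: eq_bigr => k _.
rewrite -mulr_sumr big_split/= sumr_const card_ord -mulr_suml -mulr_sumr -/(normsq x).
rewrite -[_ *+ n]mulr_natr (_ : - (e k + 1) = - e k - 1); last by ring.
rewrite (_ : - (e k + 2) = - e k - 1 - 1); last by ring.
have -> : rho x `^ (- e k - 1) = rho x `^ (- e k - 1 - 1) * rho x.
  by rewrite -[X in _ * X](powRr1 (ltW (rho_gt0 x))) -gt0_powRD ?rho_gt0// subrK.
by rewrite /rho; ring.
Qed.

End laplacian_rho.

(** * The wavelet as a combination of powers of 1 + |x|^2 *)

Section wavelet_rho.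
Context {R : realType} {n : nat}.
Implicit Types (x y : 'rV[R]_n) (j k m : nat).

(* With beta = alpha / 2 and B = (n + alpha) / 2 this is a multiple of the wavelet w.
   The weights [bincoef beta k] are the coefficients of (1 - z)^beta. *)
Definition rho_comb (beta B : R) m y : R :=
  \sum_(k < m.+1) bincoef beta k * (m ^_ k)%:R * Gamma (B + (m - k)%:R) *
    rho y `^ (- (B + (m - k)%:R)).

(** Each Laplacian raises the upper argument of [bincoef] by 1, and the induction step is the
    recurrence [bincoef_ffactS]. *)
Lemma iter_neg_laplacian_rho (a : R) j :
  iter j (@neg_laplacian R n) (fun y : 'rV[R]_n => rho y `^ (- a)) =
  (fun y => 4 ^+ j * \sum_(k < j.+1) bincoef (a - n%:R / 2 + j%:R) k *
     (j ^_ k)%:R * rising a (2 * j - k) * rho y `^ (- (a + (2 * j - k)%:R))).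
Proof.
elim: j => [|j IHj].
  apply/funext => y /=; rewrite big_ord1 /= muln0 subn0 /rising big_ord0 addr0.
  by rewrite !mul1r.
rewrite iterS IHj.
under eq_fun do rewrite mulr_sumr.
under eq_fun do under eq_bigr do rewrite mulrA.
rewrite neg_laplacian_sum_rho; apply/funext => y.
set g := a - n%:R / 2 + j%:R.
have -> : a - n%:R / 2 + j.+1%:R = g + 1.
  by rewrite /g -[j.+1%:R]natr1 addrA.
pose t k : R := bincoef g k * (j ^_ k)%:R.
pose G k := rising a k * rho y `^ (- (a + k%:R)).
(* Each new coefficient has two sources: the old term k feeds the orders 2 j + 2 - k and 2 j + 1 -
   k, the latter with weight k - 1 - j - g. *)
transitivity (4 ^+ j.+1 * (\sum_(k < j.+2) t k * G (2 * j.+1 - k)%N +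
  \sum_(k < j.+1) (k%:R - 1 - j%:R - g) * t k * G (2 * j.+1 - k.+1)%N)); last first.
  congr (_ * _); rewrite [X in X + _]big_ord_recl [in RHS]big_ord_recl.
  rewrite -addrA -big_split/=; congr (_ + _).
    by rewrite /t /G ffactn0 !mulrA.
  apply: eq_bigr => k _; rewrite -[bump 0 k]/(k.+1) bincoef_ffactS /t /G; ring.
have tj : t j.+1 = 0 by rewrite /t ffact_small// mulr0.
rewrite [X in _ * (X + _)]big_ord_recr /= tj mul0r addr0.
rewrite -big_split mulr_sumr; apply: eq_bigr => k _ /=.
have kj : (k <= 2 * j)%N.
  by rewrite (leq_trans (_ : k <= j)%N) ?leq_pmull// -ltnS ltn_ord.
set L := (2 * j - k)%N.
have -> : (2 * j.+1 - k = L.+2)%N by rewrite /L mulnS; lia.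
have -> : (2 * j.+1 - k.+1 = L.+1)%N by rewrite /L mulnS; lia.
have LE : L%:R = 2 * j%:R - k%:R :> R by rewrite /L natrB// natrM.
have gE : g = a - n%:R / 2 + j%:R by [].
rewrite /G !risingS -/(t k) -[L.+2%:R]natr1 -[L.+1%:R]natr1 exprS.
rewrite (_ : a + L%:R + 1 = a + (L%:R + 1)); last by ring.
rewrite (_ : a + L%:R + 2 = a + (L%:R + 1 + 1)); last by ring.
by rewrite gE LE; field.
Qed.

(** The case j = m is w, the case j = m + 1 is - Delta w. If m - B is a natural number, the power is
    a polynomial of degree 2 (m - B) < 2 j, killed by Delta^j; then Gamma(B - m) = 0 and division by
    0 makes the right side vanish too. *)
Lemma iter_neg_laplacian_rho_comb (beta B : R) m j :
  beta + n%:R / 2 = B -> 0 < B -> (m <= j)%N ->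
  iter j (@neg_laplacian R n) (fun y : 'rV[R]_n => rho y `^ (m%:R - B)) =
  (fun y => 4 ^+ j / Gamma (B - m%:R) *
     rho_comb (beta + (j - m)%:R) (B + (j - m)%:R) j y).
Proof.
move=> BE B0 mj; rewrite -[m%:R - B]opprK opprB iter_neg_laplacian_rho.
apply/funext => y; rewrite -mulrA; congr (_ * _); rewrite /rho_comb mulr_sumr.
apply: eq_bigr => k _; have kj : (k <= j)%N by rewrite -ltnS ltn_ord.
have -> : B - m%:R - n%:R / 2 + j%:R = beta + (j - m)%:R.
  by rewrite natrB// -BE; ring.
have E : B - m%:R + (2 * j - k)%:R = B + (j - m)%:R + (j - k)%:R.
  by rewrite !natrB// ?natrM; [ring|lia].
rewrite risingE E; last by rewrite -addrA ltr_wpDr// addr_ge0.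
by ring.
Qed.

(** The right side has the form that the derivative of a dilated combination takes, see
    [is_derive_dilated_rho_comb]. *)
Lemma rho_comb_succ (beta B : R) m y : 0 < B ->
  rho_comb (beta + 1) (B + 1) m y =
  \sum_(k < m.+1) bincoef beta k * (m ^_ k)%:R * Gamma (B + (m - k)%:R) *
    ((B + (m - k)%:R) * rho y `^ (- (B + (m - k)%:R + 1)) -
     (m - k)%:R * rho y `^ (- (B + (m - k)%:R))).
Proof.
move=> B0; pose t k : R := bincoef beta k * (m ^_ k)%:R.
pose b k : R := B + (m - k)%:R.
have b0 k : 0 < b k by rewrite ltr_wpDr.
transitivity (\sum_(k < m.+1) t k * (Gamma (b k + 1) * rho y `^ (- (b k + 1))) -
  \sum_(k < m.+1) (m%:R - k%:R) * t k * (Gamma (b k) * rho y `^ (- b k))).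
  rewrite /rho_comb big_ord_recl [X in _ = X - _]big_ord_recl -[RHS]addrA; congr (_ + _).
    by rewrite /t /b /= ffactn0 [B + 1 + _]addrAC !mulrA.
  rewrite [X in _ = _ - X]big_ord_recr /= subrr !mul0r addr0 -sumrB.
  apply: eq_bigr => k _; have km := ltn_ord k.
  rewrite -[bump 0 k]/(k.+1) bincoef_ffact_addr1 -/(t k) -/(t k.+1).
  have -> : B + 1 + (m - k.+1)%:R = b k.
    by rewrite /b -(subnSK km) -[(m - k.+1).+1%:R]natr1; ring.
  have -> : b k.+1 + 1 = b k.
    by rewrite /b -(subnSK km) -[(m - k.+1).+1%:R]natr1; ring.
  by ring.
rewrite -sumrB; apply: eq_bigr => k _; rewrite GammaS// /t /b.
by have km : (k <= m)%N; [rewrite -ltnS ltn_ord|rewrite natrB//; ring].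
Qed.

(** The slowest term, k = m, fixes the decay; this bound is all that the Fubini argument uses of the
    wavelet. *)
Lemma rho_comb_bound (beta B : R) m :
  exists2 C : R, 0 <= C & forall y, `|rho_comb beta B m y| <= C * rho y `^ (- B).
Proof.
exists (\sum_(k < m.+1) `|bincoef beta k * (m ^_ k)%:R * Gamma (B + (m - k)%:R)|).
  exact: sumr_ge0.
move=> y; rewrite mulr_suml; apply: le_trans (ler_norm_sum _ _ _) _.
apply: ler_sum => k _; rewrite normrM; apply: ler_wpM2l => //.
by rewrite ger0_norm ?powR_ge0// ler_powR ?rho_ge1// lerN2 lerDl.
Qed.

Lemma measurable_rho_comb beta B m : measurable_fun setT (rho_comb beta B m).
Proof.
by apply: measurable_sum => k; rewrite /rho; meas.
Qed.

End wavelet_rho.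

(** * Collapse of the Riesz potential of the combination *)

Section riesz_of_rho_comb.
Context {R : realType}.
Variables (n : nat) (A beta : R).
Hypotheses (n_gt0 : (0 < n)%N) (A_gt0 : 0 < A) (beta_gt0 : 0 < beta)
  (AbetaE : A + beta = n%:R / 2).
Local Notation B := (A + 2 * beta).

Lemma integrable_riesz_rho (x : 'rV[R]_n) (j : nat) :
  (lebesgue_rV R n).-integrable setT
    (fun y => (normsq (x - y) `^ (- A) * rho y `^ (- (B + j%:R)))%:E).
Proof.
apply/integrableP; split; first by rewrite /rho; emeas.
under eq_integral do rewrite gee0_abs ?lee_fin ?mulr_ge0 ?powR_ge0//.
by rewrite riesz_rho// ltry.
Qed.

(** After exchanging the sums, Gamma(beta + l) = l! [bincoef (- beta) l] Gamma(beta) with l = m - k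
    - i, and the factorials combine to m! / i!. The inner sum is then a convolution of the
    coefficients of (1 - z)^beta and (1 - z)^-beta, which vanishes unless i = m. *)
Let sum_coef (F : nat -> R) m :
  \sum_(k < m.+1) bincoef beta k * (m ^_ k)%:R *
    (\sum_(i < (m - k).+1) 'C(m - k, i)%:R * Gamma (beta + (m - k - i)%:R) * F i) =
  Gamma beta * F m.
Proof.
transitivity (\sum_(k < m.+1) \sum_(i < m.+1 | (i < (m - k).+1)%N)
  bincoef beta k * (m ^_ k)%:R * ('C(m - k, i)%:R * Gamma (beta + (m - k - i)%:R) * F i)).
  apply: eq_bigr => k _; rewrite mulr_sumr.
  by rewrite (big_ord_widen m.+1
    (fun i => bincoef beta k * (m ^_ k)%:R * ('C(m - k, i)%:R * Gamma (beta + (m - k - i)%:R) * F i)))//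
    ltnS leq_subr.
rewrite (exchange_big_dep predT)//=.
transitivity (\sum_(i < m.+1) Gamma beta * F i * (m`!%:R / i`!%:R) *
   (\sum_(k < (m - i).+1) bincoef beta k * bincoef (- beta) (m - i - k))).
  apply: eq_bigr => i _; rewrite mulr_sumr.
  have im : (i <= m)%N by rewrite -ltnS ltn_ord.
  rewrite (big_ord_widen m.+1 (fun k => Gamma beta * F i * (m`!%:R / i`!%:R) *
     (bincoef beta k * bincoef (- beta) (m - i - k)))) ?ltnS ?leq_subr//.
  apply: eq_big => [k|k]; have km : (k <= m)%N by rewrite -ltnS ltn_ord.
    by rewrite !ltnS; lia.
  rewrite ltnS => ik.
  have imk : (i + k <= m)%N by lia.
  have -> : (m - i - k = m - k - i)%N by lia.
  rewrite Gamma_add_nat// -bincoef_risingE.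
  have /(congr1 (fun z => z%:R : R)) E : (m ^_ k * 'C(m - k, i) * (i`! * (m - k - i)`!) = m`!)%N.
    by rewrite -mulnA bin_fact ?ffact_fact//; lia.
  have i0 : (i`!%:R : R) != 0 by rewrite pnatr_eq0 -lt0n fact_gt0.
  rewrite -E !natrM; field.
  exact: i0.
rewrite big_ord_recr /= subnn big1 => [|i _].
  by rewrite add0r big_ord1 /= !mulr1 divff ?mulr1// pnatr_eq0 -lt0n fact_gt0.
by rewrite bincoef_convolution subn_eq0 leqNgt ltn_ord mulr0.
Qed.

(** The factors Gamma(B + m - k) in the weights are there to cancel the denominators of [riesz_rho];
    [sum_coef] does the rest. *)
Lemma riesz_rho_comb (x : 'rV[R]_n) m :
  (lebesgue_rV R n).-integrable setT
    (fun y => (normsq (x - y) `^ (- A) * rho_comb beta B m y)%:E) /\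
  (\int[lebesgue_rV R n]_y (normsq (x - y) `^ (- A) * rho_comb beta B m y)%:E =
   (pi `^ (n%:R / 2) / Gamma A * Gamma beta * Gamma (A + m%:R) *
     rho x `^ (- (A + m%:R)))%:E)%E.
Proof.
pose c (k : 'I_m.+1) := bincoef beta k * (m ^_ k)%:R * Gamma (B + (m - k)%:R).
have E : (fun y => (normsq (x - y) `^ (- A) * rho_comb beta B m y)%:E) =
  (fun y => \sum_(k < m.+1) ((c k)%:E *
     (normsq (x - y) `^ (- A) * rho y `^ (- (B + (m - k)%:R)))%:E)%E)%R.
  apply/funext => y; rewrite /rho_comb mulr_sumr -sumEFin; apply: eq_bigr => k _.
  by rewrite -EFinM /c; congr EFin; ring.
rewrite E; split.
  apply: integrable_sum => // k _; apply: integrableZl => //.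
  exact: integrable_riesz_rho.
rewrite integral_sum//; last first.
  by move=> k; apply: integrableZl => //; exact: integrable_riesz_rho.
under eq_bigr => k _.
  rewrite integralZl//; last exact: integrable_riesz_rho.
  rewrite riesz_rho// -EFinM.
  over.
rewrite sumEFin; congr EFin.
rewrite -[RHS]mulrA -[RHS]mulrA -(sum_coef (fun i => Gamma (A + i%:R) * rho x `^ (- (A + i%:R)))).
rewrite mulr_sumr; apply: eq_bigr => k _.
have GB : 0 < Gamma (B + (m - k)%:R) :> R.
  by rewrite Gamma_gt0// ltr_wpDr// addr_gt0// mulr_gt0.
rewrite /c; set S1 := \sum_(_ < _) _; set S2 := \sum_(_ < _) _.
have -> : S1 = S2 by apply: eq_bigr => i _; ring.
by field; rewrite !gt_eqF// Gamma_gt0.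
Qed.

End riesz_of_rho_comb.

(** * Dilates of (1 + |x|^2)^(-kappa) *)

Section rho_kernel.
Context {R : realType} {n : nat}.
Variable kappa : R.
Hypothesis kappa_gt : n%:R / 2 < kappa.
Local Notation mu := (lebesgue_rV R n).
Implicit Types (x y z : 'rV[R]_n) (t : R) (f g : 'rV[R]_n -> R).

Definition rho_kernel t z : R := t ^- n * rho (t^-1 *: z) `^ (- kappa).

(** The integral of the kernel at every scale. The kernel is left unnormalized, so its convolutions
    with f tend to [rho_mass] times f. *)
Definition rho_mass : R := pi `^ (n%:R / 2) * Gamma (kappa - n%:R / 2) / Gamma kappa.

Let kappa_gt0 : 0 < kappa.
Proof. by rewrite (le_lt_trans _ kappa_gt). Qed.

Lemma rho_mass_gt0 : 0 < rho_mass.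
Proof.
by rewrite divr_gt0 ?mulr_gt0 ?powR_gt0 ?pi_gt0// Gamma_gt0// subr_gt0.
Qed.

Lemma rho_kernel_ge0 t z : 0 < t -> 0 <= rho_kernel t z.
Proof. by move=> t0; rewrite mulr_ge0 ?powR_ge0// invr_ge0 exprn_ge0// ltW. Qed.

Lemma measurable_rho_kernel t : measurable_fun setT (rho_kernel t).
Proof. by rewrite /rho_kernel /rho; meas. Qed.

Lemma rho_powR_le1 (k : R) z : 0 <= k -> rho z `^ (- k) <= 1.
Proof.
move=> k0; rewrite powRN invf_le1 ?powR_gt0 ?rho_gt0//.
by rewrite -[leLHS](powRr0 (rho z)) ler_powR ?rho_ge1.
Qed.

Lemma rho_kernel_le t z : 0 < t -> rho_kernel t z <= t ^- n.
Proof.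
by move=> t0; rewrite ler_piMr ?invr_ge0 ?exprn_ge0 ?(ltW t0)// rho_powR_le1// ltW.
Qed.

Lemma ge0_integral_rV_reflect (F : 'rV[R]_n -> \bar R) x :
  measurable_fun setT F -> (forall z, 0 <= F z)%E ->
  (\int[mu]_y F (x - y)%R = \int[mu]_y F y)%E.
Proof.
move=> mF F0.
have N0 : (-1 : R) != 0 by rewrite oppr_eq0 oner_eq0.
have := ge0_integral_rV_affine x N0 mF F0.
rewrite normrN1 expr1n invr1 mul1e => <-.
by apply: eq_integral => y _; rewrite scaleN1r.
Qed.

Lemma integral_rho_kernel t : 0 < t ->
  (\int[mu]_y (rho_kernel t y)%:E = rho_mass%:E)%E.
Proof.
move=> t0.
have mF : measurable_fun [set: 'rV[R]_n] (fun z => (rho z `^ (- kappa))%:E).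
  by rewrite /rho; emeas.
have F0 z : (0 <= (rho z `^ (- kappa))%:E)%E by rewrite lee_fin powR_ge0.
have t1 : t^-1 != 0 by rewrite invr_eq0 gt_eqF.
rewrite /rho_mass -integral_rho_powR//.
have := ge0_integral_rV_affine 0 t1 mF F0.
rewrite normrV ?unitfE ?gt_eqF// gtr0_norm// -exprVn invrK.
move=> /(congr1 (fun u : \bar R => (t ^- n)%:E * u)%E).
rewrite muleA -EFinM mulVf ?expf_neq0 ?gt_eqF// mul1e => <-.
rewrite -ge0_integralZl => [|//| |y _|].
- by apply: eq_integral => y _; rewrite add0r.
- by apply: (measurableT_comp mF); exact: measurable_rV_affine.
- exact: F0.
- by rewrite lee_fin invr_ge0 exprn_ge0// ltW.
Qed.

Lemma integral_rho_kernel_sub t x : 0 < t ->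
  (\int[mu]_y (rho_kernel t (x - y))%:E = rho_mass%:E)%E.
Proof.
move=> t0; rewrite -(integral_rho_kernel t0).
apply: (ge0_integral_rV_reflect x (F := fun z => (rho_kernel t z)%:E)).
  by apply/measurable_EFinP; exact: measurable_rho_kernel.
by move=> z; rewrite lee_fin rho_kernel_ge0.
Qed.

(** The kernel equals t^(2 kappa - n) (t^2 + |z|^2)^-kappa, and |z|^2 is at least d / (1 + d) times
    1 + |z|^2 when |z|^2 is at least d. The power of t is positive, so the tail tends to 0 relative
    to the kernel at scale 1. *)
Lemma rho_kernel_far (d t : R) z : 0 < d -> 0 < t -> t <= 1 -> d <= normsq z ->
  rho_kernel t z <= t `^ (2 * kappa - n%:R) * (d / (1 + d)) `^ (- kappa) * rho z `^ (- kappa).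
Proof.
move=> d0 t0 t1 dz; rewrite /rho_kernel /rho normsqZ.
have z0 : 0 < normsq z by exact: lt_le_trans dz.
have d1 : 0 < d / (1 + d) by rewrite divr_gt0 ?addr_gt0.
have -> : t ^- n = t `^ (- n%:R) by rewrite powRN powR_mulrn// ltW.
have -> : 1 + t^-1 ^+ 2 * normsq z = t `^ (- 2) * (t ^+ 2 + normsq z).
  rewrite powRN -[2]/(2%:R) powR_mulrn ?ltW//; field.
  by rewrite gt_eqF.
rewrite powRM ?powR_ge0 ?addr_ge0 ?sqr_ge0 ?normsq_ge0//.
rewrite -powRrM mulrA -gt0_powRD//.
have -> : - n%:R + - 2 * - kappa = 2 * kappa - n%:R by ring.
rewrite -mulrA ler_wpM2l ?powR_ge0// -powRM ?(ltW d1) ?addr_ge0 ?normsq_ge0//.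
have h1 : 0 < d / (1 + d) * (1 + normsq z) by rewrite mulr_gt0// ltr_wpDr// ltW.
have h2 : 0 < t ^+ 2 + normsq z by rewrite ltr_wpDl// sqr_ge0.
rewrite !powRN lef_pV2 ?posrE; [|exact: powR_gt0|exact: powR_gt0].
apply: ge0_ler_powR; rewrite ?nnegrE ?(ltW kappa_gt0) ?(ltW h1) ?(ltW h2)//.
rewrite mulrAC ler_pdivrMr ?addr_gt0//.
have : 0 <= t ^+ 2 by exact: sqr_ge0.
have : 0 <= t ^+ 2 * d by rewrite mulr_ge0 ?sqr_ge0// ltW.
nra.
Qed.

(** Convergence at every point and scale keeps the convolution away from the default value of the
    real integral, so that it is linear on this class. *)
Definition admissible f := measurable_fun setT f /\
  forall t x, 0 < t -> mu.-integrable setT (fun y => (f y * rho_kernel t (x - y))%:E).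

Definition rho_conv f t x : R := \int[mu]_y (f y * rho_kernel t (x - y)).

Lemma measurable_fun_rho_kernel d (T : measurableType d) t (h : T -> 'rV[R]_n) :
  measurable_fun setT h -> measurable_fun setT (fun u => rho_kernel t (h u)).
Proof.
by move=> mh; apply: (measurableT_comp (measurable_rho_kernel t)).
Qed.

Lemma measurable_rho_kernel_sub t x :
  measurable_fun setT (fun y : 'rV[R]_n => rho_kernel t (x - y)).
Proof. by apply: measurable_fun_rho_kernel; meas. Qed.

Lemma admissible_bounded f (M : R) : measurable_fun setT f ->
  (forall y, `|f y| <= M) -> admissible f.
Proof.
move=> mf fM; split=> // t x t0; apply/integrableP; split.
  by apply/measurable_EFinP; apply: measurable_funM => //; exact: measurable_rho_kernel_sub.
apply: (@le_lt_trans _ _ (\int[mu]_y (M%:E * (rho_kernel t (x - y))%:E))%E).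
  apply: ge0_le_integral => //.
  - apply: measurableT_comp => //; apply/measurable_EFinP.
    by apply: measurable_funM => //; exact: measurable_rho_kernel_sub.
  - apply/measurable_EFinP; apply: measurable_funM => //; exact: measurable_rho_kernel_sub.
  - move=> y _; rewrite -EFinM abse_EFin lee_fin normrM.
    by rewrite [`|rho_kernel _ _|]ger0_norm ?rho_kernel_ge0// ler_wpM2r ?rho_kernel_ge0.
rewrite ge0_integralZl => [|//| |y _|].
- by rewrite integral_rho_kernel_sub// -EFinM ltry.
- by apply/measurable_EFinP; exact: measurable_rho_kernel_sub.
- by rewrite lee_fin rho_kernel_ge0.
- by rewrite lee_fin (le_trans _ (fM 0)).
Qed.

Lemma admissible_le f g : measurable_fun setT f -> (forall y, `|f y| <= `|g y|) ->
  admissible g -> admissible f.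
Proof.
move=> mf fg [mg ig]; split=> // t x t0.
apply: (le_integrable measurableT _ _ (ig t x t0)) => [|y _].
  by apply/measurable_EFinP; apply: measurable_funM => //; exact: measurable_rho_kernel_sub.
by rewrite !abse_EFin lee_fin !normrM ler_wpM2r.
Qed.

Lemma powR_ge_id (u p : R) : 1 <= p -> 0 <= u -> u <= 1 + u `^ p.
Proof.
move=> p1 u0; have [u1|u1] := leP u 1; first by rewrite ler_wpDr ?powR_ge0.
by rewrite ler_wpDl// -{1}(powRr1 u0) ler_powR// ltW.
Qed.

(** Since |f| <= 1 + |f|^p, it is enough that the kernel is both integrable and bounded; no
    conjugate exponent is involved. *)
Lemma admissible_Lp f (p : R) : 1 <= p -> measurable_fun setT f ->
  (\int[mu]_y (`|f y| `^ p)%:E < +oo)%E -> admissible f.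
Proof.
move=> p1 mf fp; split=> // t x t0; apply/integrableP; split.
  by apply/measurable_EFinP; apply: measurable_funM => //; exact: measurable_rho_kernel_sub.
have mfp : measurable_fun setT (fun y => (`|f y| `^ p)%:E).
  by apply/measurable_EFinP; apply: measurable_fun_powR; exact: measurableT_comp.
have mk : measurable_fun setT (fun y => (rho_kernel t (x - y))%:E).
  by apply/measurable_EFinP; exact: measurable_rho_kernel_sub.
have tn : 0 <= t ^- n by rewrite invr_ge0 exprn_ge0// ltW.
apply: (@le_lt_trans _ _ (\int[mu]_y ((rho_kernel t (x - y))%:E +
   (t ^- n)%:E * (`|f y| `^ p)%:E))%E).
  apply: ge0_le_integral => //.
  - apply: measurableT_comp => //; apply/measurable_EFinP.
    by apply: measurable_funM => //; exact: measurable_rho_kernel_sub.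
  - by apply: emeasurable_funD => //; exact: emeasurable_funM.
  - move=> y _; rewrite -EFinM -EFinD abse_EFin lee_fin normrM.
    rewrite [`|rho_kernel _ _|]ger0_norm ?rho_kernel_ge0//.
    have k0 := rho_kernel_ge0 (x - y) t0; have k1 := rho_kernel_le (x - y) t0.
    apply: le_trans (ler_wpM2r k0 (powR_ge_id p1 (normr_ge0 (f y)))) _.
    by rewrite mulrDl mul1r lerD2l mulrC ler_wpM2r ?powR_ge0.
rewrite ge0_integralD//; last 3 first.
- by move=> y _; rewrite lee_fin rho_kernel_ge0.
- by move=> y _; rewrite mule_ge0// lee_fin powR_ge0.
- exact: emeasurable_funM.
rewrite integral_rho_kernel_sub// lte_add_pinfty ?ltry//.
rewrite ge0_integralZl => [|//| //|y _|].
- by rewrite lte_mul_pinfty// lee_fin.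
- by rewrite lee_fin powR_ge0.
- by rewrite lee_fin.
Qed.

Lemma admissibleB f g : admissible f -> admissible g -> admissible (f \- g).
Proof.
move=> [mf fi] [mg gi]; split; first exact: measurable_funB.
move=> t x t0; under eq_fun do rewrite /= mulrBl EFinB.
by apply: integrableB => //; [exact: fi|exact: gi].
Qed.

Lemma rho_convB f g t x : 0 < t -> admissible f -> admissible g ->
  rho_conv (f \- g) t x = rho_conv f t x - rho_conv g t x.
Proof.
move=> t0 [_ fi] [_ gi]; rewrite /rho_conv -RintegralB//; [|exact: fi|exact: gi].
by apply: eq_Rintegral => y _; rewrite /= mulrBl.
Qed.

Lemma admissibleZ f (a : R) : admissible f -> admissible (fun y => a * f y).
Proof.
move=> [mf fi]; split; first exact: measurable_funM.
move=> t x t0; under eq_fun do rewrite -mulrA EFinM.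
by apply: integrableZl => //; exact: fi.
Qed.

Lemma rho_convZ f (a : R) t x : 0 < t -> admissible f ->
  rho_conv (fun y => a * f y) t x = a * rho_conv f t x.
Proof.
move=> t0 [_ fi]; rewrite /rho_conv -RintegralZl//; last exact: fi.
by apply: eq_Rintegral => y _; rewrite mulrA.
Qed.

Lemma rho_conv_cst (a : R) t x : 0 < t -> rho_conv (cst a) t x = a * rho_mass.
Proof.
move=> t0; rewrite /rho_conv /Rintegral.
under eq_integral do rewrite EFinM.
rewrite integralZl//=; first by rewrite integral_rho_kernel_sub.
apply/integrableP; split.
  by apply/measurable_EFinP; exact: measurable_rho_kernel_sub.
under eq_integral do rewrite gee0_abs ?lee_fin ?rho_kernel_ge0//.
by rewrite integral_rho_kernel_sub// ltry.
Qed.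

Lemma rho_conv_far f (d t : R) x : admissible f -> 0 < d -> 0 < t -> t <= 1 ->
  (forall y, normsq (x - y) < d -> f y = 0) ->
  (\int[mu]_y (`|f y| * rho_kernel t (x - y))%:E <=
   (t `^ (2 * kappa - n%:R) * (d / (1 + d)) `^ (- kappa))%:E *
   \int[mu]_y (`|f y| * rho_kernel 1 (x - y))%:E)%E.
Proof.
move=> [mf fi] d0 t0 t1 f0.
have mfk s : measurable_fun setT (fun y => (`|f y| * rho_kernel s (x - y))%:E).
  apply/measurable_EFinP; apply: measurable_funM; first exact: measurableT_comp.
  exact: measurable_rho_kernel_sub.
rewrite -ge0_integralZl => [|//| //|y _|].
- apply: ge0_le_integral => //.
  + by move=> y _; rewrite lee_fin mulr_ge0// rho_kernel_ge0.
  + by apply: emeasurable_funM.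
  move=> y _; rewrite -EFinM lee_fin.
  have [xd|xd] := ltP (normsq (x - y)) d; first by rewrite f0// normr0 !mul0r mulr0.
  rewrite [leRHS]mulrCA; apply: ler_wpM2l => //; apply: le_trans (rho_kernel_far d0 t0 t1 xd) _.
  by rewrite /rho_kernel expr1n invr1 scale1r mul1r.
- by rewrite lee_fin mulr_ge0// rho_kernel_ge0.
- by rewrite lee_fin mulr_ge0 ?powR_ge0.
Qed.

Lemma le_rho_conv f t x : 0 < t -> admissible f ->
  ((`|rho_conv f t x|)%:E <= \int[mu]_y (`|f y| * rho_kernel t (x - y))%:E)%E.
Proof.
move=> t0 [mf fi]; rewrite /rho_conv EFin_normr_Rintegral//; last exact: fi.
apply: le_trans (le_abse_integral _ _ _) _ => //.
  by have /integrableP[] := fi t x t0.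
apply: eqW; apply: eq_integral => y _.
by rewrite abse_EFin normrM [`|rho_kernel _ _|]ger0_norm// rho_kernel_ge0.
Qed.

End rho_kernel.

(** * The maximal inequality *)

Section boxes.
Context {R : realType} {n : nat}.
Local Notation mu := (lebesgue_rV R n).
Implicit Types (x y : 'rV[R]_n) (q : R).

(** Balls of the sup norm take the place of Euclidean balls, as the product measure gives their
    volume exactly. *)
Definition box x q : set 'rV[R]_n := [set y | forall i, `|y ord0 i - x ord0 i| < q].

Lemma measurable_rV_rect (A : 'I_n -> set (measurableTypeR R)) :
  (forall i, measurable (A i)) ->
  measurable [set x : 'rV[R]_n | forall i, A i (x ord0 i)].
Proof.
move=> mA.
rewrite (_ : [set x : 'rV[R]_n | forall i, A i (x ord0 i)] =
  \big[setI/setT]_(i < n)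
    ((fun y : 'rV[R]_n => y ord0 i : measurableTypeR R) @^-1` A i)).
  apply: bigsetI_measurable => i _; rewrite -[X in measurable X]setTI.
  by apply: measurable_rV_coord.
rewrite -bigcap_seq; apply/seteqP; split => [y yA i _|y /= yA i]; first exact: yA.
by apply: yA; rewrite /= mem_index_enum.
Qed.

Let side x q (i : 'I_n) : set (measurableTypeR R) :=
  `](x ord0 i - q), (x ord0 i + q)[%classic.

Let boxE x q : box x q = [set y | forall i, side x q i (y ord0 i)].
Proof.
apply/seteqP; split => y /= xy i; have := xy i; rewrite /side/= in_itv/= ltr_distl => /andP[h1 h2];
  by apply/andP; split; lra.
Qed.

Lemma measurable_box x q : measurable (box x q).
Proof.
by rewrite boxE; apply: (measurable_rV_rect (A := side x q)) => i; exact: measurable_itv.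
Qed.

Lemma lebesgue_rV_box x q : 0 < q -> mu (box x q) = ((2 * q) ^+ n)%:E.
Proof.
move=> q0; rewrite boxE (lebesgue_rV_rect (A := side x q)); last by move=> i; exact: measurable_itv.
rewrite (eq_bigr (fun=> (2 * q)%:E)); last first.
  move=> i _; rewrite /side lebesgue_measure_itv/= lte_fin ifT; last lra.
  by rewrite -EFinD; congr EFin; ring.
by rewrite prodEFin prodr_const card_ord.
Qed.

Lemma box_meet x x' q q' : q <= q' -> box x q `&` box x' q' !=set0 ->
  box x q `<=` box x' (3 * q').
Proof.
move=> qq [z [zx zx']] y yx i.
have := zx i; have := zx' i; have := yx i; rewrite !ltr_distl.
by move=> /andP[? ?] /andP[? ?] /andP[? ?]; apply/andP; split; lra.
Qed.

Section vitali.
Variables (h : 'rV[R]_n -> \bar R) (lam : R).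
Hypotheses (mh : measurable_fun setT h) (h0 : forall y, (0 <= h y)%E) (lam0 : 0 < lam).

(** A cube, given by centre and half side, on which the mean of h is at least lam. *)
Definition heavy_box (z : 'rV[R]_n * R) :=
  0 < z.2 /\ ((lam * (2 * z.2) ^+ n)%:E <= \int[mu]_(y in box z.1 z.2) h y)%E.

Let mhD (D : set 'rV[R]_n) : measurable_fun D h.
Proof. exact: measurable_funTS. Qed.

(* Greedy selection: [V] is a disjoint union of selected boxes, and [W] the
   union of their dilates by 3. *)
Let vitali_sorted (s : seq ('rV[R]_n * R)) :
  sorted (fun z w : 'rV[R]_n * R => z.2 <= w.2) s -> (forall z, z \in s -> heavy_box z) ->
  exists V W : set 'rV[R]_n, [/\ measurable V, measurable W,
    forall z, z \in s -> box z.1 z.2 `<=` W,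
    (mu W <= (3 ^+ n / lam)%:E * \int[mu]_(y in V) h y)%E &
    forall z, (forall w, w \in s -> z.2 <= w.2) -> box z.1 z.2 `&` V !=set0 ->
      box z.1 z.2 `<=` W].
Proof.
elim: s => [_ _|z s IHs zs hs].
  exists set0, set0; split => //; first by rewrite measure0 integral_set0 mule0.
  by move=> z _ [y []].
have tr : transitive (fun z w : 'rV[R]_n * R => z.2 <= w.2).
  by move=> a b c; exact: le_trans.
have zmin w : w \in s -> z.2 <= w.2 by move/(allP (order_path_min tr zs)).
have [|w ws|V [W [mV mW sW muW VW]]] := IHs; first exact: path_sorted zs.
  by apply: hs; rewrite inE ws orbT.
(* The head of the list is the smallest box and the tail is already processed. If it meets a
   selected box, the dilate of that box contains it; otherwise it is selected itself. *)
have [zV|zV] := pselect (box z.1 z.2 `&` V !=set0).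
  exists V, W; split => // [w|w wz].
    by rewrite inE => /predU1P[->|/sW//]; exact: VW.
  by apply: VW => u us; apply: wz; rewrite inE us orbT.
have [z0 zh] : heavy_box z by apply: hs; rewrite mem_head.
exists (V `|` box z.1 z.2), (W `|` box z.1 (3 * z.2)); split.
- by apply: measurableU => //; exact: measurable_box.
- by apply: measurableU => //; exact: measurable_box.
- move=> w; rewrite inE => /predU1P[->|/sW wW]; last by move=> y /wW; left.
  by move=> y yz; right => i; apply: lt_le_trans (yz i) _; lra.
- apply: le_trans (measureU2 _ _ _) _ => //; first exact: measurable_box.
  rewrite ge0_integral_setU//; [|exact: measurable_box|].
  + rewrite ge0_muleDr ?integral_ge0//; apply: leeD => //.
    rewrite [X in (X <= _)%E](_ : _ = ((2 * (3 * z.2)) ^+ n)%:E); last first.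
      by apply: lebesgue_rV_box; rewrite mulr_gt0.
    apply: le_trans (_ : ((3 ^+ n / lam)%:E * (lam * (2 * z.2) ^+ n)%:E <= _)%E).
      by rewrite -EFinM lee_fin [2 * (3 * _)]mulrCA exprMn -[leRHS]mulrA mulKf ?gt_eqF.
    by apply: lee_wpmul2l => //; rewrite lee_fin divr_ge0 ?exprn_ge0// ltW.
  + by rewrite disj_set_sym; apply/disj_setPS => y yV; apply: zV; exists y.
- move=> w wz [y [yw [yV|yz]]].
    have wW : box w.1 w.2 `<=` W.
      by apply: VW => [u us|]; [apply: wz; rewrite inE us orbT|exists y].
    by move=> u /wW; left.
  have wb : box w.1 w.2 `<=` box z.1 (3 * z.2).
    by apply: box_meet; [apply: wz; rewrite mem_head|exists y].
  by move=> u /wb; right.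
Qed.

Let vitali_finite (s : seq ('rV[R]_n * R)) :
  (forall z, z \in s -> heavy_box z) ->
  (mu (\big[setU/set0]_(z <- s) box z.1 z.2) <= (3 ^+ n / lam)%:E * \int[mu]_y h y)%E.
Proof.
pose le2 (z w : 'rV[R]_n * R) := z.2 <= w.2.
move=> hs; have [| |V [W [mV mW sW muW _]]] := @vitali_sorted (sort le2 s).
- by apply: sort_sorted => a b; exact: le_total.
- by move=> z; rewrite mem_sort; exact: hs.
apply: le_trans (_ : (mu W <= _)%E).
  apply: le_measure; rewrite ?inE//.
    by apply: bigsetU_measurable => z _; exact: measurable_box.
  rewrite -bigcup_seq => y [z /= zs]; apply: sW.
  by rewrite mem_sort.
apply: le_trans muW _; apply: lee_wpmul2l.
  by rewrite lee_fin divr_ge0 ?exprn_ge0// ltW.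
exact: ge0_subset_integral.
Qed.

(** A superlevel set of a maximal function, built from cubes with rational centre and half side:
    [unpickle] enumerates them, so the union is countable and measurable. *)
Definition heavy_set : set 'rV[R]_n :=
  \bigcup_k (if unpickle k is Some (c, q) then
    (if `[< heavy_box (map_mx ratr c, ratr q) >] then box (map_mx ratr c) (ratr q) else set0)
    else set0 : set 'rV[R]_n).

Let hbox (k : nat) : set 'rV[R]_n := (if unpickle k is Some (c, q) then
    (if `[< heavy_box (map_mx ratr c, ratr q) >] then box (map_mx ratr c) (ratr q) else set0)
    else set0 : set 'rV[R]_n).

Let measurable_hbox k : measurable (hbox k).
Proof.
rewrite /hbox; case: unpickle => // -[c q]; case: ifP => // _; exact: measurable_box.
Qed.

Lemma measurable_heavy_set : measurable heavy_set.
Proof. by apply: bigcup_measurable => k _; exact: measurable_hbox. Qed.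

(** The weak type (1, 1) inequality. The greedy selection bounds every finite union independently of
    its length, and continuity from below passes to the countable one. *)
Lemma lebesgue_heavy_set :
  (mu heavy_set <= (3 ^+ n / lam)%:E * \int[mu]_y h y)%E.
Proof.
have -> : heavy_set = \bigcup_N \big[setU/set0]_(k < N.+1) hbox k.
  by rewrite bigcup_bigsetU_bigcup.
have cv := @nondecreasing_cvg_mu _ _ R mu (fun N => \big[setU/set0]_(k < N.+1) hbox k).
rewrite -(cvg_lim _ (cv _ _ _))//; last 3 first.
- by move=> N; apply: bigsetU_measurable => k _; exact: measurable_hbox.
- by apply: bigcup_measurable => N _; apply: bigsetU_measurable => k _; exact: measurable_hbox.
- by move=> i j ij; exact/subsetPset/subset_bigsetU.
apply: lime_le.
  apply/cvg_ex; eexists; apply: cv.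
  - by move=> N; apply: bigsetU_measurable => k _; exact: measurable_hbox.
  - by apply: bigcup_measurable => N _; apply: bigsetU_measurable => k _; exact: measurable_hbox.
  - by move=> i j ij; exact/subsetPset/subset_bigsetU.
apply: nearW => N /=; move: (N.+1) => {}N.
have [s sh <-] : exists2 s : seq ('rV[R]_n * R), (forall z, z \in s -> heavy_box z) &
    \big[setU/set0]_(z <- s) box z.1 z.2 = \big[setU/set0]_(k < N) hbox k.
  elim: N => [|N [s sh sE]]; first by exists [::]; rewrite ?big_nil ?big_ord0.
  rewrite big_ord_recr/= -sE /hbox.
  case: unpickle => [[c q]|]; last by exists s; rewrite ?setU0.
  case: ifPn => [/asboolP hc|_]; last by exists s; rewrite ?setU0.
  exists ((map_mx ratr c, ratr q) :: s); last by rewrite big_cons/= setUC.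
  by move=> z; rewrite inE => /predU1P[->|/sh].
exact: vitali_finite.
Qed.

Lemma notin_heavy_set x r : ~ heavy_set x -> 0 < r ->
  (\int[mu]_(y in box x r) h y <= (lam * (4 * r) ^+ n)%:E)%E.
Proof.
move=> xU r0.
(* With a rational centre within r / 2 of x, a half side above 3 r / 2 contains the given cube;
   staying below 2 r gives the side 4 r of the bound. *)
have [q] : exists q : rat, (ratr q : R) \in `](3 / 2 * r), (2 * r)[.
  by apply: rat_in_itvoo; lra.
rewrite in_itv/= => /andP[q1 q2].
have /choice [c cx] i : exists c : rat, `|ratr c - x ord0 i| < r / 2.
  have [c] : exists c : rat, (ratr c : R) \in `](x ord0 i - r / 2), (x ord0 i + r / 2)[.
    by apply: rat_in_itvoo; lra.
  by rewrite in_itv/= => cx; exists c; rewrite ltr_distl.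
pose C : 'rV[R]_n := map_mx ratr (\row_i c i).
have CE i : C ord0 i = ratr (c i) by rewrite !mxE.
have sub : box x r `<=` box C (ratr q).
  move=> y yx i; rewrite CE; have := yx i; have := cx i; rewrite !ltr_distl.
  by move=> /andP[? ?] /andP[? ?]; apply/andP; split; lra.
have xC : box C (ratr q) x.
  by move=> i; rewrite CE; have := cx i; rewrite !ltr_distl => /andP[? ?]; apply/andP; split; lra.
have q0 : 0 < ratr q :> R by lra.
apply: (@le_trans _ _ (\int[mu]_(y in box C (ratr q)) h y)%E).
  by apply: ge0_subset_integral => //; exact: measurable_box.
rewrite leNgt; apply/negP => big; apply: xU.
exists (pickle (\row_i c i, q)) => //; rewrite pickleK.
rewrite ifT//; apply/asboolP; split => //=.
apply: le_trans (ltW big); rewrite lee_fin ler_pM2l//.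
by apply: lerXn2r; rewrite ?nnegrE; lra.
Qed.

End vitali.

End boxes.

(** * Domination of the kernel by dyadic cubes *)

Section lebesgue_points.
Context {R : realType} {n : nat}.
Variable kappa : R.
Hypothesis kappa_gt : n%:R / 2 < kappa.
Local Notation mu := (lebesgue_rV R n).
Local Notation rho_kernel := (@rho_kernel R n kappa).
Local Notation rho_conv := (@rho_conv R n kappa).
Local Notation rho_mass := (@rho_mass R n kappa).
Local Notation admissible := (@admissible R n kappa).
Implicit Types (x y : 'rV[R]_n) (t : R) (f g : 'rV[R]_n -> R).

Let kappa_gt0 : 0 < kappa.
Proof. by rewrite (le_lt_trans _ kappa_gt). Qed.

Lemma rho_conv_near0 f (d : R) x : admissible f -> 0 < d ->
  (forall y, normsq (x - y) < d -> f y = 0) ->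
  rho_conv f t x @[t --> 0^'+] --> 0.
Proof.
move=> af d0 f0; have [mf fi] := af.
pose M := fine (\int[mu]_y (`|f y| * rho_kernel 1 (x - y))%:E).
have ME : (\int[mu]_y (`|f y| * rho_kernel 1 (x - y))%:E = M%:E)%E.
  rewrite /M fineK// ge0_fin_numE; last first.
    by apply: integral_ge0 => y _; rewrite lee_fin mulr_ge0// rho_kernel_ge0.
  have /integrableP[_] := fi 1 x ltr01.
  under eq_integral do rewrite abse_EFin normrM [`|rho_kernel _ _|]ger0_norm ?rho_kernel_ge0//.
  by [].
have M0 : 0 <= M.
  by rewrite -lee_fin -ME; apply: integral_ge0 => y _; rewrite lee_fin mulr_ge0// rho_kernel_ge0.
have k2 : 0 < 2 * kappa - n%:R by move: kappa_gt; lra.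
apply/cvgr0Pnorm_le => e e0.
have : t `^ (2 * kappa - n%:R) * ((d / (1 + d)) `^ (- kappa) * M) @[t --> 0^'+] -->
    0 * ((d / (1 + d)) `^ (- kappa) * M).
  by apply: cvgM; [exact: powR_cvg0|exact: cvg_cst].
rewrite [X in _ --> X]mul0r.
move=> /cvgr0Pnorm_le /(_ _ e0) H; near=> t.
have t0 : 0 < t by near: t; exact: nbhs_right_gt.
have t1 : t <= 1 by near: t; exact: nbhs_right_le.
apply: (@le_trans _ _ `|t `^ (2 * kappa - n%:R) * ((d / (1 + d)) `^ (- kappa) * M)|); last by near: t.
rewrite [leRHS]ger0_norm ?mulr_ge0 ?powR_ge0// -lee_fin.
apply: le_trans (le_rho_conv _ t0 af) _.
apply: le_trans (rho_conv_far kappa_gt af d0 t0 t1 f0) _.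
by rewrite ME -EFinM mulrA.
Unshelve. all: by end_near. Qed.

Lemma rho_conv_locally_cst f (d c : R) x : admissible f -> 0 < d ->
  (forall y, normsq (x - y) < d -> f y = c) ->
  rho_conv f t x @[t --> 0^'+] --> rho_mass * c.
Proof.
move=> af d0 fc.
have ac : admissible (cst c) by apply: (@admissible_bounded _ _ _ kappa_gt _ `|c|).
have af' : admissible (f \- cst c) by exact: admissibleB.
have H : rho_conv (f \- cst c) t x @[t --> 0^'+] --> 0.
  by apply: (rho_conv_near0 af' d0) => y yx; rewrite /= fc// subrr.
have : rho_conv (f \- cst c) t x + rho_mass * c @[t --> 0^'+] --> 0 + rho_mass * c.
  by apply: cvgD; [exact: H|exact: cvg_cst].
rewrite add0r; apply: cvg_trans.
apply: near_eq_cvg; near=> t.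
have t0 : 0 < t by near: t; exact: nbhs_right_gt.
by rewrite /= rho_convB// rho_conv_cst// mulrC subrK.
Unshelve. all: by end_near. Qed.

(** From one dyadic cube to the next the bound on the kernel drops by 2^(- 2 kappa) and the volume
    grows by 2^n; kappa > n / 2 makes the product less than 1. *)
Let ratio : R := 2 `^ (- (2 * kappa)) * 2 ^+ n.

Let ratio_ge0 : 0 <= ratio.
Proof. by rewrite mulr_ge0 ?powR_ge0 ?exprn_ge0. Qed.

Let ratio_lt1 : ratio < 1.
Proof.
rewrite /ratio -powR_mulrn// -gt0_powRD//.
have s0 : 0 < 2 * kappa - n%:R by move: kappa_gt; lra.
have -> : - (2 * kappa) + n%:R = - (2 * kappa - n%:R) by ring.
rewrite powRN invf_lt1 ?powR_gt0//; apply: (@le_lt_trans _ _ (1 `^ (2 * kappa - n%:R))).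
  by rewrite powR1.
by apply: gt0_ltr_powR; rewrite ?nnegrE// ltr1n.
Qed.

Let series_ratio (c : R) : 0 <= c ->
  (\sum_(0 <= k <oo) (c * ratio ^+ k)%:E = (c / (1 - ratio))%:E)%E.
Proof.
move=> c0; have r1 : `|ratio| < 1 by rewrite ger0_norm.
rewrite -(cvg_lim _ (@cvg_geometric_series _ c _ r1))// -EFin_lim; last exact: is_cvg_geometric_series.
by congr (limn _); apply/funext => N; rewrite /= /series/= -sumEFin.
Qed.

Definition heavy_const : R := 4 ^+ n * 2 `^ (2 * kappa) / (1 - ratio).

Lemma heavy_const_gt0 : 0 < heavy_const.
Proof. by rewrite divr_gt0 ?mulr_gt0 ?exprn_gt0 ?powR_gt0 ?subr_gt0. Qed.

(** The index k is that of the first dyadic cube containing y. For k > 0 the point lies outside the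
    cube of index k - 1, so |x - y| is at least 2^(k - 1) t; the factor 2^(2 kappa) absorbs this
    shift and also covers k = 0. *)
Let kernel_le_boxes t x y : 0 < t -> exists2 k : nat, box x (2 ^+ k * t) y &
  rho_kernel t (x - y) <= t ^- n * (2 `^ (2 * kappa) * (2 `^ (- (2 * kappa))) ^+ k).
Proof.
move=> t0.
have /ex_minnP[k] : exists k, `[< box x (2 ^+ k * t) y >].
  pose M := \sum_i `|y ord0 i - x ord0 i|.
  exists (Num.truncn (M / t)).+1; apply/asboolP => i.
  have M1 : `|y ord0 i - x ord0 i| <= M.
    by rewrite /M (bigD1 i)//= lerDl sumr_ge0.
  apply: (le_lt_trans M1); rewrite -ltr_pdivrMr//.
  apply: (lt_trans (truncnS_gt _)); rewrite -natrX ltr_nat.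
  exact: ltn_expl.
move=> /asboolP xy kmin; exists k => //.
have tn : 0 < t ^- n by rewrite invr_gt0 exprn_gt0.
rewrite /rho_kernel ler_pM2l//.
case: k xy kmin => [_ _|k xy kmin].
  rewrite expr0 mulr1; apply: (@le_trans _ _ 1).
    by apply: rho_powR_le1; rewrite ltW.
  by rewrite -[leLHS](powRr0 2) ler_powR ?ler1n// mulr_ge0// ltW.
have : ~ box x (2 ^+ k * t) y.
  by move=> /asboolP /kmin; rewrite ltnn.
move=> /existsNP[i /negP]; rewrite -leNgt => ki.
have rk : (2 ^+ k) ^+ 2 <= rho (t^-1 *: (x - y)) :> R.
  rewrite /rho normsqZ /normsq (bigD1 i)//= !mxE.
  have s0 : 0 <= \sum_(j < n | j != i) (x - y) ord0 j ^+ 2 by apply: sumr_ge0 => j _; exact: sqr_ge0.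
  apply: (@le_trans _ _ (t^-1 ^+ 2 * (x ord0 i - y ord0 i) ^+ 2)).
    rewrite -exprMn -[leRHS]real_normK ?num_real// lerXn2r ?nnegrE ?exprn_ge0//.
    by rewrite normrM normrV ?unitfE ?gt_eqF// gtr0_norm// mulrC ler_pdivlMr// distrC.
  rewrite mulrDr; have := sqr_ge0 t^-1; nra.
rewrite -powR_mulrn ?powR_ge0// -powRrM -gt0_powRD//.
apply: (@le_trans _ _ (((2 ^+ k) ^+ 2) `^ (- kappa))).
  rewrite !powRN lef_pV2 ?posrE ?powR_gt0 ?rho_gt0 ?exprn_gt0//.
  by apply: ge0_ler_powR; rewrite ?nnegrE ?(ltW kappa_gt0) ?(ltW (rho_gt0 _)) ?exprn_ge0.
rewrite -exprM -powR_mulrn// -powRrM natrM ler_powR ?ler1n//.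
by apply: eqW; rewrite -[k.+1%:R]natr1; ring.
Qed.

(** The kernel is at most a weighted sum of indicators of the cubes of half side 2^k t. Off the
    heavy set the integral of h over each is at most lam (4 2^k t)^n, and the resulting geometric
    series sums to lam times [heavy_const]. *)
Lemma maximal_rho_conv (h : 'rV[R]_n -> \bar R) (lam : R) x t :
  measurable_fun setT h -> (forall y, (0 <= h y)%E) -> 0 < lam ->
  ~ heavy_set h lam x -> 0 < t ->
  (\int[mu]_y (h y * (rho_kernel t (x - y))%:E) <= (lam * heavy_const)%:E)%E.
Proof.
move=> mh h0 lam0 xU t0.
have tn : 0 < t ^- n by rewrite invr_gt0 exprn_gt0.
pose a k : R := t ^- n * (2 `^ (2 * kappa) * (2 `^ (- (2 * kappa))) ^+ k).
have a0 k : 0 <= a k by rewrite !mulr_ge0 ?exprn_ge0 ?powR_ge0// ltW.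
have t2 k : 0 < 2 ^+ k * t by rewrite mulr_gt0// exprn_gt0.
pose u k y : \bar R := ((a k)%:E * (h y * (\1_(box x (2 ^+ k * t)) y)%:E))%E.
have u0 k y : (0 <= u k y)%E.
  by rewrite /u mule_ge0 ?lee_fin// mule_ge0 ?lee_fin.
have mhi k : measurable_fun setT (fun y => h y * (\1_(box x (2 ^+ k * t)) y)%:E)%E.
  by apply: emeasurable_funM => //; apply/measurable_EFinP; apply: measurable_indic; exact: measurable_box.
have mu_ k : measurable_fun setT (u k) by apply: emeasurable_funM.
apply: (@le_trans _ _ (\int[mu]_y \sum_(0 <= k <oo) u k y)%E).
  apply: ge0_le_integral => //.
  - by move=> y _; rewrite mule_ge0// lee_fin rho_kernel_ge0.
  - apply: emeasurable_funM => //; apply/measurable_EFinP.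
    exact: measurable_rho_kernel_sub.
  - by apply: ge0_emeasurable_sum => k.
  move=> y _; have [k xy ke] := kernel_le_boxes x y t0.
  apply: le_trans (_ : (u k y <= _)%E).
    rewrite /u indicE mem_set// mule1 muleC; apply: lee_wpmul2r => //.
  apply: le_trans (nneseries_lim_ge k.+1 _) => //.
  by rewrite big_nat_recr//= leeDr// sume_ge0.
rewrite integral_nneseries//.
apply: (@le_trans _ _ (\sum_(0 <= k <oo) ((lam * 4 ^+ n * 2 `^ (2 * kappa)) * ratio ^+ k)%:E)%E); last first.
  by rewrite series_ratio ?mulr_ge0 ?exprn_ge0 ?powR_ge0 ?(ltW lam0)// /heavy_const !mulrA.
apply: lee_nneseries => [k _|k _]; first by move=> _; exact: integral_ge0.
rewrite ge0_integralZl => [|//|//|y _|]; last 2 first.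
- by rewrite mule_ge0 ?lee_fin.
- by rewrite lee_fin.
have -> : (\int[mu]_y (h y * (\1_(box x (2 ^+ k * t)) y)%:E) =
    \int[mu]_(y in box x (2 ^+ k * t)) h y)%E.
  rewrite [RHS]integral_mkcond; apply: eq_integral => y _.
  by rewrite patchE indicE; case: (y \in _); rewrite ?mule1 ?mule0.
apply: (@le_trans _ _ ((a k)%:E * (lam * (4 * (2 ^+ k * t)) ^+ n)%:E)%E).
  by apply: lee_wpmul2l; rewrite ?lee_fin//; exact: notin_heavy_set.
rewrite -EFinM lee_fin; apply: eqW; rewrite /a /ratio !exprMn -!exprM [(n * k)%N]mulnC.
by field; rewrite expf_neq0// gt_eqF.
Qed.

End lebesgue_points.

(** * Convergence almost everywhere *)

Section ae_convergence.
Context {R : realType} {n : nat}.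
Variable kappa : R.
Hypothesis kappa_gt : n%:R / 2 < kappa.
Local Notation mu := (lebesgue_rV R n).
Local Notation rho_kernel := (@rho_kernel R n kappa).
Local Notation rho_conv := (@rho_conv R n kappa).
Local Notation rho_mass := (@rho_mass R n kappa).
Local Notation admissible := (@admissible R n kappa).
Implicit Types (f g : 'rV[R]_n -> R).

Definition ae_approximated f :=
  {ae mu, forall x, rho_conv f t x @[t --> 0^'+] --> rho_mass * f x}.

(** Take g_k at L^1 distance lam / (k + 1) from f. The exceptional set for g_k consists of the heavy
    set of |f - g_k|, the set where |f - g_k| >= lam (Chebyshev) and a null set; its measure is at
    most (3^n + 1) / (k + 1), so the intersection over k is null. *)
Let ae_near f (lam : R) : admissible f -> 0 < lam ->
  (forall e : R, 0 < e -> exists g, [/\ admissible g, ae_approximated g &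
    (\int[mu]_y (`|f y - g y|)%:E <= e%:E)%E]) ->
  {ae mu, forall x, \forall t \near 0^'+,
     `|rho_conv f t x - rho_mass * f x| <= lam * (@heavy_const R n kappa + 1 + rho_mass)}.
Proof.
move=> af lam0 fg.
have k0 k : 0 < lam / k.+1%:R by rewrite divr_gt0.
have /choice[g gP] k := fg _ (k0 k).
have mass0 : 0 < rho_mass by exact: rho_mass_gt0.
have mf := af.1.
have mg k : measurable_fun setT (g k) by have [[]] := gP k.
have mh k : measurable_fun setT (fun y => (`|f y - g k y|)%:E).
  by apply/measurable_EFinP; apply: measurableT_comp => //; exact: measurable_funB.
have h0 k y : (0 <= (`|f y - g k y|)%:E)%E by rewrite lee_fin.
have /choice[N NP] k : exists N, [/\ measurable N, mu N = 0%E &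
    forall x, ~ N x -> rho_conv (g k) t x @[t --> 0^'+] --> rho_mass * g k x].
  have [_ [N [mN N0 sN]] _] := gP k; exists N; split => // x Nx.
  by apply: contrapT => H; apply: Nx; exact: sN.
pose U k := heavy_set (fun y => (`|f y - g k y|)%:E) lam.
pose V k := [set: 'rV[R]_n] `&` [set y | (lam%:E <= `|(`|f y - g k y|)%:E|)%E].
have mU k : measurable (U k) by exact: measurable_heavy_set.
have mV k : measurable (V k).
  by apply: emeasurable_fun_c_infty => //; exact: measurableT_comp.
have mN k : measurable (N k) by have [] := NP k.
have mT k : measurable (U k `|` (V k `|` N k)) by apply: measurableU => //; exact: measurableU.
exists (\bigcap_k (U k `|` (V k `|` N k))); split.
- exact: bigcap_measurableType.
- apply/eqP; rewrite -measure_le0; apply/lee_addgt0Pr => e e0; rewrite add0e.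
  pose k := Num.truncn ((3 ^+ n + 1) / e).
  apply: (@le_trans _ _ (mu (U k `|` (V k `|` N k)))).
    apply: le_measure; rewrite ?inE//; first exact: bigcap_measurableType.
    by move=> x; exact.
  apply: le_trans (measureU2 _ _ _) _ => //; first exact: measurableU.
  apply: (@le_trans _ _ (mu (U k) + (mu (V k) + mu (N k)))%E).
    by apply: leeD => //; exact: measureU2.
  have [_ N0 _] := NP k; have [_ _ fgk] := gP k.
  rewrite [X in (_ + (_ + X))%E](_ : _ = 0%E)// adde0.
  apply: (@le_trans _ _ ((3 ^+ n / lam)%:E * (lam / k.+1%:R)%:E + (k.+1%:R^-1)%:E)%E).
    apply: leeD.
      apply: le_trans (lebesgue_heavy_set (mh k) (h0 k) lam0) _.
      by apply: lee_wpmul2l => //; rewrite lee_fin divr_ge0 ?exprn_ge0// ltW.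
    have := le_integral_abse mu measurableT (mh k) lam0.
    under eq_integral do rewrite abse_EFin normr_id.
    move=> /le_trans/(_ fgk); rewrite muleC -lee_pdivlMr//.
    by rewrite -EFinM mulrAC divff ?gt_eqF// mul1r.
  rewrite -EFinM -EFinD lee_fin.
  have -> : 3 ^+ n / lam * (lam / k.+1%:R) + k.+1%:R^-1 = (3 ^+ n + 1) / k.+1%:R.
    by rewrite mulrDl mul1r mulrA mulfVK ?gt_eqF.
  by rewrite ler_pdivrMr// mulrC -ler_pdivrMr// ltW// truncnS_gt.
move=> x /= nx k _; apply: contrapT => /not_orP[Ux /not_orP[Vx Nx]]; apply: nx.
have [ag _ _] := gP k; have [_ _ /(_ x Nx) gx] := NP k.
have fgx : `|f x - g k x| <= lam.
  apply/ltW; rewrite ltNge; apply/negP => H; apply: Vx; split => //=.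
  by rewrite normr_id lee_fin.
move/cvgrPdist_le : gx => /(_ _ lam0) gx; near=> t.
have t0 : 0 < t by near: t; exact: nbhs_right_gt.
(* The three terms are at most lam times [heavy_const], lam and [rho_mass] respectively: maximal
   inequality, convergence for g_k, and closeness at x. *)
have -> : rho_conv f t x - rho_mass * f x = rho_conv (f \- g k) t x +
   (rho_conv (g k) t x - rho_mass * g k x) - rho_mass * (f x - g k x).
  by rewrite rho_convB//; ring.
rewrite !mulrDr mulr1; apply: le_trans (ler_normB _ _) _; apply: lerD.
  apply: le_trans (ler_normD _ _) _; apply: lerD.
    rewrite -lee_fin; apply: le_trans (le_rho_conv _ t0 (admissibleB af ag)) _.
    under eq_integral do rewrite EFinM.
    exact: (maximal_rho_conv kappa_gt (mh k) (h0 k) lam0 Ux t0).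
  by rewrite distrC; near: t.
rewrite -mulrDr normrM gtr0_norm// mulrC; apply: ler_wpM2r => //; exact: ltW.
Unshelve. all: by end_near. Qed.

(** The density principle: countably many thresholds lam give convergence outside one null set. *)
Lemma ae_approximated_closed f : admissible f ->
  (forall e : R, 0 < e -> exists g, [/\ admissible g, ae_approximated g &
    (\int[mu]_y (`|f y - g y|)%:E <= e%:E)%E]) -> ae_approximated f.
Proof.
move=> af fg; pose D := @heavy_const R n kappa + 1 + rho_mass.
have D0 : 0 < D.
  by rewrite addr_gt0 ?rho_mass_gt0// addr_gt0// heavy_const_gt0.
have k0 k : 0 < k.+1%:R^-1 / D by rewrite divr_gt0.
have := ae_foralln (fun k => ae_near af (k0 k) fg).
apply: filterS => x H; apply/cvgrPdist_le => e e0.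
have := H (Num.truncn e^-1); apply: filterS => t; rewrite distrC => /le_trans; apply.
rewrite -/D mulfVK ?gt_eqF// invf_ple ?posrE//.
by rewrite ltW// truncnS_gt.
Qed.

Lemma ae_approximatedB f g : admissible f -> admissible g ->
  ae_approximated f -> ae_approximated g -> ae_approximated (f \- g).
Proof.
move=> af ag; apply: filterS2 => x fx gx; rewrite /= mulrBr.
apply: cvg_trans (cvgB fx gx); apply: near_eq_cvg; near=> t.
by rewrite /= rho_convB//; near: t; exact: nbhs_right_gt.
Unshelve. all: by end_near. Qed.

Lemma ae_approximatedZ f (a : R) : admissible f ->
  ae_approximated f -> ae_approximated (fun y => a * f y).
Proof.
move=> af; apply: filterS => x fx; rewrite mulrCA.
have : a * rho_conv f t x @[t --> 0^'+] --> a * (rho_mass * f x).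
  by apply: cvgM; [exact: cvg_cst|exact: fx].
apply: cvg_trans; apply: near_eq_cvg; near=> t.
by rewrite rho_convZ//; near: t; exact: nbhs_right_gt.
Unshelve. all: by end_near. Qed.

Lemma admissible0 : admissible (cst 0).
Proof. by apply: (@admissible_bounded _ _ _ kappa_gt _ 0) => // y; rewrite normr0. Qed.

Lemma ae_approximated0 : ae_approximated (cst 0).
Proof.
apply: aeW => x; rewrite mulr0; apply: cvg_near_cst; near=> t.
by rewrite rho_conv_cst ?mul0r//; near: t; exact: nbhs_right_gt.
Unshelve. all: by end_near. Qed.

Lemma ae_approximatedD f g : admissible f -> admissible g ->
  ae_approximated f -> ae_approximated g ->
  admissible (f \+ g) /\ ae_approximated (f \+ g).
Proof.
move=> af ag gf gg.
have aN : admissible (cst 0 \- g) by exact: admissibleB admissible0 ag.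
have -> : f \+ g = f \- (cst 0 \- g).
  by apply/funext => y; rewrite /= sub0r opprK.
split; first exact: admissibleB.
by apply: ae_approximatedB => //; apply: ae_approximatedB => //;
  [exact: admissible0|exact: ae_approximated0].
Qed.

Lemma ae_approximated_sum (I : Type) (s : seq I) (F : I -> 'rV[R]_n -> R) :
  (forall i, admissible (F i)) -> (forall i, ae_approximated (F i)) ->
  admissible (fun y => \sum_(i <- s) F i y) /\
  ae_approximated (fun y => \sum_(i <- s) F i y).
Proof.
move=> aF gF; elim: s => [|i s [IHa IHg]].
  under eq_fun do rewrite big_nil.
  by split; [exact: admissible0|exact: ae_approximated0].
have -> : (fun y => \sum_(j <- i :: s) F j y) = F i \+ (fun y => \sum_(j <- s) F j y).
  by apply/funext => y; rewrite big_cons.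
exact: ae_approximatedD.
Qed.

End ae_convergence.

(** * Half-open boxes as a generating family *)

Section oc_boxes.
Context {R : realType} {n : nat}.
Local Notation mu := (lebesgue_rV R n).
Implicit Types (a b x y : 'rV[R]_n).

(** Half open to match the generating intervals of the line, with empty boxes allowed so that the
    family is stable under intersection. *)
Definition oc_box a b : set 'rV[R]_n :=
  [set x | forall i, a ord0 i < x ord0 i <= b ord0 i].

Let side a b (i : 'I_n) : set (measurableTypeR R) := `]a ord0 i, b ord0 i]%classic.

Let oc_boxE a b : oc_box a b = [set x | forall i, side a b i (x ord0 i)].
Proof.
by apply/seteqP; split => x /= xab i; have := xab i; rewrite /side/= in_itv.
Qed.

Lemma measurable_oc_box a b : measurable (oc_box a b).
Proof.
by rewrite oc_boxE; apply: (measurable_rV_rect (A := side a b)) => i; exact: measurable_itv.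
Qed.

Lemma lebesgue_oc_box_lty a b : (mu (oc_box a b) < +oo)%E.
Proof.
rewrite oc_boxE (lebesgue_rV_rect (A := side a b)); last by move=> i; exact: measurable_itv.
have -> : (\prod_(i < n) lebesgue_measure (side a b i) =
   (\prod_(i < n) (if a ord0 i < b ord0 i then b ord0 i - a ord0 i else 0))%:E)%E.
  rewrite -prodEFin; apply: eq_bigr => i _; rewrite /side lebesgue_measure_itv/= lte_fin.
  by case: ifP.
exact: ltry.
Qed.

Lemma oc_boxI a b a' b' :
  oc_box a b `&` oc_box a' b' = oc_box (\row_i Num.max (a ord0 i) (a' ord0 i))
    (\row_i Num.min (b ord0 i) (b' ord0 i)).
Proof.
apply/seteqP; split => [x [/= h1 h2] i|x /= h].
  rewrite !mxE gt_max le_min; have := h1 i; have := h2 i.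
  by move=> /andP[-> ->] /andP[-> ->].
by split => i; have := h i; rewrite !mxE gt_max le_min => /andP[/andP[? ?] /andP[? ?]];
  apply/andP.
Qed.

(** The boundary of a box lies in finitely many such hyperplanes and may thus be neglected. *)
Lemma lebesgue_hyperplane (i : 'I_n) (c : R) :
  measurable [set x : 'rV[R]_n | x ord0 i = c] /\ mu [set x : 'rV[R]_n | x ord0 i = c] = 0%E.
Proof.
pose A (j : 'I_n) : set (measurableTypeR R) := if j == i then [set c] else setT.
have mA j : measurable (A j).
  by rewrite /A; case: ifP => // _; exact: measurable_set1.
have -> : [set x : 'rV[R]_n | x ord0 i = c] = [set x | forall j, A j (x ord0 j)].
  apply/seteqP; split => x /=.
    by move=> xi j; rewrite /A; case: eqP => // ->.
  by move=> /(_ i); rewrite /A eqxx.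
split; first exact: measurable_rV_rect.
by rewrite lebesgue_rV_rect// (bigD1 i)//= /A eqxx lebesgue_measure_set1 mul0e.
Qed.

Definition oc_boxes : set (set 'rV[R]_n) := [set E | exists a b, E = oc_box a b].

Lemma oc_boxes_setI : setI_closed oc_boxes.
Proof.
move=> _ _ [a [b ->]] [a' [b' ->]]; rewrite oc_boxI.
by do 2 eexists.
Qed.

(** A slab in one coordinate is the union over N of the boxes whose other sides are ]-N, N], so the
    coordinates are measurable for the generated sigma-algebra. *)
Lemma measurable_oc_boxes (E : set 'rV[R]_n) : measurable E -> <<s oc_boxes >> E.
Proof.
pose T := g_sigma_algebraType oc_boxes.
have mcoord (i : 'I_n) : measurable_fun [set: T]
    (fun x : T => (x : 'rV[R]_n) ord0 i : measurableTypeR R).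
  apply: (measurability _ (erefl : @measurable _ (measurableTypeR R) = <<s _ >>)).
  move=> _ [_ [[u v] _ <-] <-]; rewrite setTI.
  rewrite (_ : _ @^-1` _ = \bigcup_(N : nat)
      oc_box (\row_j if j == i then u else - N%:R) (\row_j if j == i then v else N%:R)).
    apply: bigcup_measurable => N _; apply: sub_sigma_algebra.
    by do 2 eexists.
  apply/seteqP; split => [x /= xuv|x [N _ /= /(_ i)]]; last first.
    by rewrite !mxE eqxx in_itv.
  pose M := \sum_j `|x ord0 j|.
  exists (Num.truncn M).+1 => // j; rewrite !mxE; case: eqP => [->|_].
    by move: xuv; rewrite in_itv.
  have xM : `|x ord0 j| <= M by rewrite /M (bigD1 j)//= lerDl sumr_ge0.
  have := le_lt_trans xM (truncnS_gt M); rewrite ltr_norml => /andP[-> /ltW ->//].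
rewrite [X in X -> _](_ : _ = <<s \big[setU/set0]_(i < n)
  preimage_set_system setT (fun x : 'rV[R]_n => x ord0 i : measurableTypeR R) measurable >> E)//.
apply: smallest_sub; first exact: smallest_sigma_algebra.
move=> D; rewrite -bigcup_seq => -[i _ [A mA <-]].
by apply: mcoord.
Qed.

End oc_boxes.

(** * From boxes to L^p functions *)

Section lebesgue_differentiation.
Context {R : realType} {n : nat}.
Variable kappa : R.
Hypothesis kappa_gt : n%:R / 2 < kappa.
Local Notation mu := (lebesgue_rV R n).
Local Notation rho_kernel := (@rho_kernel R n kappa).
Local Notation rho_conv := (@rho_conv R n kappa).
Local Notation rho_mass := (@rho_mass R n kappa).
Local Notation admissible := (@admissible R n kappa).
Local Notation ae_approximated := (@ae_approximated R n kappa).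
Implicit Types (f g : 'rV[R]_n -> R).

Lemma admissible_indic (E : set 'rV[R]_n) : measurable E -> admissible \1_E.
Proof.
move=> mE; apply: (@admissible_bounded _ _ _ kappa_gt _ 1); first exact: measurable_indic.
by move=> y; rewrite indicE; case: (_ \in _); rewrite ?normr1 ?normr0.
Qed.

Lemma normsq_lt_coord (x y : 'rV[R]_n) (e : R) i : 0 < e ->
  normsq (x - y) < e ^+ 2 -> x ord0 i - e < y ord0 i < x ord0 i + e.
Proof.
move=> e0 xy; have : `|x ord0 i - y ord0 i| < e.
  rewrite -(@ltr_pXn2r _ 2)// ?nnegrE ?(ltW e0)// real_normK ?num_real//.
  apply: le_lt_trans xy; rewrite /normsq (bigD1 i)//= !mxE lerDl.
  by apply: sumr_ge0 => j _; exact: sqr_ge0.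
by rewrite ltr_norml => /andP[? ?]; apply/andP; split; lra.
Qed.

(** Off the hyperplanes that carry the faces the indicator is locally constant, and
    [rho_conv_locally_cst] applies. *)
Let ae_approximated_oc_box a b : ae_approximated \1_(oc_box a b).
Proof.
have ao := admissible_indic (@measurable_oc_box R n a b).
have cv (x : 'rV[R]_n) (e c : R) : 0 < e ->
    (forall y : 'rV[R]_n, (forall i, x ord0 i - e < y ord0 i < x ord0 i + e) ->
      \1_(oc_box a b) y = c) ->
    rho_conv \1_(oc_box a b) t x @[t --> 0^'+] --> rho_mass * c.
  move=> e0 H; apply: (rho_conv_locally_cst kappa_gt ao (d := e ^+ 2)).
    by rewrite exprn_gt0.
  by move=> y xy; apply: H => i; exact: normsq_lt_coord.
have : {ae mu, forall x : 'rV[R]_n, forall i, x ord0 i <> a ord0 i /\ x ord0 i <> b ord0 i}.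
  apply: filter_forall => i.
  have aeN (c : R) : {ae mu, forall x : 'rV[R]_n, x ord0 i <> c}.
    have [mH H0] := @lebesgue_hyperplane R n i c.
    by exists [set x : 'rV[R]_n | x ord0 i = c]; split => // x /= /contrapT.
  by apply: filterI; exact: aeN.
apply: filterS => x xab.
have [xin|/existsNP[i /negP xout]] := pselect (oc_box a b x).
  have : \forall e \near 0^'+, forall i, a ord0 i < x ord0 i - e /\ x ord0 i + e <= b ord0 i.
    apply: filter_forall => i; have /andP[ax bx] := xin i; near=> e.
    have e1 : e < x ord0 i - a ord0 i by near: e; apply: nbhs_right_lt; rewrite subr_gt0.
    have e2 : e <= b ord0 i - x ord0 i.
      near: e; apply: nbhs_right_le; rewrite subr_gt0 lt_neqAle bx andbT.
      by apply/eqP; exact: (xab i).2.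
    by split; lra.
  move=> H; have [e [e0 He]] : exists e : R, 0 < e /\
      forall i, a ord0 i < x ord0 i - e /\ x ord0 i + e <= b ord0 i.
    by have [e eP] := filter_ex (filterI (nbhs_right_gt (0 : R)) H); exists e.
  rewrite indicE (mem_set xin); apply: (cv x e) => // y yx.
  rewrite indicE mem_set// => j; have [? ?] := He j; have /andP[? ?] := yx j.
  by apply/andP; split; lra.
rewrite indicE memNset; last by move=> /(_ i); exact/negP.
have [ai bi] := xab i.
have [e e0 He] : exists2 e : R, 0 < e & (x ord0 i + e <= a ord0 i \/ b ord0 i <= x ord0 i - e).
  move: xout; rewrite negb_and -leNgt -ltNge => /orP[xa|bx].
    exists (a ord0 i - x ord0 i); last by left; lra.
    by rewrite subr_gt0 lt_neqAle xa andbT; exact/eqP.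
  by exists (x ord0 i - b ord0 i); [rewrite subr_gt0|right; lra].
apply: (cv x e) => // y yx; rewrite indicE memNset// => /(_ i) /andP[ay yb].
by have /andP[? ?] := yx i; case: He => ?; lra.
Unshelve. all: by end_near. Qed.

Let cube (N : nat) : set 'rV[R]_n := oc_box (const_mx (- N%:R)) (const_mx N%:R).

Let measurable_cube N : measurable (cube N).
Proof. exact: measurable_oc_box. Qed.

(** Dynkin's argument: boxes form a pi-system and the good sets a lambda-system. The intersection
    with a cube keeps the measures finite, so that an increasing union is approximated in L^1 by its
    members. *)
Let ae_approximated_indic N (E : set 'rV[R]_n) : measurable E ->
  ae_approximated \1_(E `&` cube N).
Proof.
move=> mE; pose H := [set F : set 'rV[R]_n | measurable F /\ ae_approximated \1_(F `&` cube N)].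
suff : H E by case.
have := @lambda_system_subset _ _ (@oc_boxes_setI R n) setT H.
move=> /(_ _ _ _ E) h; apply: h => //; last exact: measurable_oc_boxes.
- split => //.
  + split; first exact: measurableT.
    rewrite setTI; exact: ae_approximated_oc_box.
  + move=> F G GF [mF Fg] [mG Gg]; split; first exact: measurableD.
    have -> : \1_((F `\` G) `&` cube N) =
       (\1_(F `&` cube N) \- \1_(G `&` cube N)) :> ('rV[R]_n -> R).
      apply/funext => y; rewrite /= !indicE setDE !in_setI in_setC.
      case: (boolP (y \in G)) => yG; case: (boolP (y \in F)) => yF;
        case: (y \in cube N); rewrite /= ?subrr ?subr0//.
      by move: yF; rewrite mem_set//; apply: GF; exact: set_mem.
    by apply: ae_approximatedB => //; apply: admissible_indic; exact: measurableI.
  move=> F ndF FH; have mF k : measurable (F k) by have [] := FH k.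
  have mUF : measurable (\bigcup_k F k) by exact: bigcup_measurable.
  split => //; apply: ae_approximated_closed => //.
    by apply: admissible_indic; exact: measurableI.
  move=> e e0.
  pose D k := (\bigcup_k F k `&` cube N) `\` F k.
  have mD k : measurable (D k) by apply: measurableD => //; exact: measurableI.
  have D0 : mu (D k) @[k --> \oo] --> mu (\bigcap_k D k).
    apply: nonincreasing_cvg_mu => //.
    - apply: le_lt_trans (lebesgue_oc_box_lty (const_mx (- N%:R)) (const_mx N%:R)).
      by apply: le_measure; rewrite ?inE//; [exact: measurable_oc_box|move=> y [[]]].
    - exact: bigcap_measurableType.
    - move=> i j ij; apply/subsetPset => y [yU yF]; split => // yi; apply: yF.
      by move: yi; exact/subsetPset/ndF.
  have DE : \bigcap_k D k = set0.
    apply/seteqP; split => // y yD; have [[[k _ Fky] _] _] := yD 0%N Logic.I.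
    by have [_ /(_ Fky)] := yD k Logic.I.
  rewrite DE measure0 in D0.
  have : \forall k \near \oo, (mu (D k) < e%:E)%E.
    apply: (D0 [set z | (z < e%:E)%E]); apply: open_nbhs_nbhs; split.
      exact: open_ereal_lt_ereal.
    by rewrite /= lte_fin.
  move=> /filter_ex[k Dk]; exists (\1_(F k `&` cube N)); split.
  - by apply: admissible_indic; exact: measurableI.
  - by have [] := FH k.
  apply: le_trans (ltW Dk); apply: eqW.
  rewrite -[D k]setIT -integral_indic//; apply: eq_integral => y _; congr EFin.
  rewrite !indicE /D setDE !in_setI in_setC.
  have [yF|yF] := boolP (y \in F k).
    rewrite mem_set; last by exists k => //; exact: set_mem.
    by rewrite /= andbF subrr normr0.
  by rewrite /= subr0 andbT ger0_norm.
- move=> _ [a [b ->]]; split; first exact: measurable_oc_box.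
  by rewrite /cube oc_boxI; exact: ae_approximated_oc_box.
Qed.


Import HBSimple.

Let ae_approximated_sfun N (g : {sfun 'rV[R]_n >-> R}) :
  admissible (fun y => g y * \1_(cube N) y) /\
  ae_approximated (fun y => g y * \1_(cube N) y).
Proof.
have -> : (fun y => g y * \1_(cube N) y) = (fun y =>
    \sum_(r <- finmap.enum_fset (fset_set (range g))) r * \1_(g @^-1` [set r] `&` cube N) y).
  apply/funext => y; rewrite [in LHS]fimfunE fsbig_finite//= mulr_suml.
  apply: eq_bigr => r _; rewrite -mulrA; congr (_ * _).
  by rewrite !indicE in_setI -natrM mulnb.
have mA r : measurable (g @^-1` [set r] `&` cube N) by apply: measurableI.
apply: ae_approximated_sum => // r.
- by apply: admissibleZ; exact: admissible_indic.
- apply: ae_approximatedZ; first exact: admissible_indic.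
  exact: ae_approximated_indic.
Qed.

Let ae_approximated_cube N (f : 'rV[R]_n -> R) : measurable_fun setT f ->
  mu.-integrable (cube N) (EFin \o f) ->
  admissible (fun y => f y * \1_(cube N) y) ->
  ae_approximated (fun y => f y * \1_(cube N) y).
Proof.
move=> mf fi af; apply: ae_approximated_closed => // e e0.
have [g [_ _ fg]] := approximation_sfun_integrable (measurable_cube N) fi.
have : \forall k \near \oo, (\int[mu]_(z in cube N) `|(EFin \o f) z - (g k z)%:E| < e%:E)%E.
  apply: (fg [set z | (z < e%:E)%E]); apply: open_nbhs_nbhs; split.
    exact: open_ereal_lt_ereal.
  by rewrite /= lte_fin.
move=> /filter_ex[k gk]; exists (fun y => g k y * \1_(cube N) y).
have [h1 h2] := ae_approximated_sfun N (g k); split => //.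
apply: le_trans (ltW gk); rewrite [leRHS]integral_mkcond.
apply: eqW; apply: eq_integral => y _.
rewrite patchE indicE; case: (y \in _); first by rewrite !mulr1.
by rewrite !mulr0 subrr normr0.
Qed.

(** A localization: f is integrable on every cube because |f| <= 1 + |f|^p, and the part of f
    outside a cube around x has no influence in the limit at x. *)
Lemma ae_approximated_Lp (p : R) f : 1 <= p -> measurable_fun setT f ->
  (\int[mu]_y (`|f y| `^ p)%:E < +oo)%E -> ae_approximated f.
Proof.
move=> p1 mf fp.
have af : admissible f := admissible_Lp kappa_gt p1 mf fp.
have afN N : admissible (fun y => f y * \1_(cube N) y).
  apply: (admissible_le _ _ af) => [|y].
    by apply: measurable_funM => //; exact: measurable_indic.
  by rewrite normrM indicE ler_piMr//; case: (_ \in _); rewrite ?normr1 ?normr0.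
have mfp : measurable_fun setT (fun y => (`|f y| `^ p)%:E).
  by apply/measurable_EFinP; apply: measurable_fun_powR; exact: measurableT_comp.
have fiN N : mu.-integrable (cube N) (EFin \o f).
  apply/integrableP; split; first by apply/measurable_EFinP; exact: measurable_funTS.
  apply: (@le_lt_trans _ _ (\int[mu]_(y in cube N) (1 + (`|f y| `^ p)%:E))%E).
    apply: ge0_le_integral => //.
    - by apply: measurableT_comp => //; apply/measurable_EFinP; exact: measurable_funTS.
    - by apply: emeasurable_funD => //; exact: measurable_funTS.
    by move=> y _; rewrite -EFinD lee_fin powR_ge_id.
  rewrite ge0_integralD//; last exact: measurable_funTS.
  rewrite lte_add_pinfty//.
    by rewrite integral_cst// mul1e; exact: lebesgue_oc_box_lty.
  by apply: le_lt_trans fp; apply: ge0_subset_integral.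
have := ae_foralln (fun N => ae_approximated_cube mf (fiN N) (afN N)).
apply: filterS => x fx.
(* N exceeds every |x_j| + 1, so f and its truncation agree on the unit ball about x. *)
pose M := \sum_j `|x ord0 j|; pose N := (Num.truncn (M + 1)).+1.
have near_cube y : normsq (x - y) < 1 -> \1_(cube N) y = 1 :> R.
  move=> xy; rewrite indicE mem_set// => j; rewrite !mxE.
  have := @normsq_lt_coord x y 1 j ltr01; rewrite expr1n => /(_ xy) /andP[h1 h2].
  have xM : `|x ord0 j| <= M by rewrite /M (bigD1 j)//= lerDl sumr_ge0.
  have := truncnS_gt (M + 1); rewrite -/N => MN.
  move: xM; rewrite ler_norml => /andP[h3 h4].
  by apply/andP; split; lra.
have fE : f = (fun y => f y * \1_(cube N) y) \+ (f \- (fun y => f y * \1_(cube N) y)).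
  by apply/funext => y /=; rewrite subrKC.
have ad : admissible (f \- (fun y => f y * \1_(cube N) y)) by exact: admissibleB.
have d0 : rho_conv (f \- (fun y => f y * \1_(cube N) y)) t x @[t --> 0^'+] --> 0.
  apply: (rho_conv_near0 kappa_gt ad ltr01) => y xy.
  by rewrite /= near_cube// mulr1 subrr.
have : rho_conv (fun y => f y * \1_(cube N) y) t x +
    rho_conv (f \- (fun y => f y * \1_(cube N) y)) t x @[t --> 0^'+] -->
    rho_mass * (f x * \1_(cube N) x) + 0 by apply: cvgD; [exact: fx|exact: d0].
rewrite addr0 near_cube; last first.
  by rewrite subrr /normsq big1// => i _; rewrite mxE expr0n.
rewrite mulr1; apply: cvg_trans; apply: near_eq_cvg; near=> t.
have t0 : 0 < t by near: t; exact: nbhs_right_gt.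
by rewrite /= rho_convB// subrKC.
Unshelve. all: by end_near. Qed.

End lebesgue_differentiation.

(** * Convergence in L^p *)

(** Holds with the default values included: the real integral is [fine] of a difference of two
    measurable extended real functions. *)
Lemma measurable_Rintegral d1 d2 (T1 : measurableType d1) (T2 : measurableType d2)
    (R : realType) (m2 : {sigma_finite_measure set T2 -> \bar R}) (k : T1 -> T2 -> R) :
  measurable_fun [set: T1 * T2] (fun z : T1 * T2 => k z.1 z.2) ->
  measurable_fun setT (fun x => \int[m2]_y k x y).
Proof.
move=> mk; have mK : measurable_fun [set: T1 * T2] (fun z : T1 * T2 => (k z.1 z.2)%:E).
  exact/measurable_EFinP.
apply: (measurableT_comp (@fine_measurable R setT measurableT)).
under eq_fun do rewrite integralE; apply: emeasurable_funB.
- apply: (measurable_fun_integral m2 (k := fun x => (fun y => (k x y)%:E)^\+%E)) => [|x y].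
    rewrite [X in measurable_fun _ X](_ : _ = (fun z : T1 * T2 => (k z.1 z.2)%:E)^\+%E).
      exact: measurable_funepos.
    by apply/funext => z; rewrite !funeposE.
  exact: funepos_ge0.
- apply: (measurable_fun_integral m2 (k := fun x => (fun y => (k x y)%:E)^\-%E)) => [|x y].
    rewrite [X in measurable_fun _ X](_ : _ = (fun z : T1 * T2 => (k z.1 z.2)%:E)^\-%E).
      exact: measurable_funeneg.
    by apply/funext => z; rewrite !funenegE.
  exact: funeneg_ge0.
Qed.

Lemma powR_norm_sub_le (R : realType) (a b p : R) : 0 <= p ->
  `|a - b| `^ p <= 2 `^ p * (`|a| `^ p + `|b| `^ p).
Proof.
move=> p0; pose M := Num.max `|a| `|b|.
have M0 : 0 <= M by rewrite /M le_max normr_ge0.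
have abM : `|a - b| <= 2 * M.
  rewrite (le_trans (ler_normB _ _))// mulr_natl mulr2n lerD//.
    by rewrite /M le_max lexx.
  by rewrite /M le_max lexx orbT.
apply: (@le_trans _ _ ((2 * M) `^ p)).
  by apply: ge0_ler_powR => //; rewrite nnegrE// mulr_ge0.
rewrite powRM// ler_wpM2l ?powR_ge0//.
have [->|->] : M = `|a| \/ M = `|b| by rewrite /M; case: leP; [right|left].
  by rewrite lerDl powR_ge0.
by rewrite lerDr powR_ge0.
Qed.

Lemma cvg_powR (R : realType) T (F : set_system T) (FF : Filter F) (f : T -> R) (l p : R) :
  0 < p -> (forall x, 0 <= f x) -> 0 <= l -> f x @[x --> F] --> l -> f x `^ p @[x --> F] --> l `^ p.
Proof.
move=> p0 f0; rewrite le_eqVlt => /predU1P[<- fl|l0 fl].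
  rewrite powR0 ?gt_eqF//; apply/cvgr0Pnorm_le => e e0.
  move/cvgr0Pnorm_le : fl => /(_ (e `^ p^-1)) /(_ (powR_gt0 _ e0)).
  apply: filterS => x; rewrite ger0_norm// => fx; rewrite ger0_norm ?powR_ge0//.
  rewrite -(powRr1 (ltW e0)) -(mulVf (lt0r_neq0 p0)) powRrM.
  by apply: ge0_ler_powR => //; rewrite ?nnegrE ?powR_ge0 ?f0// ltW.
have : expR (p * ln (f x)) @[x --> F] --> expR (p * ln l).
  apply: continuous_cvg; first exact: continuous_expR.
  apply: cvgM; first exact: cvg_cst.
  by apply: continuous_cvg => //; exact: continuous_ln.
rewrite {2}/powR gt_eqF//; apply: cvg_trans; apply: near_eq_cvg.
have := @cvgr_gt _ _ F FF f l fl 0 l0; apply: filterS => x fx.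
by rewrite /powR gt_eqF.
Qed.

Section riesz_scheffe.
Context d (T : measurableType d) (R : realType) (mu : {measure set T -> \bar R}).
Variables (p : R) (u : nat -> T -> R) (v : T -> R).
Hypotheses (p0 : 0 < p) (mu_ : forall k, measurable_fun setT (u k))
  (mv : measurable_fun setT v).

(** An inequality of norms is enough. With c = 2^p and A the integral of |v|^p, the integrals of h_k
    and of |u_k - v|^p add up to at most 2 c A, while Fatou bounds the lower limit of the former
    from below by 2 c A. *)
Lemma riesz_scheffe :
  (\int[mu]_x (`|v x| `^ p)%:E < +oo)%E ->
  (forall k, \int[mu]_x (`|u k x| `^ p)%:E <= \int[mu]_x (`|v x| `^ p)%:E)%E ->
  {ae mu, forall x, u k x @[k --> \oo] --> v x} ->
  forall e : R, 0 < e -> \forall k \near \oo, (\int[mu]_x (`|u k x - v x| `^ p)%:E <= e%:E)%E.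
Proof.
move=> vp uv uvx e e0; pose A := fine (\int[mu]_x (`|v x| `^ p)%:E)%E.
have AE : (\int[mu]_x (`|v x| `^ p)%:E = A%:E)%E.
  by rewrite /A fineK// ge0_fin_numE// integral_ge0// => x _; rewrite lee_fin powR_ge0.
pose c : R := 2 `^ p.
have c0 : 0 <= c by exact: powR_ge0.
pose h k x := c * (`|u k x| `^ p + `|v x| `^ p) - `|u k x - v x| `^ p.
have h0 k x : 0 <= h k x by rewrite subr_ge0 powR_norm_sub_le// ltW.
have mup k : measurable_fun setT (fun x => `|u k x| `^ p).
  by apply: measurable_fun_powR; exact: measurableT_comp.
have mvp : measurable_fun setT (fun x => `|v x| `^ p).
  by apply: measurable_fun_powR; exact: measurableT_comp.
have mdp k : measurable_fun setT (fun x => `|u k x - v x| `^ p).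
  by apply: measurable_fun_powR; apply: measurableT_comp => //; exact: measurable_funB.
have mh k : measurable_fun setT (h k).
  by apply: measurable_funB => //; apply: measurable_funM => //; exact: measurable_funD.
pose D k : \bar R := (\int[mu]_x (`|u k x - v x| `^ p)%:E)%E.
have D0 k : (0 <= D k)%E by apply: integral_ge0 => x _; rewrite lee_fin powR_ge0.
have hD k : (\int[mu]_x (h k x)%:E + D k <= (2 * c * A)%:E)%E.
  rewrite -ge0_integralD => [|//|x _| |x _|]; last 4 first.
  - by rewrite lee_fin.
  - exact/measurable_EFinP.
  - by rewrite lee_fin powR_ge0.
  - exact/measurable_EFinP.
  under eq_integral do rewrite -EFinD /h subrK EFinM.
  rewrite ge0_integralZl => [|//| |x _|]; last 3 first.
  - by apply/measurable_EFinP; exact: measurable_funD.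
  - by rewrite lee_fin addr_ge0 ?powR_ge0.
  - by rewrite lee_fin.
  under eq_integral do rewrite EFinD.
  rewrite ge0_integralD => [|//|x _| |x _|]; last 4 first.
  - by rewrite lee_fin powR_ge0.
  - exact/measurable_EFinP.
  - by rewrite lee_fin powR_ge0.
  - exact/measurable_EFinP.
  rewrite AE.
  apply: (@le_trans _ _ (c%:E * (A%:E + A%:E))%E).
    by apply: lee_wpmul2l; [rewrite lee_fin|apply: leeD => //; rewrite -AE].
  by rewrite -EFinD -EFinM lee_fin; lra.
have fatouh : ((2 * c * A)%:E <= limn_einf (fun k => \int[mu]_x (h k x)%:E))%E.
  apply: le_trans (fatou mu measurableT (f := fun k x => (h k x)%:E) _ _); last 2 first.
  - by move=> k; exact/measurable_EFinP.
  - by move=> k x _; rewrite lee_fin.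
  have -> : ((2 * c * A)%:E = \int[mu]_x (2 * c * `|v x| `^ p)%:E)%E.
    under eq_integral do rewrite EFinM.
    rewrite ge0_integralZl => [|//| |x _|]; last 3 first.
    + exact/measurable_EFinP.
    + by rewrite lee_fin powR_ge0.
    + by rewrite lee_fin mulr_ge0.
    by rewrite AE.
  apply: eqW; apply: ae_eq_integral => //.
  - by apply/measurable_EFinP; exact: measurable_funM.
  - apply: (emeasurable_fun_cvg (fun k x => einfs (fun j => (h j x)%:E) k)) => [k|x _].
      by apply: measurable_fun_einfs => j; exact/measurable_EFinP.
    by rewrite limn_einf_lim; exact: is_cvg_einfs.
  move: uvx; apply: filterS => x uvx _.
  symmetry; apply: (cvg_limn_einf_sup _).1; apply: cvg_EFin; first exact: nearW.
  have un : `|u k x| `^ p @[k --> \oo] --> `|v x| `^ p.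
    by apply: cvg_powR => //; exact: cvg_norm.
  have ud : `|u k x - v x| `^ p @[k --> \oo] --> (0 : R).
    rewrite -[X in _ --> X](powR0 (lt0r_neq0 p0)); apply: cvg_powR => //.
    rewrite -(normr0 R) -(subrr (v x)); apply: cvg_norm; apply: cvgB => //; exact: cvg_cst.
  have -> : 2 * c * `|v x| `^ p = c * (`|v x| `^ p + `|v x| `^ p) - 0 by ring.
  apply: cvgB; last exact: ud.
  by apply: cvgM; [exact: cvg_cst|apply: cvgD => //; exact: cvg_cst].
pose H k : \bar R := (\int[mu]_x (h k x)%:E)%E.
have : ((2 * c * A - e)%:E < ereal_sup (range (einfs H)))%E.
  rewrite -(cvg_lim _ (@cvg_einfs_sup _ H))// -limn_einf_lim.
  by apply: lt_le_trans fatouh; rewrite lte_fin ltrBlDr ltrDl.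
move=> /ereal_sup_gt[_ [N _ <-] HN]; exists N => // k /= Nk.
have Hk : (((2 * c * A - e)%:E) < H k)%E.
  by apply: lt_le_trans HN _; apply: ereal_inf_lbound; exists k.
have := hD k; rewrite -/(H k) -/(D k) => HDk.
have : ((2 * c * A - e)%:E + D k <= (2 * c * A)%:E)%E.
  by apply: le_trans HDk; apply: leeD => //; exact: ltW.
case: (D k) => [r| |_]; [by rewrite -EFinD !lee_fin; lra|by rewrite addey|exact: leNye].
Qed.
End riesz_scheffe.

(** Fatou's lemma concerns sequences, whereas the scale t is continuous. *)
Lemma near_right_sequentially (R : realType) (P : R -> Prop) :
  (forall u : R^nat, (forall k, 0 < u k) -> u k @[k --> \oo] --> 0 ->
    \forall k \near \oo, P (u k)) ->
  \forall t \near 0^'+, P t.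
Proof.
move=> H; apply: contrapT => nP.
have /choice[u uP] k : exists t, [/\ 0 < t, t < k.+1%:R^-1 & ~ P t].
  apply: contrapT => nk; apply: nP; near=> t; apply: contrapT => nt.
  by apply: nk; exists t; split => //.
have u0 k : 0 < u k by have [] := uP k.
have : u k @[k --> \oo] --> 0.
  apply: (squeeze_cvgr _ (cvg_cst 0) cvg_harmonic); near=> k.
  by have [_ uk _] := uP k; rewrite (ltW (u0 k))/= ltW.
by move=> /(H u u0)[N _ /(_ N (leqnn N))]; have [] := uP N.
Unshelve. all: by end_near. Qed.

Lemma ge0_cvge0 (R : realType) I (F : set_system I) (FF : Filter F) (h : I -> \bar R) :
  (forall i, 0 <= h i)%E ->
  (forall e : R, 0 < e -> \forall i \near F, (h i <= e%:E)%E) ->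
  h i @[i --> F] --> 0%E.
Proof.
move=> h0 he; apply/fine_cvgP; split.
  have := he 1 ltr01; apply: filterS => i hi; rewrite ge0_fin_numE//.
  exact: le_lt_trans hi (ltry 1).
apply/cvgr0Pnorm_le => e e0; have := he e e0; apply: filterS => i /=.
move: (h0 i); case: (h i) => //= r; rewrite !lee_fin => r0.
by rewrite ger0_norm.
Qed.

(** * Contraction and convergence in L^p *)

Section Lp_convergence.
Context {R : realType} {n : nat}.
Variable kappa : R.
Hypothesis kappa_gt : n%:R / 2 < kappa.
Local Notation mu := (lebesgue_rV R n).
Local Notation rho_kernel := (@rho_kernel R n kappa).
Local Notation rho_conv := (@rho_conv R n kappa).
Local Notation rho_mass := (@rho_mass R n kappa).
Local Notation admissible := (@admissible R n kappa).
Variables (p : R) (f : 'rV[R]_n -> R).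
Hypotheses (p1 : 1 <= p) (mf : measurable_fun setT f)
  (fp : (\int[mu]_y (`|f y| `^ p)%:E < +oo)%E).

Let p0 : 0 < p. Proof. exact: lt_le_trans p1. Qed.
Let af : admissible f. Proof. exact: (admissible_Lp kappa_gt p1). Qed.
Let mass0 : 0 < rho_mass. Proof. exact: rho_mass_gt0. Qed.
Let mfp : measurable_fun setT (fun y => `|f y| `^ p).
Proof. by apply: measurable_fun_powR; exact: measurableT_comp. Qed.

Lemma measurable_rho_conv t : measurable_fun setT (rho_conv f t).
Proof.
rewrite /rho_conv.
apply: (@measurable_Rintegral _ _ 'rV[R]_n 'rV[R]_n R mu (fun x y => f y * rho_kernel t (x - y))).
apply: measurable_funM; first exact: (measurableT_comp mf measurable_snd).
by apply: measurable_fun_rho_kernel; meas.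
Qed.

Lemma rho_conv_powR_le t x : 0 < t ->
  ((`|rho_conv f t x| `^ p)%:E <=
   (rho_mass `^ (p - 1))%:E * \int[mu]_y (`|f y| `^ p * rho_kernel t (x - y))%:E)%E.
Proof.
move=> t0; have := le_rho_conv x t0 af.
have mk : measurable_fun setT (fun y : 'rV[R]_n => rho_kernel t (x - y)).
  exact: measurable_rho_kernel_sub.
have mfk : measurable_fun setT (fun y => `|f y| * rho_kernel t (x - y)).
  by apply: measurable_funM => //; exact: measurableT_comp.
have k0 y : 0 <= rho_kernel t (x - y) by exact: rho_kernel_ge0.
have := p1; rewrite le_eqVlt => /predU1P[<-|p1'].
  rewrite subrr powRr0 powRr1// mul1e => /le_trans; apply.
  by under [leRHS]eq_integral do rewrite powRr1//.
set J := (\int[mu]_y (`|f y| `^ p * rho_kernel t (x - y))%:E)%E.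
set I := integral _ _ _ => fI.
have If : I \is a fin_num.
  rewrite ge0_fin_numE; last by apply: integral_ge0 => y _; rewrite lee_fin mulr_ge0.
  have /integrableP[_] := af.2 t x t0; apply: le_lt_trans; rewrite /I.
  apply: eqW; apply: eq_integral => y _.
  by rewrite abse_EFin normrM [`|rho_kernel _ _|]ger0_norm.
pose s := fine I; have IE : I = s%:E by rewrite /s fineK.
move: fI; rewrite IE lee_fin => fs.
have s0 : 0 <= s by rewrite (le_trans _ fs).
(* The kernel mean of |f|. Young's inequality for |f| sg^(p - 1), integrated against the kernel,
   gives rho_mass sg^p <= J / p + rho_mass sg^p / q, hence rho_mass sg^p <= J. *)
pose sg := s / rho_mass; have sg0 : 0 <= sg by rewrite divr_ge0// ltW.
pose q := p / (p - 1).
have pB : 0 < p - 1 by rewrite subr_gt0.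
have q0 : 0 < q by rewrite divr_gt0.
have pq : p^-1 + q^-1 = 1.
  by rewrite /q invf_div -[X in X + _]mul1r -mulrDl addrC subrK divff ?gt_eqF.
have young y : `|f y| * sg `^ (p - 1) <= `|f y| `^ p / p + sg `^ p / q.
  have := conjugate_powR (normr_ge0 (f y)) (powR_ge0 sg (p - 1)) p0 q0 pq.
  by rewrite -powRrM /q mulrCA divff ?mulr1// gt_eqF.
have : ((s * sg `^ (p - 1))%:E <= (p^-1)%:E * J + (sg `^ p / q * rho_mass)%:E)%E.
  rewrite EFinM -IE muleC -ge0_integralZl => [|//|//| |//]; last 3 first.
  - exact/measurable_EFinP.
  - by move=> y _; rewrite lee_fin mulr_ge0.
  - by rewrite lee_fin powR_ge0.
  rewrite EFinM -(integral_rho_kernel_sub kappa_gt x t0).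
  have -> : ((p^-1)%:E * J = \int[mu]_y ((p^-1)%:E * (`|f y| `^ p * rho_kernel t (x - y))%:E))%E.
    rewrite ge0_integralZl => [//|//| |y _|].
    - by apply/measurable_EFinP; exact: measurable_funM.
    - by rewrite lee_fin mulr_ge0 ?powR_ge0.
    - by rewrite lee_fin invr_ge0 ltW.
  rewrite -ge0_integralZl => [|//| |y _|]; last 3 first.
  - exact/measurable_EFinP.
  - by rewrite lee_fin.
  - by rewrite lee_fin divr_ge0 ?powR_ge0// ltW.
  rewrite -ge0_integralD => [|//|y _| |y _|]; last 4 first.
  - by rewrite -EFinM lee_fin mulr_ge0 ?invr_ge0 ?(ltW p0)// mulr_ge0 ?powR_ge0.
  - by apply: emeasurable_funM => //; apply/measurable_EFinP; exact: measurable_funM.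
  - by rewrite -EFinM lee_fin mulr_ge0// divr_ge0 ?powR_ge0// ltW.
  - by apply: emeasurable_funM => //; exact/measurable_EFinP.
  apply: ge0_le_integral => //.
  - by move=> y _; rewrite -EFinM lee_fin mulr_ge0 ?powR_ge0// mulr_ge0.
  - by apply: emeasurable_funM => //; exact/measurable_EFinP.
  - apply: emeasurable_funD; apply: emeasurable_funM => //; apply/measurable_EFinP => //.
    exact: measurable_funM.
  move=> y _; rewrite -!EFinM -EFinD lee_fin.
  have := ler_wpM2r (k0 y) (young y); lra.
have sE : s = rho_mass * sg by rewrite /sg mulrC mulfVK ?gt_eqF.
have -> : s * sg `^ (p - 1) = rho_mass * sg `^ p.
  by rewrite [in LHS]sE -mulrA mulr_powRB1.
have J0 : (0 <= J)%E by apply: integral_ge0 => y _; rewrite lee_fin mulr_ge0 ?powR_ge0.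
case: J J0 => [J J0|_ _|//]; last first.
  by rewrite gt0_muley ?leey// lte_fin powR_gt0.
rewrite -EFinM -EFinD -EFinM !lee_fin => H.
have sJ : rho_mass * sg `^ p <= J.
  have : rho_mass * sg `^ p * p^-1 <= J * p^-1.
    have -> : p^-1 = 1 - q^-1 by rewrite -pq addrK.
    have -> : J * (1 - q^-1) = p^-1 * J by rewrite -pq addrK mulrC.
    rewrite mulrBr mulr1; lra.
  by rewrite ler_pM2r// invr_gt0.
apply: (@le_trans _ _ (s `^ p)); first by apply: ge0_ler_powR => //; rewrite ?nnegrE ltW.
rewrite sE powRM ?(ltW mass0)// -(mulr_powRB1 (ltW mass0) p0) -mulrA.
by rewrite mulrCA ler_wpM2l ?powR_ge0.
Qed.

(** The constant is sharp for the purpose: the right side is the integral of |rho_mass f|^p, as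
    [riesz_scheffe] demands. *)
Lemma Lp_norm_rho_conv_le t : 0 < t ->
  (\int[mu]_x (`|rho_conv f t x| `^ p)%:E <=
   (rho_mass `^ p)%:E * \int[mu]_y (`|f y| `^ p)%:E)%E.
Proof.
move=> t0; pose k x y := (`|f y| `^ p * rho_kernel t (x - y))%:E.
have k0 x y : (0 <= k x y)%E by rewrite lee_fin mulr_ge0 ?powR_ge0 ?rho_kernel_ge0.
have mk : measurable_fun setT (fun z : 'rV[R]_n * 'rV[R]_n => k z.1 z.2).
  apply/measurable_EFinP; apply: measurable_funM.
    exact: (measurableT_comp mfp measurable_snd).
  by apply: measurable_fun_rho_kernel; meas.
have mI : measurable_fun setT (fun x => \int[mu]_y k x y)%E.
  exact: (measurable_fun_integral mu mk k0).
apply: (@le_trans _ _ (\int[mu]_x ((rho_mass `^ (p - 1))%:E * \int[mu]_y k x y))%E).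
  apply: ge0_le_integral => //.
  - apply/measurable_EFinP; apply: measurable_fun_powR; apply: measurableT_comp => //.
    exact: measurable_rho_conv.
  - exact: emeasurable_funM.
  by move=> x _; exact: rho_conv_powR_le.
rewrite ge0_integralZl => [|//|//|x _|]; last 2 first.
- exact: integral_ge0.
- by rewrite lee_fin powR_ge0.
rewrite (tonelli mu mu mk k0) /k.
under eq_integral => y _.
  under eq_integral do rewrite EFinM.
  rewrite ge0_integralZl => [|//| |x _|]; last 3 first.
  - by apply/measurable_EFinP; apply: measurable_fun_rho_kernel; meas.
  - by rewrite lee_fin rho_kernel_ge0.
  - by rewrite lee_fin powR_ge0.
  over.
have mass y : (\int[mu]_x (rho_kernel t (x - y))%:E = rho_mass%:E)%E.
  rewrite -(integral_rho_kernel kappa_gt t0).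
  have mK : measurable_fun setT (fun x : 'rV[R]_n => (rho_kernel t x)%:E).
    by apply/measurable_EFinP; exact: measurable_rho_kernel.
  have K0 x : (0 <= (rho_kernel t x)%:E)%E by rewrite lee_fin rho_kernel_ge0.
  have := ge0_integral_rV_affine (- y) (oner_neq0 R) mK K0.
  rewrite normr1 expr1n invr1 mul1e => <-.
  by apply: eq_integral => x _; rewrite scale1r addrC.
under eq_integral do rewrite mass.
rewrite ge0_integralZr => [|//| |y _|]; last 3 first.
- exact/measurable_EFinP.
- by rewrite lee_fin powR_ge0.
- by rewrite lee_fin ltW.
by rewrite muleCA -EFinM muleC -(mulr_powRB1 (ltW mass0) p0) [rho_mass * _]mulrC.
Qed.

Lemma Lp_cvg_rho_conv (e : R) : 0 < e ->
  \forall t \near 0^'+, (\int[mu]_x (`|rho_conv f t x - rho_mass * f x| `^ p)%:E <= e%:E)%E.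
Proof.
move=> e0; apply: near_right_sequentially => u u0 u_cvg.
have normE : (\int[mu]_x (`|rho_mass * f x| `^ p)%:E =
   (rho_mass `^ p)%:E * \int[mu]_y (`|f y| `^ p)%:E)%E.
  rewrite -ge0_integralZl => [|//| |x _|]; last 3 first.
  - exact/measurable_EFinP.
  - by rewrite lee_fin powR_ge0.
  - by rewrite lee_fin powR_ge0.
  apply: eq_integral => x _.
  by rewrite normrM (gtr0_norm mass0) powRM ?EFinM// ltW.
apply: (@riesz_scheffe _ _ R mu p (fun k => rho_conv f (u k)) (fun x => rho_mass * f x)
  p0 _ _ _ _ _ e e0).
- by move=> k; exact: measurable_rho_conv.
- exact: measurable_funM.
- by rewrite normE lte_mul_pinfty// lee_fin powR_ge0.
- by move=> k; rewrite normE; exact: Lp_norm_rho_conv_le.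
have := ae_approximated_Lp kappa_gt p1 mf fp.
by apply: filterS => x /cvg_at_rightP; apply; split.
Qed.

Lemma Lp_limit_rho_conv (C : R) (F : R -> 'rV[R]_n -> R) :
  (forall t x, 0 < t -> F t x = C * rho_conv f t x) ->
  Lp_limit p F (fun x => C * rho_mass * f x).
Proof.
move=> FE; have mF t : 0 < t -> measurable_fun setT (F t).
  move=> t0; rewrite (_ : F t = fun x => C * rho_conv f t x); last first.
    by apply/funext => x; exact: FE.
  by apply: measurable_funM => //; exact: measurable_rho_conv.
have mp : measurable_fun setT (fun x : R => x `^ p) by exact: measurable_powR.
have CE t : 0 < t -> (\int[mu]_x (`|F t x| `^ p)%:E =
    (`|C| `^ p)%:E * \int[mu]_x (`|rho_conv f t x| `^ p)%:E)%E.
  move=> t0; rewrite -ge0_integralZl => [|//| |x _|]; last 3 first.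
  - apply/measurable_EFinP; apply: measurable_fun_powR; apply: measurableT_comp => //.
    exact: measurable_rho_conv.
  - by rewrite lee_fin powR_ge0.
  - by rewrite lee_fin powR_ge0.
  by apply: eq_integral => x _; rewrite FE// normrM powRM// EFinM.
have normE g : ('N[mu]_p%:E[EFin \o g] = (\int[mu]_x (`|g x| `^ p)%:E) `^ p^-1)%E.
  by rewrite unlock.
split.
  near=> t; have t0 : 0 < t by near: t; exact: nbhs_right_gt.
  apply/andP; split; rewrite inE/=; first exact: mF.
  rewrite /finite_norm normE; apply: poweR_lty; rewrite (CE t t0).
  apply: lte_mul_pinfty; [by rewrite lee_fin powR_ge0|by []|].
  apply: le_lt_trans (Lp_norm_rho_conv_le t0) _.
  by rewrite lte_mul_pinfty ?lee_fin ?powR_ge0.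
apply: ge0_cvge0 => [t|e e0]; first exact: Lnorm_ge0.
(* The summand 1 covers C = 0, which occurs when C contains the inverse of Gamma at a pole. *)
have d0 : 0 < e `^ p / (`|C| `^ p + 1) by rewrite divr_gt0 ?powR_gt0// ltr_wpDl ?powR_ge0.
have := Lp_cvg_rho_conv d0; apply: filterS2 (nbhs_right_gt 0) => t t0 H.
rewrite normE; have -> : e%:E = ((e `^ p)%:E `^ p^-1)%E.
  by rewrite poweR_EFin -powRrM divff ?powRr1 ?gt_eqF// ltW.
have I0 g : (0 <= \int[mu]_x (`|g x| `^ p)%:E)%E.
  by apply: integral_ge0 => x _; rewrite lee_fin powR_ge0.
apply: gt0_ler_poweR; rewrite ?invr_ge0 ?(ltW p0)// ?in_itv/= ?leey ?andbT ?lee_fin ?powR_ge0//.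
apply: (@le_trans _ _ ((`|C| `^ p)%:E *
    \int[mu]_x (`|rho_conv f t x - rho_mass * f x| `^ p)%:E)%E).
  rewrite -ge0_integralZl => [|//| |x _|]; last 3 first.
  - apply/measurable_EFinP; apply: measurable_fun_powR; apply: measurableT_comp => //.
    by apply: measurable_funB; [exact: measurable_rho_conv|exact: measurable_funM].
  - by rewrite lee_fin powR_ge0.
  - by rewrite lee_fin powR_ge0.
  apply: eqW; apply: eq_integral => x _.
  by rewrite /= FE// -mulrA -mulrBr normrM powRM// EFinM.
apply: le_trans (lee_wpmul2l _ H) _; first by rewrite lee_fin powR_ge0.
rewrite -EFinM lee_fin mulrA ler_pdivrMr ?ltr_wpDl ?powR_ge0//.
by rewrite mulrC ler_wpM2l ?powR_ge0// lerDl.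
Unshelve. all: by end_near. Qed.

End Lp_convergence.

(** * Uniform convergence *)

Section C0.
Context {R : realType} {n : nat}.
Implicit Types (x y : 'rV[R]_n) (f : 'rV[R]_n -> R).

Lemma coord_le_enorm x i : `|x ord0 i| <= enorm x.
Proof.
rewrite /enorm -sqrtr_sqr ler_sqrt; last by apply: sumr_ge0 => j _; exact: sqr_ge0.
by rewrite (bigD1 i)//= lerDl; apply: sumr_ge0 => j _; exact: sqr_ge0.
Qed.

Let cube (M : R) : set 'rV[R]_n := [set v | forall i, `[- M, M]%classic (v ord0 i)].

Let compact_cube M : compact (cube M).
Proof. exact: (@rV_compact R n (fun _ => `[- M, M]%classic) (fun i => @segment_compact R (- M) M)). Qed.

Let near_cube M (F : set_system R) (P : R -> 'rV[R]_n -> Prop) : Filter F ->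
  (forall x, cube M x -> \near x & F, P F x) -> \near F, cube M `<=` P F.
Proof. by apply: (compact_near_coveringP (cube M)).1; exact: compact_cube. Qed.

Let notin_cube M x : ~ cube M x -> exists i, M < `|x ord0 i|.
Proof.
move=> xM; apply: contrapT => H; apply: xM => i /=; rewrite in_itv/= -ler_norml leNgt.
by apply/negP => Mx; apply: H; exists i.
Qed.

Lemma C0_bounded f : C0 f -> exists M, forall x, `|f x| <= M.
Proof.
move=> [cf f0]; have [M fM] := f0 1 ltr01.
have := @near_cube M (pinfty_nbhs R) (fun (A : R) x => `|f x| <= A) _.
case=> [x _|A [_ AP]].
  near=> y A.
  have fy : `|f x - f y| <= 1.
    by near: y; move/cvgrPdist_le: (cf x); apply.
  rewrite /=; apply: (@le_trans _ _ (`|f x| + 1)); last by near: A; exact: nbhs_pinfty_ge.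
  by rewrite -[f y](subKr (f x)) (le_trans (ler_normB _ _))// lerD2l.
exists (Num.max 1 (A + 1)) => x; rewrite le_max.
have [xM|/notin_cube[i xi]] := pselect (cube M x).
  by rewrite (AP (A + 1)) ?orbT// ltrDl.
by rewrite ltW// fM// (lt_le_trans xi)// coord_le_enorm.
Unshelve. all: by end_near. Qed.

(** Compactness gives a uniform d on a cube; beyond it both values are small. *)
Lemma C0_uniform f : C0 f -> forall e : R, 0 < e ->
  exists2 d : R, 0 < d & forall x y, normsq (x - y) < d -> `|f x - f y| <= e.
Proof.
move=> [cf f0] e e0; have e2 : 0 < e / 2 by rewrite divr_gt0.
have [M fM] := f0 _ e2.
(* The cube is larger than M by 1: if x lies outside it and y is within distance 1, then y is still
   beyond M, where |f| < e / 2. *)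
have := @near_cube (M + 1) (at_right 0)
  (fun (d : R) x => forall y, (forall i, `|x ord0 i - y ord0 i| < d) -> `|f x - f y| <= e) _.
case=> [x _|d0 /= d00 dP].
  move/cvgrPdist_le: (cf x) => /(_ _ e2) /nbhs_ballP[r /= r0 rP].
  have r2 : 0 < r / 2 by rewrite divr_gt0.
  near=> x' d => /= y x'y.
  have dr : d <= r / 2 by near: d; exact: nbhs_right_le.
  have xx' : ball x (r / 2) x' by near: x'; exact: nbhsx_ballx.
  have fx' : `|f x - f x'| <= e / 2.
    by apply: rP; split => // i j; apply: le_ball (xx'.2 i j); rewrite ler_pdivrMr// ler_pMr// ler1n.
  have fy : `|f x - f y| <= e / 2.
    apply: rP; split => // i j; rewrite (ord1 i) [r]splitr.
    apply: (ball_triangle (xx'.2 ord0 j)); rewrite /ball/=.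
    exact: lt_le_trans (x'y j) dr.
  rewrite [e]splitr -[f x' - f y](subrKA (f x)) (le_trans (ler_normD _ _))// lerD//.
  by rewrite distrC.
have d1 : 0 < Num.min (d0 / 2) 1 by rewrite lt_min ltr01 andbT divr_gt0.
exists (Num.min (d0 / 2) 1 ^+ 2) => [|x y xy]; first by rewrite exprn_gt0.
have xyi i : `|x ord0 i - y ord0 i| < Num.min (d0 / 2) 1.
  rewrite -enorm_sqr in xy.
  have /le_lt_trans : `|x ord0 i - y ord0 i| <= enorm (x - y).
    by have := coord_le_enorm (x - y) i; rewrite !mxE.
  by apply; rewrite -(ltr_pXn2r (n := 2))// ?nnegrE ?sqrtr_ge0// ltW.
have [xM|/notin_cube[i xi]] := pselect (cube (M + 1) x).
  apply: (dP (d0 / 2)) => //=.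
  - by rewrite sub0r normrN gtr0_norm ?divr_gt0// ltr_pdivrMr// ltr_pMr// ltr1n.
  - by rewrite divr_gt0.
  by move=> i; apply: lt_le_trans (xyi i) _; rewrite ge_min lexx.
have yi : M < `|y ord0 i|.
  have : `|x ord0 i - y ord0 i| < 1 by apply: lt_le_trans (xyi i) _; rewrite ge_min lexx orbT.
  have := lerB_dist (x ord0 i) (y ord0 i); lra.
rewrite [e]splitr (le_trans (ler_normB _ _))// lerD// ltW// fM//.
  by apply: lt_le_trans (coord_le_enorm x i); lra.
exact: lt_le_trans (coord_le_enorm y i).
Unshelve. all: by end_near. Qed.

End C0.

Section sup_convergence.
Context {R : realType} {n : nat}.
Variable kappa : R.
Hypothesis kappa_gt : n%:R / 2 < kappa.
Local Notation mu := (lebesgue_rV R n).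
Local Notation rho_kernel := (@rho_kernel R n kappa).
Local Notation rho_conv := (@rho_conv R n kappa).
Local Notation rho_mass := (@rho_mass R n kappa).
Variable f : 'rV[R]_n -> R.
Hypotheses (mf : measurable_fun setT f) (f0 : C0 f).

(** Near x uniform continuity costs e / 2 after multiplication by the mass; the far part is bounded
    by 2 M and has weight O(t^(2 kappa - n)). Neither bound depends on x. *)
Lemma sup_cvg_rho_conv (e : R) : 0 < e ->
  \forall t \near 0^'+, forall x, `|rho_conv f t x - rho_mass * f x| <= e.
Proof.
move=> e0; have mass0 : 0 < rho_mass by exact: rho_mass_gt0.
have [M fM] := C0_bounded f0.
have M0 : 0 <= M by exact: le_trans (fM 0).
pose e1 := e / 2 / rho_mass.
have e10 : 0 < e1 by rewrite /e1 divr_gt0 ?(divr_gt0 e0).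
have [d d0 fd] := C0_uniform f0 e10.
have k2 : 0 < 2 * kappa - n%:R by move: kappa_gt; lra.
pose C := (d / (1 + d)) `^ (- kappa) * (2 * M * rho_mass).
have tC : t `^ (2 * kappa - n%:R) * C @[t --> 0^'+] --> 0 * C.
  by apply: cvgM; [exact: powR_cvg0|exact: cvg_cst].
rewrite mul0r in tC; have e2 : 0 < e / 2 by rewrite divr_gt0.
move/cvgr0Pnorm_le : tC => /(_ _ e2) tC; near=> t => x.
have t0 : 0 < t by near: t; exact: nbhs_right_gt.
have t1 : t <= 1 by near: t; exact: nbhs_right_le.
have af : admissible kappa f by exact: admissible_bounded fM.
have ac : admissible kappa (cst (f x) : 'rV[R]_n -> R).
  exact: (@admissible_bounded _ _ _ kappa_gt _ `|f x|).
have -> : rho_conv f t x - rho_mass * f x = rho_conv (f \- cst (f x)) t x.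
  by rewrite rho_convB// rho_conv_cst// mulrC.
rewrite -lee_fin; apply: le_trans (le_rho_conv _ t0 (admissibleB af ac)) _.
pose g y := if normsq (x - y) < d then 0 else f y - f x.
have mg : measurable_fun setT g.
  apply: measurable_fun_if => //; first by apply: measurable_fun_ltr => //; meas.
  - by apply: measurable_funTS; apply: measurable_funB.
have gM y : `|g y| <= 2 * M.
  rewrite /g; case: ifP => _; first by rewrite normr0 mulr_ge0.
  by rewrite (le_trans (ler_normB _ _))// mulr_natl mulr2n lerD.
have ag : admissible kappa g by exact: admissible_bounded gM.
have k0 s y : 0 < s -> 0 <= rho_kernel s (x - y) by exact: rho_kernel_ge0.
have mk s : measurable_fun setT (fun y : 'rV[R]_n => rho_kernel s (x - y)).
  exact: measurable_rho_kernel_sub.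
have mgk s : measurable_fun setT (fun y => (`|g y| * rho_kernel s (x - y))%:E).
  by apply/measurable_EFinP; apply: measurable_funM => //; exact: measurableT_comp.
apply: (@le_trans _ _ (\int[mu]_y (e1%:E * (rho_kernel t (x - y))%:E +
    (`|g y| * rho_kernel t (x - y))%:E))%E).
  apply: ge0_le_integral => //.
  - by move=> y _; rewrite lee_fin mulr_ge0// k0.
  - apply/measurable_EFinP; apply: measurable_funM => //; apply: measurableT_comp => //.
    exact: measurable_funB.
  - apply: emeasurable_funD => //; apply: emeasurable_funM => //; exact/measurable_EFinP.
  move=> y _; rewrite -EFinM -EFinD lee_fin -mulrDl ler_wpM2r ?k0//.
  rewrite /g /=; case: ifPn => xy; last by rewrite lerDr ltW.
  by rewrite normr0 addr0 distrC fd.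
rewrite ge0_integralD => [|//|y _| |y _|]; last 4 first.
- by rewrite -EFinM lee_fin mulr_ge0 ?k0// ltW.
- by apply: emeasurable_funM => //; exact/measurable_EFinP.
- by rewrite lee_fin mulr_ge0 ?k0.
- exact: mgk.
rewrite ge0_integralZl => [|//| |y _|]; last 3 first.
- exact/measurable_EFinP.
- by rewrite lee_fin k0.
- by rewrite lee_fin ltW.
rewrite integral_rho_kernel_sub// -EFinM {1}/e1 mulfVK ?gt_eqF// [e in leRHS]splitr EFinD.
apply: leeD => //.
have gfar y : normsq (x - y) < d -> g y = 0 by rewrite /g => ->.
apply: le_trans (rho_conv_far kappa_gt ag d0 t0 t1 gfar) _.
apply: (@le_trans _ _ (t `^ (2 * kappa - n%:R) * C)%:E); last first.
  by rewrite lee_fin; apply: le_trans (ler_norm _) _; near: t.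
rewrite /C mulrA [in leRHS]EFinM; apply: lee_wpmul2l; first by rewrite lee_fin mulr_ge0 ?powR_ge0.
rewrite EFinM -(integral_rho_kernel_sub kappa_gt x ltr01) -ge0_integralZl => [|//| |y _|]; last 3 first.
- exact/measurable_EFinP.
- by rewrite lee_fin k0.
- by rewrite lee_fin mulr_ge0.
apply: ge0_le_integral => //.
- by move=> y _; rewrite lee_fin mulr_ge0// k0.
- by apply: emeasurable_funM => //; exact/measurable_EFinP.
- by move=> y _; rewrite -EFinM lee_fin ler_wpM2r// k0.
Unshelve. all: by end_near. Qed.

Lemma sup_limit_rho_conv (C : R) (F : R -> 'rV[R]_n -> R) :
  (forall t x, 0 < t -> F t x = C * rho_conv f t x) ->
  sup_norm (F t \- (fun x => C * rho_mass * f x)) @[t --> 0^'+] --> 0%E.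
Proof.
move=> FE; apply: ge0_cvge0 => [t|e e0].
  by apply: ereal_sup_ge; exists `|(F t \- (fun x => C * rho_mass * f x)) 0|%:E;
    [exists 0|rewrite lee_fin].
have d0 : 0 < e / (`|C| + 1) by rewrite divr_gt0// ltr_wpDl.
have := sup_cvg_rho_conv d0; apply: filterS2 (nbhs_right_gt 0) => t t0 H.
apply: ge_ereal_sup => _ [x _ <-]; rewrite lee_fin /= FE// -mulrA -mulrBr normrM.
apply: le_trans (ler_wpM2l _ (H x)) _ => //.
by rewrite mulrCA ger_pMr// ler_pdivrMr ?ltr_wpDl// mul1r lerDl.
Qed.

End sup_convergence.

(** * Convolutions with Riesz potentials *)

Section Rintegral_total.
Context d (T : measurableType d) (R : realType) (mu : {measure set T -> \bar R}).

(** One of the two parts of f has infinite integral, so the extended difference is infinite and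
    [fine] sends it to 0. *)
Lemma Rintegral_nonintegrable (f : T -> R) : measurable_fun setT f ->
  ~ mu.-integrable setT (EFin \o f) -> \int[mu]_x f x = 0.
Proof.
move=> mf nf; have mF : measurable_fun setT (EFin \o f) by exact/measurable_EFinP.
rewrite /Rintegral integralE.
set a := integral _ _ _; set b := integral _ _ _.
have a0 : (0 <= a)%E by apply: integral_ge0 => x _; exact: funepos_ge0.
have b0 : (0 <= b)%E by apply: integral_ge0 => x _; exact: funeneg_ge0.
have ab : (a + b = +oo)%E.
  apply: contrapT => H; apply: nf; apply/integrableP; split => //.
  rewrite ltey; apply/eqP => H'; apply: H; rewrite -H' -ge0_integralD//.
  - by apply: eq_integral => x _; have /(congr1 (@^~ x)) := fune_abse (EFin \o f).
  - exact: measurable_funepos.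
  - exact: measurable_funeneg.
case: a a0 ab => [a||]//; case: b b0 => [b||]//.
Qed.

(* Where f is not integrable, both sides take the junk value 0. *)
Lemma RintegralZr_total (f : T -> R) (r : R) : measurable_fun setT f ->
  \int[mu]_x (f x * r) = (\int[mu]_x f x) * r.
Proof.
move=> mf; have [->|r0] := eqVneq r 0.
  by rewrite mulr0; under eq_Rintegral do rewrite mulr0; rewrite /Rintegral integral0.
have [fi|nfi] := pselect (mu.-integrable setT (EFin \o f)).
  by rewrite RintegralZr.
rewrite !Rintegral_nonintegrable ?mul0r//; first exact: measurable_funM.
move=> fri; apply: nfi.
have -> : EFin \o f = (fun x => (f x * r)%:E * (r^-1)%:E)%E.
  by apply/funext => x /=; rewrite -EFinM mulfK.
exact: integrableZr.
Qed.

End Rintegral_total.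

Section fubini_real.
Context d1 d2 (T1 : measurableType d1) (T2 : measurableType d2) (R : realType).
Variables (m1 : {sigma_finite_measure set T1 -> \bar R})
  (m2 : {sigma_finite_measure set T2 -> \bar R}) (k : T1 -> T2 -> R).
Hypotheses (mk : measurable_fun [set: T1 * T2] (fun z : T1 * T2 => k z.1 z.2))
  (koo : (\int[m1]_x \int[m2]_y (`|k x y|)%:E < +oo)%E).

Let K (z : T1 * T2) : \bar R := (k z.1 z.2)%:E.

Let mK : measurable_fun setT K. Proof. exact/measurable_EFinP. Qed.

Let iK : (m1 \x m2)%E.-integrable setT K.
Proof. by apply/(integrable12ltyP m1 m2 mK). Qed.

Lemma integrable_Rintegral :
  m1.-integrable setT (EFin \o (fun x => \int[m2]_y k x y)).
Proof.
have iF := integrable_fubini_F iK.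
apply/integrableP; split; first exact/measurable_EFinP/(measurable_Rintegral m2 mk).
have /integrableP[mF Foo] := iF; apply: le_lt_trans Foo.
apply: ge0_le_integral => //.
- apply: measurableT_comp => //; exact/measurable_EFinP/(measurable_Rintegral m2 mk).
- exact: measurableT_comp.
- move=> x _; rewrite /= /Rintegral /fubini_F /K /=.
  by case: (integral _ _ _) => [r||] //=; rewrite ?normr0 ?leey ?lexx.
Qed.

(** The inner integral is finite for almost every x, so passing to its real part changes nothing. *)
Lemma integral_Rintegral :
  (\int[m1]_x (\int[m2]_y k x y)%:E = \int[m1]_x \int[m2]_y (k x y)%:E)%E.
Proof.
apply: ae_eq_integral => //.
- exact/measurable_EFinP/(measurable_Rintegral m2 mk).
- exact: (measurable_int _ (integrable_fubini_F iK)).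
have := integrable_ae measurableT (integrable_fubini_F iK).
by apply: filterS => x /(_ I) + _ => /fineK.
Qed.

Lemma ae_integrable_section :
  {ae m1, forall x, m2.-integrable setT (EFin \o k x)}.
Proof. exact: (ae_integrable1 iK). Qed.

End fubini_real.

Lemma Rfubini d1 d2 (T1 : measurableType d1) (T2 : measurableType d2) (R : realType)
    (m1 : {sigma_finite_measure set T1 -> \bar R})
    (m2 : {sigma_finite_measure set T2 -> \bar R}) (k : T1 -> T2 -> R) :
  measurable_fun [set: T1 * T2] (fun z : T1 * T2 => k z.1 z.2) ->
  (\int[m1]_x \int[m2]_y (`|k x y|)%:E < +oo)%E ->
  \int[m1]_x \int[m2]_y k x y = \int[m2]_y \int[m1]_x k x y.
Proof.
move=> mk koo; rewrite [LHS]/Rintegral [RHS]/Rintegral; congr fine.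
rewrite integral_Rintegral// integral_Rintegral; last 2 first.
- apply: (measurableT_comp mk (g := fun z : T2 * T1 => (z.2, z.1))).
  exact: measurable_swap.
- move: koo; rewrite (tonelli m1 m2 (k := fun x y => (`|k x y|)%:E))//.
  by apply/measurable_EFinP; exact: measurableT_comp.
apply: (Fubini (f := fun z => (k z.1 z.2)%:E)).
by apply/integrable12ltyP => //; exact/measurable_EFinP.
Qed.

(** * Fubini for I^alpha f against functions decaying like rho^-B *)

Section riesz_fubini.
Context {R : realType} {n : nat}.
Variables (A beta : R).
Hypotheses (n_gt0 : (0 < n)%N) (A0 : 0 < A) (beta0 : 0 < beta)
  (Abeta : A + beta = n%:R / 2).
Local Notation mu := (lebesgue_rV R n).
Local Notation B := (A + 2 * beta).
Implicit Types (x y z : 'rV[R]_n) (t : R).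

Let B0 : 0 < B. Proof. by rewrite addr_gt0// mulr_gt0. Qed.

(** The rescaled case m = 0 of [riesz_rho_comb], where the combination is Gamma(B) rho^-B. The Riesz
    kernel is homogeneous of degree - 2 A, and n - 2 A = 2 beta is the power of t. *)
Lemma ge0_integral_riesz_rho : exists2 c : R, 0 <= c & forall x t, 0 < t ->
  (\int[mu]_y (normsq (x - y) `^ (- A) * rho (t^-1 *: y) `^ (- B))%:E =
   (c * t `^ (2 * beta) * rho (t^-1 *: x) `^ (- A))%:E)%E.
Proof.
pose c := pi `^ (n%:R / 2) / Gamma A * Gamma beta * Gamma A / Gamma B.
have c0 : 0 <= c.
  by rewrite !mulr_ge0 ?invr_ge0 ?powR_ge0 ?(ltW (Gamma_gt0 _)).
exists c => // x t t0.
pose F y : \bar R := (normsq (x - y) `^ (- A) * rho (t^-1 *: y) `^ (- B))%:E.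
have mF : measurable_fun setT F by rewrite /F /rho; emeas.
have F0 y : (0 <= F y)%E by rewrite lee_fin mulr_ge0 ?powR_ge0.
have := ge0_integral_rV_affine 0 (lt0r_neq0 t0) mF F0.
rewrite gtr0_norm// => /(congr1 (fun u : \bar R => (t ^+ n)%:E * u)%E).
rewrite muleA -EFinM divff ?expf_neq0 ?gt_eqF// mul1e => <-.
have [_] := riesz_rho_comb n_gt0 A0 beta0 Abeta (t^-1 *: x) 0.
rewrite addr0 => H.
have GB : Gamma B != 0 by rewrite gt_eqF// Gamma_gt0.
have RE : (\int[mu]_y (normsq (t^-1 *: x - y) `^ (- A) * rho y `^ (- B))%:E =
   (c * rho (t^-1 *: x) `^ (- A))%:E)%E.
  apply: (@eq_trans _ _ ((Gamma B)^-1%:E * \int[mu]_y (normsq (t^-1 *: x - y) `^ (- A) *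
      rho_comb beta B 0 y)%:E)%E).
    rewrite -integralZl//; last by have [] := riesz_rho_comb n_gt0 A0 beta0 Abeta (t^-1 *: x) 0.
    apply: eq_integral => y _; rewrite -EFinM /rho_comb big_ord1 subnn addr0 ffactn0 !mul1r.
    by rewrite [(Gamma B)^-1 * _]mulrCA mulKf.
  by rewrite H -EFinM; congr (_%:E); rewrite /c; ring.
rewrite (_ : (\int[mu]_x0 F (0 + t *: x0)%R)%E =
   (\int[mu]_y ((t `^ (- 2 * A))%:E * (normsq (t^-1 *: x - y) `^ (- A) * rho y `^ (- B))%:E))%E); last first.
  apply: eq_integral => y _; rewrite /F add0r scalerA mulVf ?gt_eqF// scale1r -EFinM mulrA.
  have -> : x - t *: y = t *: (t^-1 *: x - y).
    by rewrite scalerBr scalerA divff ?gt_eqF// scale1r.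
  by rewrite normsqZ powRM ?sqr_ge0 ?normsq_ge0// -powR_mulrn ?ltW// -powRrM mulrN mulNr.
rewrite ge0_integralZl => [|//| |y _|]; last 3 first.
- by rewrite /rho; emeas.
- by rewrite lee_fin mulr_ge0 ?powR_ge0.
- by rewrite lee_fin powR_ge0.
rewrite RE -!EFinM; congr (_%:E); rewrite -powR_mulrn ?ltW// mulrA -gt0_powRD//.
have -> : n%:R + - 2 * A = 2 * beta by move: Abeta; lra.
by rewrite mulrCA mulrA.
Qed.

Variables (p : R) (f : 'rV[R]_n -> R).
Hypotheses (p1 : 1 <= p) (pbeta : p * beta < n%:R / 2) (mf : measurable_fun setT f)
  (fp : (\int[mu]_y (`|f y| `^ p)%:E < +oo)%E).

(** For p = 1 the power of rho is bounded. For p > 1 Young's inequality leaves rho^-(A q), with q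
    conjugate to p, and A q > n / 2 is equivalent to p beta < n / 2. *)
Lemma Lp_integral_rho_lty x t : 0 < t ->
  (\int[mu]_z (`|f z| * rho (t^-1 *: (x - z)) `^ (- A))%:E < +oo)%E.
Proof.
move=> t0; have mfp : measurable_fun setT (fun y => (`|f y| `^ p)%:E).
  by apply/measurable_EFinP; apply: measurable_fun_powR; exact: measurableT_comp.
have mr a : measurable_fun setT (fun z : 'rV[R]_n => rho (t^-1 *: (x - z)) `^ a).
  by rewrite /rho; meas.
have mfr : measurable_fun setT (fun z => (`|f z| * rho (t^-1 *: (x - z)) `^ (- A))%:E).
  by apply/measurable_EFinP; apply: measurable_funM => //; exact: measurableT_comp.
have := p1; rewrite le_eqVlt => /predU1P[p1E|p1'].
  apply: le_lt_trans fp; apply: ge0_le_integral => //.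
  - by move=> z _; rewrite lee_fin mulr_ge0 ?powR_ge0.
  by move=> z _; rewrite lee_fin -p1E powRr1// ler_piMr// rho_powR_le1// ltW.
pose q := p / (p - 1).
have p0 : 0 < p by exact: lt_trans p1'.
have pB : 0 < p - 1 by rewrite subr_gt0.
have q0 : 0 < q by rewrite divr_gt0.
have pq : p^-1 + q^-1 = 1.
  by rewrite /q invf_div -[X in X + _]mul1r -mulrDl addrC subrK divff ?gt_eqF.
have qA : n%:R / 2 < A * q.
  rewrite /q mulrA ltr_pdivlMr// mulrBr mulr1.
  have -> : A = n%:R / 2 - beta by rewrite -Abeta addrK.
  by move: pbeta; rewrite [p * beta]mulrC mulrBl; lra.
have rE z : rho (t^-1 *: (x - z)) `^ (- (A * q)) = t ^+ n * rho_kernel (A * q) t (x - z).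
  by rewrite /rho_kernel mulVKf// expf_neq0// gt_eqF.
have tn : 0 <= t ^+ n by rewrite exprn_ge0// ltW.
apply: (@le_lt_trans _ _ (\int[mu]_z ((`|f z| `^ p)%:E +
    (t ^+ n)%:E * (rho_kernel (A * q) t (x - z))%:E))%E).
  apply: ge0_le_integral => //.
  - by move=> z _; rewrite lee_fin mulr_ge0 ?powR_ge0.
  - apply: emeasurable_funD => //; apply: emeasurable_funM => //.
    by apply/measurable_EFinP; exact: measurable_rho_kernel_sub.
  move=> z _; rewrite -EFinM -EFinD lee_fin -rE.
  apply: le_trans (conjugate_powR (normr_ge0 _) (powR_ge0 _ _) p0 q0 pq) _.
  rewrite -powRrM mulNr.
  have pV : p^-1 <= 1 by rewrite -pq lerDl invr_ge0 ltW.
  have qV : q^-1 <= 1 by rewrite -pq lerDr invr_ge0 ltW.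
  by rewrite lerD// ler_piMr ?powR_ge0.
rewrite ge0_integralD => [|//|z _| |z _|]; last 4 first.
- by rewrite lee_fin powR_ge0.
- exact: mfp.
- by rewrite -EFinM lee_fin mulr_ge0// rho_kernel_ge0.
- by apply: emeasurable_funM => //; apply/measurable_EFinP; exact: measurable_rho_kernel_sub.
rewrite ge0_integralZl => [|//| |z _|]; last 3 first.
- by apply/measurable_EFinP; exact: measurable_rho_kernel_sub.
- by rewrite lee_fin rho_kernel_ge0.
- by rewrite lee_fin.
by rewrite integral_rho_kernel_sub// lte_add_pinfty// -EFinM ltry.
Qed.

Lemma riesz_double_integral_lty x t : 0 < t ->
  (\int[mu]_y \int[mu]_z
    (`|f z| * normsq (x - y - z) `^ (- A) * rho (t^-1 *: y) `^ (- B))%:E < +oo)%E.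
Proof.
move=> t0; have [c c0 cE] := ge0_integral_riesz_rho.
rewrite (tonelli mu mu
  (k := fun y z => (`|f z| * normsq (x - y - z) `^ (- A) * rho (t^-1 *: y) `^ (- B))%:E)); last 2 first.
- apply/measurable_EFinP; rewrite /rho; apply: measurable_funM; last by meas.
  apply: measurable_funM; last by meas.
  by apply: measurableT_comp => //; exact: (measurableT_comp mf measurable_snd).
- by move=> y z; rewrite lee_fin !mulr_ge0 ?powR_ge0.
under eq_integral => z _.
  under eq_integral => y _.
    rewrite -mulrA EFinM addrAC; over.
  rewrite ge0_integralZl => [|//| |y _|]; last 3 first.
  - by rewrite /rho; emeas.
  - by rewrite lee_fin mulr_ge0 ?powR_ge0.
  - by rewrite lee_fin.
  rewrite cE// -EFinM mulrCA EFinM; over.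
rewrite ge0_integralZl => [|//| |z _|]; last 3 first.
- apply/measurable_EFinP; apply: measurable_funM; first exact: measurableT_comp.
  by rewrite /rho; meas.
- by rewrite lee_fin mulr_ge0 ?powR_ge0.
- by rewrite lee_fin mulr_ge0 ?powR_ge0.
rewrite lte_mul_pinfty ?lee_fin ?mulr_ge0 ?powR_ge0//.
exact: Lp_integral_rho_lty.
Qed.

Local Notation riesz u := (\int[mu]_z (f z * normsq (u - z) `^ (- A))).

(** The weight rho^-B is positive and independent of z: it makes the double integral finite without
    affecting the convergence of the inner one. A reflection brings it to the form of
    [riesz_double_integral_lty] at x = 0. *)
Lemma ae_integrable_riesz :
  {ae mu, forall u, mu.-integrable setT (EFin \o (fun z => f z * normsq (u - z) `^ (- A)))}.
Proof.
pose k u z := f z * normsq (u - z) `^ (- A) * rho u `^ (- B).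
have mk : measurable_fun setT (fun z : 'rV[R]_n * 'rV[R]_n => k z.1 z.2).
  rewrite /k /rho; apply: measurable_funM; last by meas.
  by apply: measurable_funM; [exact: (measurableT_comp mf measurable_snd)|meas].
have koo : (\int[mu]_u \int[mu]_z (`|k u z|)%:E < +oo)%E.
  pose G u := (\int[mu]_z (`|k u z|)%:E)%E.
  have mG : measurable_fun setT G.
    apply: (measurable_fun_integral mu (k := fun u z => (`|k u z|)%:E)) => // .
    by apply/measurable_EFinP; exact: measurableT_comp.
  rewrite -[X in (X < _)%E](ge0_integral_rV_reflect 0 mG) => [|u]; last exact: integral_ge0.
  apply: le_lt_trans (riesz_double_integral_lty 0 ltr01).
  apply: eqW; apply: eq_integral => u _.
  apply: eq_integral => z _; rewrite /k !normrM ![`|_ `^ _|]ger0_norm ?powR_ge0//.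
  by rewrite invr1 scale1r /rho sub0r normsqN.
have := ae_integrable_section mk koo; apply: filterS => u.
have r0 : rho u `^ (- B) != 0 by rewrite gt_eqF// powR_gt0// rho_gt0.
move=> ik; have -> : EFin \o (fun z => f z * normsq (u - z) `^ (- A)) =
    (fun z => (k u z)%:E * ((rho u `^ (- B))^-1)%:E)%E.
  by apply/funext => z; rewrite /= -EFinM /k mulfK.
exact: integrableZr.
Qed.

Lemma riesz_fubini x t (g : 'rV[R]_n -> R) (C : R) : 0 < t -> measurable_fun setT g ->
  (forall y, `|g y| <= C * rho (t^-1 *: y) `^ (- B)) ->
  mu.-integrable setT (EFin \o (fun y => riesz (x - y) * g y)) /\
  \int[mu]_y (riesz (x - y) * g y) =
  \int[mu]_z (f z * \int[mu]_y (normsq (x - z - y) `^ (- A) * g y)).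
Proof.
move=> t0 mg gC; pose k y z := f z * normsq (x - y - z) `^ (- A) * g y.
have mk : measurable_fun setT (fun z : 'rV[R]_n * 'rV[R]_n => k z.1 z.2).
  rewrite /k; apply: measurable_funM; last exact: (measurableT_comp mg measurable_fst).
  by apply: measurable_funM; [exact: (measurableT_comp mf measurable_snd)|meas].
have C0 : 0 <= C.
  have := le_trans (normr_ge0 _) (gC 0); rewrite pmulr_lge0// powR_gt0//.
  exact: rho_gt0.
have koo : (\int[mu]_y \int[mu]_z (`|k y z|)%:E < +oo)%E.
  have mk' : measurable_fun setT (fun z : 'rV[R]_n * 'rV[R]_n =>
      (`|f z.2| * normsq (x - z.1 - z.2) `^ (- A) * rho (t^-1 *: z.1) `^ (- B))%:E).
    apply/measurable_EFinP; rewrite /rho; apply: measurable_funM; last by meas.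
    apply: measurable_funM; last by meas.
    by apply: measurableT_comp => //; exact: (measurableT_comp mf measurable_snd).
  have k0 y z : (0 <= (`|f z| * normsq (x - y - z) `^ (- A) * rho (t^-1 *: y) `^ (- B))%:E)%E.
    by rewrite lee_fin !mulr_ge0 ?powR_ge0.
  have mI := measurable_fun_integral mu
    (k := fun y z => (`|f z| * normsq (x - y - z) `^ (- A) * rho (t^-1 *: y) `^ (- B))%:E) mk' k0.
  apply: (@le_lt_trans _ _ (\int[mu]_y (C%:E * \int[mu]_z
    (`|f z| * normsq (x - y - z) `^ (- A) * rho (t^-1 *: y) `^ (- B))%:E))%E); last first.
    rewrite ge0_integralZl => [|//|//|y _|]; last 2 first.
    - exact: integral_ge0.
    - by rewrite lee_fin.
    by rewrite lte_mul_pinfty ?lee_fin//; exact: riesz_double_integral_lty.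
  apply: ge0_le_integral => //.
  - by move=> y _; exact: integral_ge0.
  - apply: (measurable_fun_integral mu (k := fun y z => (`|k y z|)%:E)) => //.
    by apply/measurable_EFinP; exact: measurableT_comp.
  - exact: emeasurable_funM.
  move=> y _; rewrite -ge0_integralZl => [|//| |z _|]; last 3 first.
  - by apply: (measurableT_comp mk' (g := fun z => (y, z))); exact: measurable_pair1.
  - exact: k0.
  - by rewrite lee_fin.
  apply: ge0_le_integral => //.
  - apply/measurable_EFinP; apply: measurableT_comp => //.
    by apply: (measurableT_comp mk (g := fun z => (y, z))); exact: measurable_pair1.
  - apply: emeasurable_funM => //.
    by apply: (measurableT_comp mk' (g := fun z => (y, z))); exact: measurable_pair1.
  move=> z _; rewrite -EFinM lee_fin /k !normrM [`|_ `^ _|]ger0_norm ?powR_ge0//.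
  by rewrite mulrCA ler_wpM2l ?mulr_ge0 ?powR_ge0.
(* Valid for every y, including those where the potential diverges: both sides are then 0. *)
have E y : riesz (x - y) * g y = \int[mu]_z k y z.
  rewrite -RintegralZr_total//; apply: measurable_funM => //; meas.
split; first by under eq_fun do rewrite E; exact: integrable_Rintegral.
under eq_Rintegral do rewrite E.
rewrite Rfubini//; apply: eq_Rintegral => z _.
rewrite mulrC -RintegralZr_total; last by apply: measurable_funM => //; meas.
by apply: eq_Rintegral => y _; rewrite /k addrAC; ring.
Qed.

End riesz_fubini.

Lemma integral_rV_scale (R : realType) n (c : R) (G : 'rV[R]_n -> \bar R) : c != 0 ->
  (lebesgue_rV R n).-integrable setT G ->
  (\int[lebesgue_rV R n]_x G (c *: x) = (`|c| ^- n)%:E * \int[lebesgue_rV R n]_x G x)%E.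
Proof.
move=> c0 iG; have mG := measurable_int _ iG.
have scale F : measurable_fun setT F -> (forall x, 0 <= F x)%E ->
    (\int[lebesgue_rV R n]_x F (c *: x) = (`|c| ^- n)%:E * \int[lebesgue_rV R n]_x F x)%E.
  move=> mF F0; rewrite -(ge0_integral_rV_affine 0 c0 mF F0).
  by apply: eq_integral => x _; rewrite add0r.
rewrite integralE [in RHS]integralE muleBr//; last exact: integrable_add_def.
congr (_ - _)%E.
- rewrite -(scale _ (measurable_funepos mG) (funepos_ge0 _)).
  by apply: eq_integral => x _; rewrite !funeposE.
- rewrite -(scale _ (measurable_funeneg mG) (funeneg_ge0 _)).
  by apply: eq_integral => x _; rewrite !funenegE.
Qed.

Section riesz_rho_comb_conv.
Context {R : realType} {n : nat}.
Variables (A beta : R).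
Hypotheses (n_gt0 : (0 < n)%N) (A0 : 0 < A) (beta0 : 0 < beta)
  (Abeta : A + beta = n%:R / 2).
Local Notation mu := (lebesgue_rV R n).
Local Notation B := (A + 2 * beta).

Lemma Rintegral_riesz_rho_comb j (t : R) (x : 'rV[R]_n) : 0 < t ->
  \int[mu]_y (normsq (x - y) `^ (- A) * (t ^- n * rho_comb beta B j (t^-1 *: y))) =
  pi `^ (n%:R / 2) / Gamma A * Gamma beta * Gamma (A + j%:R) * t `^ (2 * beta) *
    rho_kernel (A + j%:R) t x.
Proof.
move=> t0; have [iG GE] := riesz_rho_comb n_gt0 A0 beta0 Abeta (t^-1 *: x) j.
have tV : t^-1 != 0 by rewrite invr_eq0 gt_eqF.
have iG' := integral_rV_scale tV iG.
pose G y := normsq (t^-1 *: x - y) `^ (- A) * rho_comb beta B j y.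
have HE y : normsq (x - y) `^ (- A) * (t ^- n * rho_comb beta B j (t^-1 *: y)) =
    G (t^-1 *: y) * (t ^- n * t `^ (- 2 * A)).
  have -> : x - y = t *: (t^-1 *: x - t^-1 *: y).
    by rewrite scalerBr !scalerA divff ?gt_eqF// !scale1r.
  rewrite normsqZ powRM ?sqr_ge0 ?normsq_ge0// -powR_mulrn ?(ltW t0)// -powRrM mulrN mulNr /G.
  by ring.
under eq_Rintegral do rewrite HE.
rewrite RintegralZr_total; last first.
  by rewrite /G; apply: measurable_funM; [meas|apply: (measurableT_comp (measurable_rho_comb _ _ _)); meas].
rewrite {1}/Rintegral iG' GE -EFinM /= gtr0_norm ?invr_gt0// -exprVn invrK /rho_kernel.
have -> : t `^ (2 * beta) = t ^+ n * t `^ (- 2 * A).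
  rewrite -powR_mulrn ?(ltW t0)// -gt0_powRD//; congr (_ `^ _); move: Abeta; lra.
by ring.
Qed.

Variables (p : R) (f : 'rV[R]_n -> R).
Hypotheses (p1 : 1 <= p) (pbeta : p * beta < n%:R / 2) (mf : measurable_fun setT f)
  (fp : (\int[mu]_y (`|f y| `^ p)%:E < +oo)%E).

Lemma riesz_conv_rho_comb j (t : R) (x : 'rV[R]_n) : 0 < t ->
  \int[mu]_y ((\int[mu]_z (f z * normsq (x - y - z) `^ (- A))) *
    (t ^- n * rho_comb beta B j (t^-1 *: y))) =
  pi `^ (n%:R / 2) / Gamma A * Gamma beta * Gamma (A + j%:R) * t `^ (2 * beta) *
    rho_conv (A + j%:R) f t x.
Proof.
move=> t0; have [C C0 gC] := @rho_comb_bound R n beta B j.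
pose g (y : 'rV[R]_n) := t ^- n * rho_comb beta B j (t^-1 *: y).
have mg : measurable_fun setT g.
  apply: measurable_funM; first exact: measurable_cst.
  by apply: (measurableT_comp (measurable_rho_comb _ _ _)); meas.
have tn : 0 <= t ^- n by rewrite invr_ge0 exprn_ge0// ltW.
have gC' y : `|g y| <= t ^- n * C * rho (t^-1 *: y) `^ (- B).
  by rewrite /g normrM (ger0_norm tn) -mulrA ler_wpM2l.
have [_] := riesz_fubini n_gt0 A0 beta0 Abeta p1 pbeta mf fp x t0 mg gC'.
rewrite /g => ->; under eq_Rintegral do rewrite Rintegral_riesz_rho_comb// mulrCA mulrC.
rewrite RintegralZr_total; first by rewrite mulrC.
by apply: measurable_funM => //; apply: measurable_fun_rho_kernel; meas.
Qed.

End riesz_rho_comb_conv.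

(** * Integration in the scale parameter *)

(** The fundamental theorem on a half line is available for nonnegative integrands; it is applied to
    g and to g + f, and the results are subtracted. *)
Lemma dominated_is_derive_FTC2y (R : realType) (f g F G : R -> R) (a l k : R) :
  measurable_fun setT f -> measurable_fun setT g -> (forall x, a <= x -> `|f x| <= g x) ->
  (forall x, a <= x -> {for x, continuous f}) -> (forall x, a <= x -> {for x, continuous g}) ->
  (forall x, a <= x -> is_derive x 1 F (f x)) -> (forall x, a <= x -> is_derive x 1 G (g x)) ->
  F x @[x --> +oo] --> l -> G x @[x --> +oo] --> k ->
  (lebesgue_measure.-integrable `[a, +oo[ (EFin \o f) /\
  \int[lebesgue_measure]_(x in `[a, +oo[) (f x)%:E = (l - F a)%:E)%E.
Proof.
move=> mf mg fg cf cg dF dG Fl Gk.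
have g0 x : a <= x -> 0 <= g x by move=> /fg; exact: le_trans.
have gf0 x : a <= x -> 0 <= g x + f x.
  by move=> /fg; rewrite ler_norml => /andP[+ _]; rewrite -lerBlDl sub0r.
have gE := ge0_is_derive_FTC2y g0 cg dG Gk.
have gfE : (\int[lebesgue_measure]_(x in `[a, +oo[) (g x + f x)%:E =
    (k + l - (G a + F a))%:E)%E.
  apply: (@ge0_is_derive_FTC2y _ (fun x => g x + f x) (fun x => G x + F x)) => //.
  - by move=> x ax; apply: cvgD; [exact: cg|exact: cf].
  - by move=> x ax; have := dF x ax; have := dG x ax => *; apply: is_deriveD.
  - by apply: cvgD.
have int (h : R -> R) (c : R) : measurable_fun setT h -> (forall x, a <= x -> 0 <= h x) ->
    (\int[lebesgue_measure]_(x in `[a, +oo[) (h x)%:E = c%:E)%E ->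
    lebesgue_measure.-integrable `[a, +oo[ (EFin \o h).
  move=> mh h0 hE; apply/integrableP; split.
    by apply/measurable_EFinP; exact: measurable_funTS.
  rewrite (_ : integral _ _ _ = c%:E) ?ltry// -hE; apply: eq_integral => x.
  by rewrite inE/= in_itv/= andbT => ax; rewrite ger0_norm ?h0.
have ig := int _ _ mg g0 gE.
have igf := int _ _ (measurable_funD mg mf) gf0 gfE.
have fE : EFin \o f = (fun x => (g x + f x)%:E - (g x)%:E)%E.
  by apply/funext => x /=; rewrite -EFinB addrC addKr.
split; first by rewrite fE; exact: integrableB.
transitivity (\int[lebesgue_measure]_(x in `[a, +oo[) ((g x + f x)%:E - (g x)%:E))%E.
  by apply: eq_integral => x _; rewrite -EFinB addrC addKr.
rewrite integralB//= gfE gE -EFinB; congr (_%:E); ring.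
Qed.

Section dilation_derivative.
Context {R : realType} {n : nat}.
Implicit Types (y : 'rV[R]_n) (t : R).

(** Substituting |y|^2 = (rho - 1) t^2 brings the derivative back to powers of rho. For s = 2 c only
    the power c - 1 survives. *)
Lemma is_derive_dilated_rho (s c t : R) y : 0 < t ->
  is_derive t 1 (fun t => t `^ s * rho (t^-1 *: y) `^ c)
    (t `^ (s - 1) * ((s - 2 * c) * rho (t^-1 *: y) `^ c + 2 * c * rho (t^-1 *: y) `^ (c - 1))).
Proof.
move=> t0; have tN0 := lt0r_neq0 t0.
have dV : is_derive t 1 (fun t : R => t^-1) (- t ^- 2).
  by have := is_deriveV tN0 (is_derive_id t 1); rewrite /GRing.scale/= mulr1.
pose r (u : R) : R := 1 + normsq y * (u^-1 * u^-1).
have rE u : rho (u^-1 *: y) = r u by rewrite /rho normsqZ /r mulrC expr2.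
have dr : is_derive t 1 r (- 2 * normsq y * t ^- 3).
  by rewrite /r; apply: is_derive_eq; rewrite /GRing.scale/=; field.
under eq_fun do rewrite rE; rewrite rE.
have r0 : 0 < r t by rewrite -rE rho_gt0.
have dp := is_derive1_powR c r0.
have dpr := @is_derive1_comp _ _ _ _ _ _ dp dr.
have ds := is_derive1_powR s t0.
apply: is_derive_eq; rewrite /GRing.scale/=.
have -> : t `^ s = t `^ (s - 1) * t by rewrite -{3}(powRr1 (ltW t0)) -gt0_powRD// subrK.
have -> : r t `^ c = r t `^ (c - 1) * r t by rewrite -{3}(powRr1 (ltW r0)) -gt0_powRD// subrK.
have -> : normsq y = (r t - 1) * t ^+ 2 by rewrite /r; field.
by move: (t `^ (s - 1)) (r t `^ (c - 1)) (r t) => a b u; field.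
Qed.

(** Differentiation raises beta and B but keeps m, whereas - Delta raises all three. Hence the
    dilates of - Delta w are scale derivatives of the combination of index m + 1, not of w. *)
Lemma is_derive_dilated_rho_comb (beta B t : R) m y : 0 < B -> 0 < t ->
  is_derive t 1 (fun t => t `^ (- (2 * B)) * rho_comb beta B m (t^-1 *: y))
    (- 2 * t `^ (- (2 * B) - 1) * rho_comb (beta + 1) (B + 1) m (t^-1 *: y)).
Proof.
move=> B0 t0; rewrite rho_comb_succ//.
pose c (k : 'I_m.+1) := bincoef beta k * (m ^_ k)%:R * Gamma (B + (m - k)%:R).
pose b (k : 'I_m.+1) := B + (m - k)%:R.
have -> : (fun t => t `^ (- (2 * B)) * rho_comb beta B m (t^-1 *: y)) =
    \sum_k (c k *: (fun t => t `^ (- (2 * B)) * rho (t^-1 *: y) `^ (- b k))).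
  apply/funext => u; rewrite fct_sumE /rho_comb mulr_sumr.
  by apply: eq_bigr => k _; rewrite mulrCA.
rewrite mulr_sumr.
apply: (@is_derive_sum _ _ _ _ _ _ _ (fun k : 'I_m.+1 => - 2 * t `^ (- (2 * B) - 1) *
  (c k * (b k * rho (t^-1 *: y) `^ (- (b k + 1)) - (m - k)%:R * rho (t^-1 *: y) `^ (- b k))))).
move=> k; have dk := is_derive_dilated_rho (- (2 * B)) (- b k) y t0.
apply: is_derive_eq; rewrite /GRing.scale/= (opprD (b k)).
by rewrite {1}/b; ring.
Qed.

Lemma continuous_dilated_rho_comb (s beta B t : R) m y : 0 < t ->
  {for t, continuous (fun t => t `^ s * rho_comb beta B m (t^-1 *: y))}.
Proof.
move=> t0; pose c (k : 'I_m.+1) := bincoef beta k * (m ^_ k)%:R * Gamma (B + (m - k)%:R).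
pose b (k : 'I_m.+1) := B + (m - k)%:R.
have -> : (fun t => t `^ s * rho_comb beta B m (t^-1 *: y)) =
    \sum_k (c k *: (fun t => t `^ s * rho (t^-1 *: y) `^ (- b k))).
  apply/funext => u; rewrite fct_sumE /rho_comb mulr_sumr.
  by apply: eq_bigr => k _; rewrite mulrCA.
apply: differentiable_continuous; apply/derivable1_diffP; apply: derivable_sum => k.
have dk := is_derive_dilated_rho s (- b k) y t0.
by apply: derivableZ; apply: ex_derive; exact: dk.
Qed.

Lemma cvg_dilated_rho_comb (beta B : R) m y : 0 < B ->
  t `^ (- (2 * B)) * rho_comb beta B m (t^-1 *: y) @[t --> +oo] --> 0.
Proof.
move=> B0; have [C C0 rC] := @rho_comb_bound R n beta B m.
have B2 : 0 < 2 * B by rewrite mulr_gt0.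
have H : t `^ (- (2 * B)) * C @[t --> +oo] --> 0 * C.
  by apply: cvgM; [exact: powR_cvgy0|exact: cvg_cst].
rewrite mul0r in H; apply/cvgr0Pnorm_le => d d0.
move/cvgr0Pnorm_le : H => /(_ _ d0); apply: filterS => t; apply: le_trans.
rewrite !normrM ler_wpM2l// (ger0_norm C0) (le_trans (rC _))//.
by rewrite ler_piMr// rho_powR_le1// ltW.
Qed.

Lemma measurable_dilated_rho_comb (s beta B : R) m y :
  measurable_fun setT (fun t : R => t `^ s * rho_comb beta B m (t^-1 *: y)).
Proof.
apply: measurable_funM; first exact: measurable_powR.
apply: (measurableT_comp (measurable_rho_comb _ _ _)).
by apply: measurable_fun_rVZ => //; exact: (measurable_fun_invr (g := id)).
Qed.

(** The integrand changes sign, so an absolute bound is recorded as well; its constant is uniform in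
    y and e, as the exchange of integrals requires. *)
Lemma integral_dilated_rho_comb (beta B : R) m : 0 < B -> exists2 C : R, 0 <= C & forall y (e : R), 0 < e ->
  [/\ lebesgue_measure.-integrable `[e, +oo[
       (EFin \o (fun t => t `^ (- (2 * B) - 1) * rho_comb (beta + 1) (B + 1) m (t^-1 *: y))),
      (\int[lebesgue_measure]_(t in `[e, +oo[)
         (t `^ (- (2 * B) - 1) * rho_comb (beta + 1) (B + 1) m (t^-1 *: y))%:E =
       (e `^ (- (2 * B)) * rho_comb beta B m (e^-1 *: y) / 2)%:E)%E &
      (\int[lebesgue_measure]_(t in `[e, +oo[)
         (`|t `^ (- (2 * B) - 1) * rho_comb (beta + 1) (B + 1) m (t^-1 *: y)|)%:E <=
       (C * e `^ (- (2 * B)) * rho (e^-1 *: y) `^ (- B))%:E)%E].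
Proof.
move=> B0; have [C C0 rC] := @rho_comb_bound R n (beta + 1) (B + 1) m.
have B2 : 0 < 2 * B by rewrite mulr_gt0.
have D0 : 0 <= C / (2 * B) by rewrite divr_ge0// ltW.
exists (C / (2 * B)) => // y e e0.
pose f t := t `^ (- (2 * B) - 1) * rho_comb (beta + 1) (B + 1) m (t^-1 *: y).
pose g t := C * (t `^ (- (2 * B) - 1) * rho (t^-1 *: y) `^ (- (B + 1))).
pose F t := - 2^-1 * (t `^ (- (2 * B)) * rho_comb beta B m (t^-1 *: y)).
(* An antiderivative of the majorant g: the exponents - 2 B and - B are in the ratio for which
   [is_derive_dilated_rho] leaves a single term. *)
pose G t := - (C / (2 * B)) * (t `^ (- (2 * B)) * rho (t^-1 *: y) `^ (- B)).
have e_gt0 t : e <= t -> 0 < t by exact: lt_le_trans.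
have mf : measurable_fun setT f by exact: measurable_dilated_rho_comb.
have mg : measurable_fun setT g.
  apply: measurable_funM => //; apply: measurable_funM; first exact: measurable_powR.
  apply: measurable_fun_powR; rewrite /rho; apply: measurable_funD => //.
  apply: measurable_fun_normsq; apply: measurable_fun_rVZ => //.
  exact: (measurable_fun_invr (g := id)).
have fg t : e <= t -> `|f t| <= g t.
  move=> _; rewrite /f /g normrM (ger0_norm (powR_ge0 _ _)) mulrCA ler_wpM2l ?powR_ge0//.
have cf t : e <= t -> {for t, continuous f}.
  by move=> /e_gt0 t0; exact: continuous_dilated_rho_comb.
have cg t : e <= t -> {for t, continuous g}.
  move=> /e_gt0 t0; have dk := is_derive_dilated_rho (- (2 * B) - 1) (- (B + 1)) y t0.
  have ck : {for t, continuous (fun t => t `^ (- (2 * B) - 1) * rho (t^-1 *: y) `^ (- (B + 1)))}.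
    by apply: differentiable_continuous; apply/derivable1_diffP; apply: ex_derive; exact: dk.
  by apply: cvgM; [exact: cvg_cst|exact: ck].
have dF t : e <= t -> is_derive t 1 F (f t).
  move=> /e_gt0 t0; have dk := is_derive_dilated_rho_comb beta m y B0 t0.
  by rewrite /F /f; apply: is_derive_eq; rewrite /GRing.scale/=; field.
have dG t : e <= t -> is_derive t 1 G (g t).
  move=> /e_gt0 t0; have dk := is_derive_dilated_rho (- (2 * B)) (- B) y t0.
  rewrite /G /g; apply: is_derive_eq; rewrite /GRing.scale/= opprD.
  by field; rewrite gt_eqF.
have Fl : F t @[t --> +oo] --> 0.
  rewrite -[X in _ --> X](mulr0 (- 2^-1)); apply: cvgM; first exact: cvg_cst.
  exact: cvg_dilated_rho_comb.
have Gl : G t @[t --> +oo] --> 0.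
  rewrite -[X in _ --> X](mulr0 (- (C / (2 * B)))); apply: cvgM; first exact: cvg_cst.
  apply/cvgr0Pnorm_le => d d0.
  move/cvgr0Pnorm_le : (powR_cvgy0 B2) => /(_ _ d0); apply: filterS => t; apply: le_trans.
  by rewrite normrM ler_piMr// ger0_norm ?powR_ge0// rho_powR_le1// ltW.
have [fi fE] := dominated_is_derive_FTC2y mf mg fg cf cg dF dG Fl Gl.
have gE := ge0_is_derive_FTC2y (fun t et => le_trans (normr_ge0 _) (fg t et)) cg dG Gl.
split => //; first by rewrite [LHS]fE /F; congr (_%:E); ring.
apply: (@le_trans _ _ (\int[lebesgue_measure]_(t in `[e, +oo[) (g t)%:E)%E).
  apply: ge0_le_integral => //.
  - by apply/measurable_EFinP; apply: measurable_funTS; exact: measurableT_comp.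
  - by apply/measurable_EFinP; exact: measurable_funTS.
  - by move=> t /=; rewrite in_itv/= andbT => et; rewrite lee_fin fg.
by rewrite gE lee_fin /G sub0r mulNr opprK mulrA.
Qed.

End dilation_derivative.

Section riesz_truncated.
Context {R : realType} {n : nat}.
Variables (A beta : R).
Hypotheses (n_gt0 : (0 < n)%N) (A0 : 0 < A) (beta0 : 0 < beta)
  (Abeta : A + beta = n%:R / 2).
Local Notation mu := (lebesgue_rV R n).
Local Notation leb := (@lebesgue_measure R).
Local Notation B := (A + 2 * beta).
Variables (p : R) (f : 'rV[R]_n -> R).
Hypotheses (p1 : 1 <= p) (pbeta : p * beta < n%:R / 2) (mf : measurable_fun setT f)
  (fp : (\int[mu]_y (`|f y| `^ p)%:E < +oo)%E).

Let B0 : 0 < B. Proof. by rewrite addr_gt0// mulr_gt0. Qed.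

Let r u : R := \int[mu]_z (f z * normsq (u - z) `^ (- A)).

Let mr : measurable_fun [set: 'rV[R]_n] r.
Proof.
apply: (@measurable_Rintegral _ _ 'rV[R]_n 'rV[R]_n R mu (fun u z => f z * normsq (u - z) `^ (- A))).
by apply: measurable_funM; [exact: (measurableT_comp mf measurable_snd)|meas].
Qed.

(** Exchanging the integrals in t and y reduces the truncated integral to a single convolution at
    scale e, evaluated by [riesz_conv_rho_comb]. *)
Lemma riesz_conv_truncated j (e : R) (x : 'rV[R]_n) : 0 < e ->
  let I t := (\int[mu]_y (r (x - y) * (t ^- n * rho_comb (beta + 1) (B + 1) j (t^-1 *: y))))
    / t `^ (1 + 2 * beta) in
  leb.-integrable `[e, +oo[ (EFin \o I) /\
  \int[leb]_(t in `[e, +oo[) I t =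
  pi `^ (n%:R / 2) / Gamma A * Gamma beta * Gamma (A + j%:R) / 2 * rho_conv (A + j%:R) f e x.
Proof.
move=> e0 I; have [C C0 HC] := @integral_dilated_rho_comb R n beta B j B0.
pose h (t : R) (y : 'rV[R]_n) := t `^ (- (2 * B) - 1) * rho_comb (beta + 1) (B + 1) j (t^-1 *: y).
pose k t y := if e <= t then r (x - y) * h t y else 0.
have mh : measurable_fun setT (fun z : R * 'rV[R]_n => h z.1 z.2).
  apply: measurable_funM; first by apply: measurable_fun_powR; exact: measurable_fst.
  apply: (measurableT_comp (measurable_rho_comb _ _ _)); apply: measurable_fun_rVZ.
    by apply: measurable_fun_invr; exact: measurable_fst.
  exact: measurable_snd.
have mk : measurable_fun setT (fun z : R * 'rV[R]_n => k z.1 z.2).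
  apply: measurable_fun_if => //.
  - by apply: measurable_fun_ler => //; exact: measurable_fst.
  - apply: measurable_funTS; apply: measurable_funM; last exact: mh.
    apply: (measurableT_comp mr); apply: measurable_fun_rVB; first exact: measurable_cst.
    exact: measurable_snd.
have koo : (\int[leb]_t \int[mu]_y (`|k t y|)%:E < +oo)%E.
  rewrite (tonelli leb mu (k := fun t y => (`|k t y|)%:E)) => [|//|//]; last first.
    by apply/measurable_EFinP; exact: measurableT_comp.
  (* A majorant of the integral of |h| over all scales beyond e. It decays like rho^-B, so
     [riesz_fubini] makes its product with the potential integrable. *)
  pose g (y : 'rV[R]_n) := C * e `^ (- (2 * B)) * rho (e^-1 *: y) `^ (- B).
  have g0 y : 0 <= g y by rewrite !mulr_ge0 ?powR_ge0.
  have mg : measurable_fun setT g by rewrite /g /rho; meas.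
  have [ig _] := riesz_fubini n_gt0 A0 beta0 Abeta p1 pbeta mf fp x e0 mg
    (fun y => eqW (ger0_norm (g0 y))).
  have /integrableP[_ goo] := ig; apply: le_lt_trans goo.
  apply: ge0_le_integral => //.
  - by move=> y _; exact: integral_ge0.
  - apply: (measurable_fun_integral leb (k := fun y t => (`|k t y|)%:E)) => //.
    apply/measurable_EFinP; apply: measurableT_comp => //.
    apply: (measurableT_comp mk (g := fun z : 'rV[R]_n * R => (z.2, z.1))).
    exact: measurable_swap.
  - by apply: (measurableT_comp (@abse_measurable R setT)); exact: (measurable_int _ ig).
  move=> y _; have [_ _ hC] := HC y e e0.
  rewrite /= normrM (ger0_norm (g0 y)) EFinM.
  apply: le_trans (lee_wpmul2l _ hC) => //.
  rewrite -ge0_integralZl => [|//| |t _|//]; last 2 first.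
  - apply/measurable_EFinP; apply: measurable_funTS; apply: measurableT_comp => //.
    exact: measurable_dilated_rho_comb.
  - by rewrite lee_fin.
  rewrite [leRHS]integral_mkcond; apply: eqW; apply: eq_integral => t _; rewrite patchE /k mem_setE in_itv/= andbT.
  by case: ifP => _; rewrite ?normr0// normrM EFinM.
have IE t : ((fun t => I t) \_ `[e, +oo[) t = \int[mu]_y k t y.
  rewrite patchE /k mem_setE in_itv/= andbT; case: ifPn => [et|_]; last first.
    by rewrite /Rintegral integral0.
  have t0 : 0 < t by exact: lt_le_trans et.
  rewrite /I -RintegralZr_total; last first.
    apply: measurable_funM; first by apply: (measurableT_comp mr); meas.
    apply: measurable_funM; first exact: measurable_cst.
    by apply: (measurableT_comp (measurable_rho_comb _ _ _)); meas.
  apply: eq_Rintegral => y _; rewrite /h -!mulrA; congr (_ * _).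
  rewrite mulrA mulrAC mulrC [LHS]mulrC; congr (_ * _).
  (* Since 2 B = n + 2 beta, the factor t^-n / t^(1 + 2 beta) is the power - 2 B - 1 of the scale
     derivative. *)
  rewrite -powR_mulrn ?(ltW t0)// -!powRN -gt0_powRD//; congr (_ `^ _).
  by move: Abeta; lra.
split.
  apply/integrable_mkcond => //.
  rewrite (_ : _ \_ _ = EFin \o (fun t => \int[mu]_y k t y)); first exact: integrable_Rintegral.
  by apply/funext => t /=; rewrite -IE !patchE; case: ifP.
rewrite Rintegral_mkcond; under eq_Rintegral do rewrite IE.
rewrite Rfubini//.
have kE y : \int[leb]_t k t y = r (x - y) * (e ^- n * rho_comb beta B j (e^-1 *: y)) *
    (e `^ (- (2 * beta)) / 2).
  have [hi hE _] := HC y e e0.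
  rewrite (_ : \int[leb]_t k t y = \int[leb]_(t in `[e, +oo[) (h t y * r (x - y))); last first.
    rewrite [RHS]Rintegral_mkcond; apply: eq_Rintegral => t _.
    by rewrite patchE /k mem_setE in_itv/= andbT; case: ifP; rewrite // mulrC.
  rewrite RintegralZr// [X in X * _]/Rintegral hE /=.
  have -> : e `^ (- (2 * B)) = e ^- n * e `^ (- (2 * beta)).
    rewrite -powR_mulrn ?(ltW e0)// -powRN -gt0_powRD//; congr (_ `^ _).
    by move: Abeta; lra.
  ring.
under eq_Rintegral do rewrite kE.
rewrite RintegralZr_total; last first.
  apply: measurable_funM; first by apply: (measurableT_comp mr); meas.
  apply: measurable_funM; first exact: measurable_cst.
  by apply: (measurableT_comp (measurable_rho_comb _ _ _)); meas.
rewrite (riesz_conv_rho_comb n_gt0 A0 beta0 Abeta p1 pbeta mf fp)//.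
rewrite powRN; have := powR_gt0 (2 * beta) e0; move: (e `^ _) => s s0.
by field; rewrite ?gt_eqF ?Gamma_gt0.
Qed.

End riesz_truncated.

(** * The limits *)

Section limits.
Context {R : realType} {n : nat}.
Local Notation mu := (lebesgue_rV R n).
Variables (p : R) (f : 'rV[R]_n -> R).
Hypotheses (p1 : 1 <= p) (mf : measurable_fun setT f)
  (fp : (\int[mu]_y (`|f y| `^ p)%:E < +oo)%E).

(** The common end of both formulae; the mass of the kernel is absorbed into c. *)
Lemma limits_rho_conv (kappa C c : R) (D : R -> 'rV[R]_n -> Prop) (F : R -> 'rV[R]_n -> R) :
  n%:R / 2 < kappa -> C * @rho_mass R n kappa = c ->
  (forall t x, 0 < t -> D t x /\ F t x = C * rho_conv kappa f t x) ->
  [/\ Lp_limit p F (fun x => c * f x), ae_limit D F (fun x => c * f x) &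
      C0 f -> sup_limit D F (fun x => c * f x)].
Proof.
move=> kappa_gt <- DF; have FE t x : 0 < t -> F t x = C * rho_conv kappa f t x.
  by move=> t0; have [] := DF t x t0.
split; first exact: Lp_limit_rho_conv.
  have := ae_approximated_Lp kappa_gt p1 mf fp; apply: filterS => x fx.
  split; first by move=> t t0; have [] := DF t x t0.
  have : C * @rho_conv R n kappa f t x @[t --> 0^'+] --> C * (@rho_mass R n kappa * f x).
    by apply: cvgM; [exact: cvg_cst|exact: fx].
  rewrite mulrA; apply: cvg_trans; apply: near_eq_cvg.
  by apply: filterS (nbhs_right_gt 0) => t t0; rewrite FE.
move=> f0; split; first by move=> t x t0; have [] := DF t x t0.
exact: sup_limit_rho_conv.
Qed.

End limits.

Section assembly.
Context {R : realType} {n : nat}.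
Variables (alpha p : R) (f : 'rV[R]_n -> R).
Local Notation mu := (lebesgue_rV R n).
Hypotheses (n_gt0 : (0 < n)%N) (alpha_gt0 : 0 < alpha) (alpha_lt_n : alpha < n%:R)
  (p1 : 1 <= p) (p_lt : p < n%:R / alpha) (mf : measurable_fun setT f)
  (fp : (\int[mu]_y (`|f y| `^ p)%:E < +oo)%E).
Local Notation A := ((n%:R - alpha) / 2).
Local Notation beta := (alpha / 2).
Local Notation B := (A + 2 * beta).
Local Notation riesz u := (\int[mu]_z (f z * normsq (u - z) `^ (- A))).

Let A0 : 0 < A. Proof. by rewrite divr_gt0// subr_gt0. Qed.
Let beta0 : 0 < beta. Proof. by rewrite divr_gt0. Qed.
Let Abeta : A + beta = n%:R / 2. Proof. by rewrite -mulrDl subrK. Qed.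
Let pbeta : p * beta < n%:R / 2.
Proof. by rewrite mulrA ltr_pM2r// -ltr_pdivlMr. Qed.

Lemma riesz_kernelE u z : riesz_kernel alpha f u z = f z * normsq (u - z) `^ (- A).
Proof. by rewrite /riesz_kernel enorm_powR powRN. Qed.

Lemma ae_integrable_riesz_kernel :
  {ae mu, forall x, mu.-integrable setT (EFin \o riesz_kernel alpha f x)}.
Proof.
have := ae_integrable_riesz n_gt0 A0 beta0 Abeta p1 pbeta mf fp.
apply: filterS => u; congr (integrable _ _ _).
by apply/funext => z; rewrite /= riesz_kernelE.
Qed.

Lemma wavelet_rho_comb m j : (m <= j)%N ->
  iter j (@neg_laplacian R n)
    (fun x : 'rV[R]_n => (1 + enorm x ^+ 2) `^ (m%:R - (n%:R + alpha) / 2)) =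
  (fun y => 4 ^+ j / Gamma (B - m%:R) * rho_comb (beta + (j - m)%:R) (B + (j - m)%:R) j y).
Proof.
move=> mj; rewrite -iter_neg_laplacian_rho_comb//; last 2 first.
- by lra.
- by rewrite addr_gt0// mulr_gt0.
congr iter; apply/funext => y; rewrite enorm_sqr /rho; congr (_ `^ _); lra.
Qed.

(** Both wavelets are covered: B' = B for w and B' = B + 1 for its negative Laplacian, whose decay
    is only better. *)
Lemma convolution_riesz_potential (b' B' K t : R) j x : 0 < t -> B <= B' ->
  convolution_exists (riesz_potential alpha f)
    (fun y => K * (t ^- n * rho_comb b' B' j (t^-1 *: y))) x /\
  convolution (riesz_potential alpha f)
    (fun y => K * (t ^- n * rho_comb b' B' j (t^-1 *: y))) x =
  (riesz_gamma n alpha)^-1 * K *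
    \int[mu]_y (riesz (x - y) * (t ^- n * rho_comb b' B' j (t^-1 *: y))).
Proof.
move=> t0 BB'; have [C C0 rC] := @rho_comb_bound R n b' B' j.
pose g (y : 'rV[R]_n) := t ^- n * rho_comb b' B' j (t^-1 *: y).
have mg : measurable_fun setT g.
  apply: measurable_funM; first exact: measurable_cst.
  by apply: (measurableT_comp (measurable_rho_comb _ _ _)); meas.
have tn : 0 <= t ^- n by rewrite invr_ge0 exprn_ge0// ltW.
have gC y : `|g y| <= t ^- n * C * rho (t^-1 *: y) `^ (- B).
  rewrite /g normrM (ger0_norm tn) -mulrA ler_wpM2l// (le_trans (rC _))// ler_wpM2l//.
  by rewrite ler_powR ?rho_ge1// lerN2.
have [ig _] := riesz_fubini n_gt0 A0 beta0 Abeta p1 pbeta mf fp x t0 mg gC.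
have E y : riesz_potential alpha f (x - y) * (K * g y) =
    riesz (x - y) * g y * ((riesz_gamma n alpha)^-1 * K).
  rewrite /riesz_potential; under eq_Rintegral do rewrite riesz_kernelE.
  by ring.
split.
  rewrite /convolution_exists (_ : EFin \o _ = (fun y => (riesz (x - y) * g y)%:E *
    ((riesz_gamma n alpha)^-1 * K)%:E)%E); first exact: integrableZr.
  by apply/funext => y; rewrite /= -EFinM -E.
rewrite /convolution; under eq_Rintegral do rewrite E.
by rewrite RintegralZr// mulrC.
Qed.

End assembly.

Theorem theoremA (R : realType) (n : nat) (alpha : R) (m : nat) (p : R)
    (f : 'rV[R]_n -> R)
    (n_ge1 : (1 <= n)%N)
    (alpha_gt0 : 0 < alpha) (alpha_lt_n : alpha < n%:R)
    (alpha_lt_2m : alpha < 2 * m%:R)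
    (p_ge1 : 1 <= p) (p_lt : p < n%:R / alpha)
    (f_Lp : f \in Lfun (lebesgue_rV R n) p%:E) :
  let If := riesz_potential alpha f in
  let w : 'rV[R]_n -> R := wavelet alpha m in
  let w' := neg_laplacian w in
  let c := riesz_gamma n (2 * m%:R - alpha) in
  let d := (2 * m%:R - alpha) * c in
  let w_scaled t := fun x => t `^ (- alpha) * dilate t w x in
  let approx t := convolution If (w_scaled t) in
  let approx_exists t x := convolution_exists If (w_scaled t) x in
  let integrand x t := convolution If (dilate t w') x / t `^ (1 + alpha) in
  let truncated e x := \int[lebesgue_measure]_(t in `[e, +oo[) integrand x t in
  let truncated_exists e x :=
    (forall t, e <= t -> convolution_exists If (dilate t w') x) /\
    lebesgue_measure.-integrable `[e, +oo[ (EFin \o integrand x) in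
  [/\ {ae lebesgue_rV R n, forall x, (lebesgue_rV R n).-integrable setT
        (EFin \o riesz_kernel alpha f x)},
      [/\ Lp_limit p approx (fun x => c * f x),
          ae_limit approx_exists approx (fun x => c * f x) &
          C0 f -> sup_limit approx_exists approx (fun x => c * f x)] &
      [/\ Lp_limit p truncated (fun x => d * f x),
          ae_limit truncated_exists truncated (fun x => d * f x) &
          C0 f -> sup_limit truncated_exists truncated (fun x => d * f x)]].
Proof.
move=> If w w' c d w_scaled approx approx_exists integrand truncated truncated_exists.
pose A : R := (n%:R - alpha) / 2; pose beta : R := alpha / 2; pose B := A + 2 * beta.
have [mf fp] : measurable_fun setT f /\ (\int[lebesgue_rV R n]_y (`|f y| `^ p)%:E < +oo)%E.
  move: f_Lp => /andP[]; rewrite !inE/= => mf; rewrite /finite_norm unlock => fp; split => //.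
  have p0 : p^-1 != 0 by rewrite invr_eq0 gt_eqF// (lt_le_trans _ p_ge1).
  exact: lty_poweRy p0 fp.
have A0 : 0 < A by rewrite divr_gt0// subr_gt0.
have beta0 : 0 < beta by rewrite divr_gt0.
have Abeta : A + beta = n%:R / 2 by rewrite -mulrDl subrK.
have mbeta : beta < m%:R by rewrite /beta; lra.
have pbeta : p * beta < n%:R / 2 by rewrite mulrA ltr_pM2r// -ltr_pdivlMr.
have am : alpha = 2 * beta by rewrite /beta; lra.
have GA : Gamma A != 0 by rewrite gt_eqF// Gamma_gt0.
have Gb : Gamma beta != 0 by rewrite gt_eqF// Gamma_gt0.
have pin : pi `^ (n%:R / 2) != 0 :> R by rewrite gt_eqF// powR_gt0// pi_gt0.
have a2 : 2 `^ alpha != 0 :> R by rewrite gt_eqF// powR_gt0.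
have gammaE : riesz_gamma n alpha = 2 `^ alpha * pi `^ (n%:R / 2) * Gamma beta / Gamma A by [].
have wE : w = (fun y => 4 ^+ m / Gamma (B - m%:R) * rho_comb beta B m y).
  by rewrite /w /wavelet wavelet_rho_comb// subnn !addr0.
have w'E : w' = (fun y => 4 ^+ m.+1 / Gamma (B - m%:R) * rho_comb (beta + 1) (B + 1) m.+1 y).
  by rewrite /w' /w /wavelet -iterS wavelet_rho_comb// subSnn.
have cE : c = 2 `^ (- alpha) * 4 ^+ m * pi `^ (n%:R / 2) * Gamma (m%:R - beta) / Gamma (B - m%:R).
  rewrite /c /riesz_gamma.
  have -> : (2 * m%:R - alpha) / 2 = m%:R - beta by rewrite /beta; lra.
  have -> : (n%:R - (2 * m%:R - alpha)) / 2 = B - m%:R by rewrite /B /A /beta; lra.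
  rewrite [2 * m%:R - alpha]addrC gt0_powRD// powRrM powR_mulrn//.
  by rewrite (powR_mulrn 2) -?natrX.
split; first exact: (ae_integrable_riesz_kernel n_ge1 alpha_gt0 alpha_lt_n p_ge1 p_lt mf fp).
- apply: (limits_rho_conv p_ge1 mf fp (kappa := A + m%:R)
    (C := 2 `^ (- alpha) * 4 ^+ m / Gamma (B - m%:R) * Gamma (A + m%:R))).
  + by rewrite -Abeta ltrD2l.
  + have G0 : Gamma (A + m%:R) != 0 by rewrite gt_eqF// Gamma_gt0// ltr_wpDr.
    rewrite /rho_mass (_ : A + m%:R - n%:R / 2 = m%:R - beta); last by rewrite -Abeta; ring.
    (* [Gamma (B - m%:R)] is 0 at a pole, so its inverse is generalized before [field] can ask for
       it to be nonzero. *)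
    by rewrite cE; move: (Gamma (B - m%:R))^-1 => g; field.
  move=> t x t0.
  have wsE : w_scaled t = (fun y => t `^ (- alpha) * (4 ^+ m / Gamma (B - m%:R)) *
      (t ^- n * rho_comb beta B m (t^-1 *: y))).
    by apply/funext => y; rewrite /w_scaled /dilate wE; ring.
  have [ex E] := convolution_riesz_potential n_ge1 alpha_gt0 alpha_lt_n p_ge1 p_lt mf fp
    beta (t `^ (- alpha) * (4 ^+ m / Gamma (B - m%:R))) m x t0 (lexx B).
  rewrite /approx_exists /approx wsE; split => //; rewrite E.
  rewrite (riesz_conv_rho_comb n_ge1 A0 beta0 Abeta p_ge1 pbeta mf fp)//.
  have ta : t `^ alpha != 0 by rewrite gt_eqF// powR_gt0.
  rewrite gammaE !powRN -am; move: (Gamma (B - m%:R))^-1 => g.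
  by field; rewrite ta Gb pin a2 GA.
apply: (limits_rho_conv p_ge1 mf fp (kappa := A + m.+1%:R)
  (C := 2 `^ (- alpha) * 4 ^+ m.+1 / Gamma (B - m%:R) * Gamma (A + m.+1%:R) / 2)).
- by rewrite -Abeta ltrD2l (lt_le_trans mbeta)// ler_nat.
- have G0 : Gamma (A + m.+1%:R) != 0 by rewrite gt_eqF// Gamma_gt0// ltr_wpDr.
  rewrite /rho_mass (_ : A + m.+1%:R - n%:R / 2 = m%:R - beta + 1); last first.
    by rewrite -Abeta -[m.+1%:R]natr1; ring.
  (* The mass of the kernel now contains Gamma(m - beta + 1) = (m - beta) Gamma(m - beta). With the
     additional factor 4 and the 1 / 2 from the scale integral this yields 2 (m - beta) = 2 m -
     alpha. *)
  rewrite GammaS ?subr_gt0// /d cE {2}am exprS; move: (Gamma (B - m%:R))^-1 => g.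
  by field.
move=> e x e0.
have dwE t : dilate t w' = (fun y => 4 ^+ m.+1 / Gamma (B - m%:R) *
    (t ^- n * rho_comb (beta + 1) (B + 1) m.+1 (t^-1 *: y))).
  by apply/funext => y; rewrite /dilate w'E mulrCA.
have B1 : B <= B + 1 by rewrite lerDl.
have conv t (t0 : 0 < t) := convolution_riesz_potential n_ge1 alpha_gt0 alpha_lt_n
  p_ge1 p_lt mf fp (beta + 1) (4 ^+ m.+1 / Gamma (B - m%:R)) m.+1 x t0 B1.
have := riesz_conv_truncated n_ge1 A0 beta0 Abeta p_ge1 pbeta mf fp m.+1 x e0.
cbv zeta; set I := (I in (EFin \o I)) => -[iI IE].
pose K := (riesz_gamma n alpha)^-1 * (4 ^+ m.+1 / Gamma (B - m%:R)).
have integrandE t : e <= t -> integrand x t = K * I t.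
  move=> et; have t0 : 0 < t by exact: lt_le_trans et.
  have [_ E] := conv t t0; rewrite /integrand dwE E /I -/K -mulrA; congr (_ * (_ / _)).
  by rewrite am.
have inE' t : t \in `[e, +oo[%classic -> e <= t.
  by rewrite inE/= in_itv/= andbT.
split; first split.
- by move=> t et; rewrite dwE; have [] := conv t (lt_le_trans e0 et).
- apply: (eq_integrable _ _ _ _ (integrableZl _ K iI)) => //.
  by move=> t /inE' et; rewrite /= integrandE// EFinM.
rewrite /truncated; under eq_Rintegral => t /inE' et do rewrite integrandE//.
rewrite RintegralZl// IE /K gammaE powRN; move: (Gamma (B - m%:R))^-1 => g.
by field; rewrite Gb pin a2 GA.
Qed.
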